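(* Let $d\ge 2$ and $n\ge 2$ be integers. There exists a continuous $\mathfrak S_n$-equivariant map \[ F(\mathbb R^d,n)\longrightarrow S\big(W_n^{\oplus(d-1)}\big) \] if and only if $n$ is not a prime power.
   Context: $F(\mathbb R^d,n)$ denotes the configuration space of $n$ labeled points in $\mathbb R^d$, i.e. the set of all real $d\times n$ matrices $(x_1,\dots,x_n)$ with pairwise distinct columns $x_j\in\mathbb R^d$. $W_n=\{(y_1,\dots,y_n)\in\mathbb R^n: y_1+\dots+y_n=0\}$, and $W_n^{\oplus k}$ denotes the space of real $k\times n$ matrices each of whose rows lies in $W_n$ (equivalently, whose columns sum to the zero vector). $S(V)$ denotes the unit sphere of a Euclidean space $V$ (for $W_n^{\oplus k}$: matrices in $W_n^{\oplus k}$ whose squared entries sum to $1$). The symmetric group $\mathfrak S_n$ acts on $F(\mathbb R^d,n)$ and on $W_n^{\oplus k}$ (hence on $S(W_n^{\oplus k})$) by permuting the columns. A prime power means $p^k$ with $p$ prime and $k\ge 1$. *)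

(* Defs.v *)
From Stdlib Require Import Reals.
From mathcomp Require Import all_boot all_fingroup.
Set Implicit Arguments. Unset Strict Implicit. Unset Printing Implicit Defensive.

Definition mat (k n : nat) := 'I_k -> 'I_n -> R.

Definition Rsum (m : nat) (F : 'I_m -> R) : R :=
  \big[Rplus/R0]_(i < m) F i.

Definition in_conf (d n : nat) (x : mat d n) : Prop :=
  forall j1 j2 : 'I_n, j1 <> j2 -> exists i : 'I_d, x i j1 <> x i j2.

Definition in_sphere_W (k n : nat) (y : mat k n) : Prop :=
  (forall i : 'I_k, Rsum (fun j => y i j) = R0) /\
  Rsum (fun i => Rsum (fun j => Rmult (y i j) (y i j))) = R1.

Definition col_perm (k n : nat) (s : 'S_n) (x : mat k n) : mat k n :=
  fun i j => x i (s j).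

(* Continuity on F(R^d,n) (sup-norm on entries; equivalent to the Euclidean
   topology of R^{k x n}). *)
Definition continuous_on_conf (d n k : nat) (f : mat d n -> mat k n) : Prop :=
  forall x : mat d n, in_conf x ->
  forall eps : R, Rlt R0 eps -> exists delta : R, Rlt R0 delta /\
    forall y : mat d n, in_conf y ->
      (forall i j, Rlt (Rabs (Rminus (y i j) (x i j))) delta) ->
      forall i j, Rlt (Rabs (Rminus (f y i j) (f x i j))) eps.

Definition equivariant_on_conf (d n k : nat) (f : mat d n -> mat k n) : Prop :=
  forall (s : 'S_n) (x : mat d n), in_conf x ->
    forall i j, f (col_perm s x) i j = col_perm s (f x) i j.

Definition prime_power (n : nat) : Prop :=
  exists p k : nat, prime p /\ (1 <= k)%N /\ n = (p ^ k)%N.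

(* Main.v *)
(* Nonexistence for n = p^e.  On a large cube, interpolate between the identity u |-> u and
   u |-> f(u, h(u)), where the heights h separate points of u that are close; take a fine Kuhn
   triangulation and label a vertex by a negative entry of the interpolated matrix, chosen
   compatibly with permutations.  By a discrete Stokes formula the signed count of completely
   labelled boundary simplices vanishes.  There are none at the end given by f, which has no zeros,
   and exactly one at the end given by the identity.  On the lateral faces the points split into
   two distant clusters, and permutations preserving the order inside each cluster group the
   simplices into families of size C(n,i) with 0 < i < n, a multiple of p; so p would divide 1.

   Existence for n not a prime power.  Then 1 + sum_(3 <= i < n) a_i C(n,i) = 0 for some integers
   a_i.  In the plane write a configuration as (u,t), and rescale u by the inverse of the minimal
   distance, so that points which are close in u are ordered by t.  Start with the field u on W_n,
   and for every i insert |a_i| small spheres, of sign a_i, around configurations u consisting of a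
   cluster of i points followed by a cluster of n - i points, together with their images under the
   C(n,i) shuffles; for |u| >= 1 no zero is created.  The restriction of the field to the unit
   sphere of W_n has total degree 0, so it extends over the unit ball without zeros: spheres of
   opposite signs are cancelled in pairs, along great arcs.  The order given by t extends all this
   to an equivariant nowhere zero field on F(R^2,n).  For d > 2, multiplied by the minimal distance
   it is defined for all x_1, x_2, and the remaining rows, centred, are stacked below it. *)
Require Import Defs.
From Stdlib Require Import Reals.
From HB Require Import structures.
From mathcomp Require Import all_classical all_reals all_analysis Rstruct Rstruct_topology.
From mathcomp Require Import all_boot all_order all_fingroup all_algebra.
From mathcomp Require Import zify ring lra.
Set Implicit Arguments. Unset Strict Implicit. Unset Printing Implicit Defensive.
Import Order.TTheory GRing.Theory Num.Theory.
Import numFieldNormedType.Exports.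

(** * Binomial coefficients and shuffles *)

(** Both halves rest on one count. The heights order close points by their indices, so u |-> (u,
    h(u)) commutes only with permutations that keep the order inside every group of close points.
    Two distant clusters of i and n - i points then leave exactly the C(n,i) shuffles. In the first
    half they make each lateral contribution a multiple of C(n,i); in the second a sphere can only
    be inserted together with all its shuffles, which changes the degree by C(n,i) up to sign. The
    greatest common divisor of the C(n,i), 0 < i < n, is p for a power of p and 1 otherwise, and
    this decides the question. The relation starts at i = 3 because an inserted isometry of
    determinant 1 needs an axis orthogonal to the centre of its sphere, and the axis used is
    supported on three points of the left cluster; the divisor has to be 1 for these i already.
    Degrees are never defined: signed counts of labelled simplices replace them in the first half,
    determinants of isometries in the second. *)

Lemma coef_binomial_poly (A : comNzRingType) n i :
  (((1 + 'X : {poly A}) ^+ n)`_i = 'C(n, i)%:R)%R.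
Proof.
rewrite exprDn coef_sum; case: (leqP i n) => [le_in | lt_ni].
  rewrite (bigD1 (Ordinal (le_in : (i < n.+1)%N))) //= expr1n mul1r coefMn coefXn eqxx.
  rewrite big1 ?addr0 ?mulr1n //= => j jDi; rewrite expr1n mul1r coefMn coefXn.
  by rewrite (_ : (i == j) = false) ?mul0rn //; apply: contra_neqF jDi => /eqP e; apply: val_inj.
rewrite bin_small // big1 // => j _; rewrite expr1n mul1r coefMn coefXn.
by rewrite (_ : (i == j) = false) ?mul0rn //; apply/eqP => e; move: (ltn_ord j); rewrite -e; lia.
Qed.

Lemma binomial_poly_Fp p e (pr_p : prime p) :
  ((1 + 'X : {poly 'F_p}) ^+ (p ^ e) = 1 + 'X^(p ^ e))%R.
Proof.
rewrite exprDn_pchar ?expr1n //.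
have pc : p \in [pchar {poly 'F_p}]%R by rewrite pchar_poly; exact: pchar_Fp.
by rewrite pnatX (eq_pnat _ (pcharf_eq pc)) pnat_id ?orbT.
Qed.

Lemma dvdn_natrFp p m (pr_p : prime p) : (p %| m) = (m%:R == 0 :> 'F_p)%R.
Proof. by rewrite -(dvdn_pcharf (pchar_Fp pr_p)). Qed.

(** Modulo p the polynomial (1 + X)^(p^e) is 1 + X^(p^e), so no middle coefficient survives. *)
Lemma prime_dvd_bin_expn p e i : prime p -> 0 < i < p ^ e -> p %| 'C(p ^ e, i).
Proof.
move=> pr_p /andP[i_gt0 i_lt]; rewrite dvdn_natrFp //.
rewrite -coef_binomial_poly binomial_poly_Fp // coefD coef1 coefXn.
by rewrite gtn_eqF // [i == _]ltn_eqF // addr0.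
Qed.

(** Modulo p, (1 + X)^(p^e q) = (1 + X^(p^e))^q, and its coefficient at X^(p^e) is q. *)
Lemma prime_ndvd_bin_expn p e q : prime p -> ~~ (p %| q) -> ~~ (p %| 'C(p ^ e * q, p ^ e)).
Proof.
move=> pr_p pq; rewrite dvdn_natrFp // -coef_binomial_poly exprM binomial_poly_Fp //.
have pe_gt0 : 0 < p ^ e by rewrite expn_gt0 prime_gt0.
rewrite exprDn coef_sum; case: q pq => [|q pq]; first by rewrite dvdn0.
rewrite (bigD1 (inord 1)) //= inordK // expr1n mul1r expr1 coefMn coefXn eqxx bin1.
rewrite big1 ?addr0 -?dvdn_natrFp // => j jD1; rewrite expr1n mul1r -exprM coefMn coefXn.
rewrite (_ : (p ^ e == p ^ e * j) = false) ?mul0rn //.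
apply: contra_neqF jD1 => /eqP; rewrite -{1}[p ^ e]muln1 => /eqP; rewrite eqn_pmul2l // => /eqP e1.
by apply: val_inj; rewrite /= inordK.
Qed.

Lemma bezout_big n (F : nat -> nat) :
  exists a : nat -> int, ((\big[gcdn/0]_(i < n) F i)%:Z = \sum_(i < n) a i * (F i)%:Z)%R.
Proof.
elim: n => [|n [a IHn]]; first by exists (fun=> 0%R); rewrite !big_ord0.
have [u [v uv]] := Bezoutz (\big[gcdn/0]_(i < n) F i)%:Z (F n)%:Z.
exists (fun i => if i == n then v else (u * a i)%R).
rewrite !big_ord_recr /= eqxx -[RHS]/(_ + _)%R.
transitivity (gcdz (\big[gcdn/0]_(i < n) F i)%:Z (F n)%:Z); first by [].
rewrite -uv IHn mulr_sumr; congr (_ + _)%R; apply: eq_bigr => i _.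
by rewrite ltn_eqF // mulrA.
Qed.

(** Suppose a prime p divides all C(n,i) with 3 <= i < n, and write n = p^e q with p not dividing q.
    Then q >= 2, as n is not a prime power, and C(n,p^e) = C(n,n - p^e) is prime to p. So the common
    divisor is 1 and Bezout applies. *)
Lemma not_prime_power_comb n : 2 <= n ->
    ~ (exists p k : nat, prime p /\ (1 <= k) /\ n = p ^ k) ->
  6 <= n /\ exists a : nat -> int, (1 + \sum_(i < n | (3 <= i)%N) a i * ('C(n, i))%:Z = 0)%R.
Proof.
move=> n2 npp.
have n6 : 6 <= n.
  rewrite leqNgt; apply/negP => n5; apply: npp.
  have : n \in [:: 2; 3; 4; 5] by rewrite !inE; lia.
  rewrite !inE => /or4P[]/eqP->;
    [exists 2, 1|exists 3, 1|exists 2, 2|exists 5, 1]; by [].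
split=> //.
pose F i := if 3 <= i then 'C(n, i) else 0.
have [a ea] := bezout_big n F.
suff g1 : \big[gcdn/0]_(i < n) F i = 1.
  exists (fun i => - a i)%R; rewrite big_mkcond /=.
  have -> : (\sum_(i < n) (if (2 < i)%N then - a i * ('C(n,
    i))%:Z else 0) = - (\sum_(i < n) a i * (F i)%:Z))%R.
    by rewrite -sumrN; apply: eq_bigr => i _; rewrite /F; case: ifP => _; rewrite ?mulr0 ?oppr0 ?mulNr.
  by rewrite -ea g1.
apply/eqP; apply: contraT => gN1.
have g_gt0 : 0 < \big[gcdn/0]_(i < n) F i.
  by rewrite (bigD1 (Ordinal (n6 : 5 < n))) //= gcdn_gt0 /F /= bin_gt0 ltnW.
have [p pr_p pg] : exists2 p, prime p & p %| \big[gcdn/0]_(i < n) F i.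
  exists (pdiv (\big[gcdn/0]_(i < n) F i)); rewrite ?pdiv_dvd // pdiv_prime //.
  by rewrite ltn_neqAle eq_sym gN1.
have pF i : 3 <= i < n -> p %| 'C(n, i).
  move=> /andP[i3 i_lt]; have := pg; rewrite (bigD1 (Ordinal i_lt)) //= /F i3 dvdn_gcd.
  by case/andP.
set e := logn p n.
have n0 : 0 < n by lia.
have nE : n = p ^ e * (n %/ p ^ e) by rewrite mulnC divnK // pfactor_dvdnn.
have pq : ~~ (p %| n %/ p ^ e).
  apply/negP => /dvdnP[c ec].
  have : p ^ e.+1 %| n by rewrite nE ec expnS mulnCA dvdn_mull // mulnC.
  by rewrite pfactor_dvdn // ltnn.
have pe_gt0 : 0 < p ^ e by rewrite expn_gt0 prime_gt0.
have q2 : 2 <= n %/ p ^ e.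
  case eq_q: (n %/ p ^ e) pq nE => [|[|//]] pq nE; first by rewrite nE muln0 in n0.
  case: npp; exists p, e; split => //; split; last by rewrite {1}nE muln1.
  by case: (e) nE n6 => [|//]; rewrite muln1 expn0 => ->.
have le_pe : p ^ e * 2 <= n by rewrite nE leq_pmul2l.
(* The index [p ^ e] may be 1 or 2, outside the range; its complement is at least n/2 >= 3. *)
have := prime_ndvd_bin_expn e pr_p pq; rewrite -nE -bin_sub; last by lia.
by rewrite pF //; lia.
Qed.

Lemma enum_ord_ltn_sorted n (A : {set 'I_n}) : sorted (fun a b : 'I_n => a < b) (enum A).
Proof.
have -> : enum A = filter (mem A) (enum 'I_n) by rewrite [in RHS]enumT.
apply: sorted_filter; first by move=> a b c; exact: ltn_trans.
by have := iota_ltn_sorted 0 n; rewrite -val_enum_ord sorted_map.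
Qed.

Definition increasing_on n (A : {set 'I_n}) (s : 'S_n) :=
  {in A &, forall a b : 'I_n, a < b -> s a < s b}.

(** The increasing enumerations of [A] and of its complement are carried to those of [A'] and of its
    complement. *)
Lemma exists_shuffle n (A A' : {set 'I_n}) : #|A| = #|A'| ->
  exists s : 'S_n, [/\ s @: A = A', increasing_on A s & increasing_on (~: A) s].
Proof.
case: n A A' => [|n] A A' cA.
  by exists 1%g; split=> [|[]//|[]//]; apply/setP => - [].
pose tr (C D : {set 'I_n.+1}) x := nth ord0 (enum D) (index x (enum C)).
have tr_in (C D : {set 'I_n.+1}) x : #|C| = #|D| -> x \in C -> tr C D x \in D.
  by move=> cD xC; rewrite -mem_enum mem_nth // -cardE -cD cardE index_mem mem_enum.
have tr_mono (C D : {set 'I_n.+1}) : #|C| = #|D| -> {in C &, forall a b : 'I_n.+1, a < b ->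
  tr C D a < tr C D b}.
  move=> cD a b aC bC ab; apply: (sorted_ltn_nth (leT := fun a b : 'I_n.+1 => a < b)).
  - by move=> ? ? ?; exact: ltn_trans.
  - exact: enum_ord_ltn_sorted.
  - by rewrite inE -cardE -cD cardE index_mem mem_enum.
  - by rewrite inE -cardE -cD cardE index_mem mem_enum.
  rewrite ltnNge leq_eqVlt; apply/norP; split.
    apply: contraTneq ab => eba; suff -> : a = b by rewrite ltnn.
    by rewrite -(nth_index a (s := enum C) (x := a)) ?mem_enum // -eba nth_index ?mem_enum.
  apply: contraTN ab => ba; rewrite -leqNgt ltnW //.
  have tr3 : transitive (fun a b : 'I_n.+1 => a < b) by move=> ? ? ?; exact: ltn_trans.
  by apply: (sorted_ltn_index tr3 (enum_ord_ltn_sorted C)) ba; rewrite mem_enum.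
have cC : #|~: A| = #|~: A'| by have := cardsC A; rewrite -(cardsC A') cA => /eqP;
  rewrite eqn_add2l => /eqP.
pose f x := if x \in A then tr A A' x else tr (~: A) (~: A') x.
have fA x : (f x \in A') = (x \in A).
  rewrite /f; case: ifPn => xA; first exact: tr_in.
  by apply/negbTE; rewrite -in_setC tr_in // in_setC.
have tr_inj (C D : {set 'I_n.+1}) : #|C| = #|D| -> {in C &, injective (tr C D)}.
  move=> cD a b aC bC e; case: (ltngtP a b) => [ab|ba|/val_inj//].
  - by have := tr_mono _ _ cD _ _ aC bC ab; rewrite e ltnn.
  - by have := tr_mono _ _ cD _ _ bC aC ba; rewrite e ltnn.
have f_inj : injective f.
  move=> x y exy; have := fA x; rewrite exy fA => xyA.
  move: exy; rewrite /f xyA; case: ifPn => xA e; first by apply: (tr_inj A A' cA) => //; rewrite xyA.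
  by apply: (tr_inj (~: A) (~: A') cC) => //; rewrite in_setC ?xyA.
exists (perm f_inj); split.
- apply/eqP; rewrite eqEcard card_imset ?cA ?leqnn ?andbT; last exact: perm_inj.
  by apply/subsetP => _ /imsetP[x xA ->]; rewrite permE fA.
- by move=> a b aA bA ab; rewrite !permE /f aA bA; apply: tr_mono.
by move=> a b aA bA ab; rewrite !permE /f; move: (aA) (bA); rewrite !in_setC => /negPf-> /negPf->;
  apply: tr_mono.
Qed.

(** * Sums invariant under the shuffles of two clusters *)

Section ClusterSum.
Variables (n p e : nat) (X : finType) (P : pred X) (T : X -> int) (cl : X -> {set 'I_n})
  (act : 'S_n -> X -> X).
Hypotheses (pr_p : prime p) (nE : n = p ^ e).
Hypothesis actK : forall s, cancel (act s) (act s^-1%g).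
Hypothesis T_triv : forall x, P x -> cl x = set0 \/ cl x = setT -> T x = 0%R.
Hypothesis act_cl : forall s x, P x -> increasing_on (cl x) s -> increasing_on (~: cl x) s ->
  [/\ P (act s x), cl (act s x) = s @: cl x & T (act s x) = T x].

(** A shuffle carrying [A] to [A'] transports the terms; its inverse is increasing on [A'] and on
    the complement, so it transports them back. *)
Lemma sum_cluster_eq (A A' : {set 'I_n}) : #|A| = #|A'| ->
  (\sum_(x | P x && (cl x == A)) T x = \sum_(x | P x && (cl x == A')) T x)%R.
Proof.
move=> cA; have [s [sA iA iAc]] := exists_shuffle cA.
have incV (B : {set 'I_n}) : increasing_on B s -> increasing_on (s @: B) s^-1%g.
  move=> iB _ _ /imsetP[a aB ->] /imsetP[b bB ->]; rewrite !permK => ab.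
  case: (ltngtP a b) => // [ba|/val_inj abE]; last by rewrite abE ltnn in ab.
  by have := iB _ _ bB aB ba; rewrite ltnNge ltnW.
have sAc : s @: (~: A) = ~: A'.
  apply/setP => x; rewrite -(permKV s x) mem_imset ?in_setC -?sA ?mem_imset //; exact: perm_inj.
rewrite [RHS](reindex_onto (act s) (act s^-1%g)); last first.
  by move=> x _; rewrite -{1}(invgK s) actK.
apply: eq_big => [x|x /andP[Px /eqP cx]]; last first.
  by have [] := @act_cl s x Px; rewrite ?cx.
apply/idP/idP => [/andP[Px /eqP cx]|/andP[/andP[Pax /eqP cax] _]].
  have [] := @act_cl s x Px; rewrite ?cx // => -> -> _; rewrite sA eqxx actK eqxx.
  by [].
have := @act_cl s^-1%g _ Pax; rewrite cax actK => - [].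
- by rewrite -sA; apply: incV.
- by rewrite -sAc; apply: incV.
by move=> -> -> _; rewrite -sA -imset_comp (eq_imset _ (permK s)) imset_id eqxx.
Qed.

(** The part of the sum with clusters of size i consists of C(n,i) equal sums; the sizes 0 and n
    contribute nothing, and p divides C(n,i) in between. *)
Lemma dvd_sum_cluster : (p %| (\sum_(x | P x) T x)%R)%Z.
Proof.
have cle (A : {set 'I_n}) : #|A| < n.+1 by rewrite ltnS -[leqRHS](card_ord n) max_card.
rewrite (partition_big cl predT) //=.
rewrite (partition_big (fun A : {set 'I_n} => inord #|A| : 'I_n.+1) predT) //=.
apply: rpred_sum => i _.
have [i0|i0] := posnP i.
  rewrite big1 ?dvdz0 // => A; rewrite -val_eqE /= inordK // => /eqP cA.
  apply: big1 => x /andP[Px /eqP cx]; apply: T_triv => //; left; apply/eqP.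
  by rewrite cx -cards_eq0 cA i0.
have [in_|in_] := eqVneq (i : nat) n.
  rewrite big1 ?dvdz0 // => A; rewrite -val_eqE /= inordK // => /eqP cA.
  apply: big1 => x /andP[Px /eqP cx]; apply: T_triv => //; right; apply/eqP.
  by rewrite cx eqEcard subsetT cardsT card_ord cA in_ leqnn.
have lt_in : i < n by rewrite ltn_neqAle in_ -ltnS ltn_ord.
pose A0 : {set 'I_n} := [set j : 'I_n | j < i].
have cA0 : #|A0| = i.
  have w_inj : injective (widen_ord (ltnW lt_in)) by move=> a b /(congr1 val) /= ab; apply: val_inj.
  rewrite -[RHS](card_ord i) -(card_imset predT w_inj).
  apply: eq_card => j; rewrite inE; apply/idP/imsetP => [ji|[k _ ->]]; last by rewrite /= ltn_ord.
  by exists (Ordinal ji) => //; apply: val_inj.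
rewrite (eq_bigr (fun=> \sum_(x | P x && (cl x == A0)) T x)%R); last first.
  by move=> A /eqP/(congr1 val) /=; rewrite inordK // => eA; apply: sum_cluster_eq; rewrite cA0 eA.
rewrite sumr_const -mulr_natr dvdz_mull //.
rewrite (_ : #|_| = 'C(n, i)); last first.
  have <- : #|[set A : {set 'I_n} | #|A| == i]| = 'C(n, i) by rewrite card_draws card_ord.
  by apply: eq_card => A; rewrite !inE unfold_in /= inordK.
rewrite natz dvdzE /=; have := @prime_dvd_bin_expn p e i pr_p.
by rewrite -nE i0 lt_in; apply.
Qed.
End ClusterSum.

Section Shuffle.
Variable n : nat.
Implicit Types (s : 'S_n) (i : nat) (a b : 'I_n).

Definition same_side i a b := (a < i) == (b < i).

Definition shuffle i s : bool := [forall a : 'I_n, forall b : 'I_n,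
  (a < b) && same_side i a b ==> (s a < s b)].

Definition segment i : {set 'I_n} := [set j : 'I_n | j < i].

Lemma shuffleP i s : reflect (forall a b, a < b -> same_side i a b -> s a < s b) (shuffle i s).
Proof.
apply: (iffP forallP) => [h a b ab ss|h a].
  by have /forallP/(_ b)/implyP := h a; apply; rewrite ab.
by apply/forallP => b; apply/implyP => /andP[]; exact: h.
Qed.

(** Strong induction on [j]: once smaller indices are fixed, neither [s j] nor the preimage of [j]
    can be smaller than [j]. If [s j] were larger, so would be the preimage, which is on the same
    side, against monotonicity. *)
Lemma side_increasing_id i s : shuffle i s -> (forall j, same_side i (s j) j) -> s = 1%g.
Proof.
move=> /shuffleP inc side; apply/permP => j; rewrite perm1.
have [k] := ubnP (j : nat); elim: k j => // k IHk j; rewrite ltnS => jk.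
have IH (l : 'I_n) : l < j -> s l = l by move=> lj; apply: IHk; apply: leq_trans lj jk.
case: (ltngtP (s j) j) => [lt|gt|/val_inj //].
  by have := perm_inj (IH _ lt).
have side' := side (s^-1%g j); rewrite permKV in side'.
case: (ltngtP j (s^-1%g j)) => [lt|lt|/val_inj e].
- by have := inc _ _ lt side'; rewrite permKV => /(ltn_trans gt); rewrite ltnn.
- by have := IH _ lt; rewrite permKV => e; rewrite -e ltnn in lt.
by move: gt; rewrite {2}e permKV ltnn.
Qed.

Lemma segment_sameE i a b : same_side i a b = ((a \in segment i) == (b \in segment i)).
Proof. by rewrite !inE. Qed.

Lemma shuffle_inj i s s' : shuffle i s -> shuffle i s' ->
  s @: segment i = s' @: segment i -> s = s'.
Proof.
move=> hs hs' e; have side j : same_side i (s'^-1%g (s j)) j.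
  have : (s j \in s @: segment i) = (s j \in s' @: segment i) by rewrite e.
  rewrite mem_imset; last exact: perm_inj.
  have -> : (s j \in s' @: segment i) = (s'^-1%g (s j) \in segment i).
    by rewrite -[in LHS](permKV s' (s j)) mem_imset //; exact: perm_inj.
  by rewrite segment_sameE => ->.
suff : (s * s'^-1 = 1)%g by move/eqP; rewrite -eq_mulgV1 => /eqP.
apply: (@side_increasing_id i); last by move=> j; rewrite permM.
apply/shuffleP => a b ab ss; rewrite !permM.
have lt := shuffleP _ _ hs a b ab ss.
case: (ltngtP (s'^-1%g (s a)) (s'^-1%g (s b))) => // [lt'|/val_inj/perm_inj/perm_inj e'];
  last by rewrite e' ltnn in ab.
have ss' : same_side i (s'^-1%g (s b)) (s'^-1%g (s a)).
  by move: (side a) (side b) ss; rewrite /same_side => /eqP-> /eqP-> /eqP->.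
have := shuffleP _ _ hs' _ _ lt' ss'; rewrite !permKV => /(ltn_trans lt).
by rewrite ltnn.
Qed.

Lemma card_segment i : i <= n -> #|segment i| = i.
Proof.
move=> lt_in; have w_inj : injective (widen_ord lt_in) by move=> a b /(congr1 val) /= ab; apply: val_inj.
rewrite -[RHS](card_ord i) -(card_imset predT w_inj).
apply: eq_card => j; rewrite inE; apply/idP/imsetP => [ji|[k _ ->]]; last by rewrite /= ltn_ord.
by exists (Ordinal ji) => //; apply: val_inj.
Qed.

Lemma card_shuffle i : i <= n -> #|[set s | shuffle i s]| = 'C(n, i).
Proof.
move=> i_n; rewrite -[in RHS](card_ord n) -card_draws.
rewrite -(card_in_imset (f := fun s : 'S_n => s @: segment i)); last first.
  by move=> s s'; rewrite !inE; exact: shuffle_inj.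
apply: eq_card => A; rewrite inE; apply/imsetP/eqP => [[s _ ->]|cA].
  by rewrite card_imset ?card_segment //; exact: perm_inj.
have [|s [sA iA iAc]] := @exists_shuffle n (segment i) A; first by rewrite card_segment.
exists s => //; rewrite inE; apply/shuffleP => a b ab; rewrite segment_sameE.
case aS: (a \in segment i) => /eqP bS; first exact: iA.
by apply: iAc; rewrite // in_setC ?aS -?bS.
Qed.

End Shuffle.

Local Open Scope ring_scope.

(** * Discrete degree theory on the cube *)

(** The sign of [t] when it is a permutation and 0 otherwise: the orientation of a completely
    labelled simplex. *)
Definition label_sign M (t : 'I_M -> 'I_M) : int := \det (\matrix_(r, j) (t r == j)%:R).

(** A column of ones added to the labelling matrix makes it singular, because its own columns
    already add up to ones. Expansion along the new column shows that the signed faces of a labelled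
    simplex cancel. *)
Lemma label_sign_cocycle M (t : 'I_M.+1 -> 'I_M) :
  \sum_(r < M.+1) (-1) ^+ r * label_sign (fun q => t (lift r q)) = 0.
Proof.
pose B : 'M[int]_M.+1 := \matrix_(r, j) if unlift ord0 j is Some k then (t r == k)%:R else 1.
have detB : \det B = 0.
  apply/eqP; rewrite -det_tr; apply/det0P.
  exists (\row_j if unlift ord0 j is Some k then -1 else 1).
    by apply/eqP => /rowP/(_ ord0); rewrite !mxE unlift_none.
  apply/rowP => r; rewrite !mxE big_ord_recl !mxE unlift_none mul1r.
  rewrite (bigD1 (t r)) //= !mxE liftK eqxx mulr1 big1 ?addr0 ?subrr // => j jD.
  by rewrite !mxE liftK eq_sym (negPf jD) mulr0.
transitivity (\det B) => //; rewrite (expand_det_col _ ord0); apply: eq_bigr => r _.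
rewrite !mxE unlift_none mul1r /cofactor addn0; congr (_ * \det _).
by apply/matrixP => i j; rewrite !mxE liftK.
Qed.

Lemma label_sign_miss M (t : 'I_M -> 'I_M) j : (forall r, t r != j) -> label_sign t = 0.
Proof.
move=> tj; rewrite /label_sign (expand_det_col _ j) big1 // => r _.
by rewrite !mxE (negPf (tj r)) mul0r.
Qed.

Lemma label_sign_comp M (s : 'S_M) (t : 'I_M -> 'I_M) :
  label_sign (fun r => s (t r)) = (-1) ^+ s * label_sign t.
Proof.
rewrite /label_sign mulrC -det_perm -det_mulmx; congr (\det _); apply/matrixP => i j.
rewrite !mxE (bigD1 (t i)) //= !mxE eqxx mul1r big1 ?addr0 // => k kD.
by rewrite !mxE eq_sym (negPf kD) mul0r.
Qed.

Lemma label_sign_perm M (s : 'S_M) : label_sign s = (-1) ^+ s.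
Proof.
rewrite -det_perm; congr (\det _); apply/matrixP => i j.
by rewrite !mxE.
Qed.

(* The [r]-th vertex of the Kuhn simplex of the unit cube at [v] in which coordinate [i] is
   incremented at time [pi i]. *)
Definition kuhn M (v : 'I_M -> nat) (pi : 'S_M) (r : nat) : 'I_M -> nat :=
  fun i => (v i + (pi i < r))%N.

(** * Stokes formula for the Kuhn triangulation of a box *)

Section Stokes.
Variables (N B : nat) (K : 'I_N.+1 -> nat).
Hypothesis KB : forall i, (K i <= B)%N.
Notation M := N.+1.
Notation cube := {ffun 'I_M -> 'I_B.+1}.
Variable H : ('I_M -> 'I_M -> nat) -> int.

Definition in_box (v : cube) := [forall i, (v i < K i)%N].
Definition face (v : cube) (pi : 'S_M) (r : 'I_M.+1) : 'I_M -> 'I_M -> nat :=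
  fun q => kuhn (fun i => v i : nat) pi (lift r q).

(** Exchanging the times [r - 1] and [r] gives the other simplex of the same cube on this face, with
    the opposite sign. *)
Lemma sum_inner_face (v : cube) (r : 'I_M.+1) : (0 < r < M)%N ->
  \sum_(pi : 'S_M) (-1) ^+ pi * H (face v pi r) = 0.
Proof.
move=> /andP[r0 rM]; have rM1 : (r.-1 < M)%N by lia.
pose a : 'I_M := Ordinal rM1; pose b : 'I_M := Ordinal rM.
have aDb : a != b by rewrite -val_eqE /=; lia.
set S := \sum_(pi : 'S_M) _; suff SN : S = - S by lia.
rewrite {1}/S (reindex_inj (@mulIg _ (tperm a b))) /= -sumrN; apply: eq_bigr => pi _.
rewrite odd_permM odd_tperm aDb addbT signrN mulNr; congr (- (_ * H _)).
apply/funext => q; apply/funext => i; rewrite /face /kuhn permM.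
have qr : lift r q != r :> nat by rewrite val_eqE eq_sym neq_lift.
congr (_ + nat_of_bool _)%N; case: tpermP => [->|->|//] /=; move: qr; rewrite -?val_eqE /=; lia.
Qed.

Let rot : 'S_M := lift_perm ord0 ord_max 1%g.

Let rot0 : rot ord0 = ord_max. Proof. exact: lift_perm_id. Qed.

Let rotS (k : 'I_M) : (0 < k)%N -> rot k = k.-1 :> nat.
Proof.
case: (unliftP ord0 k) => [k' ->|->] // _.
by rewrite lift_perm_lift perm1 lift_max lift0.
Qed.

Let shift_up (x : cube * 'S_M) : cube * 'S_M :=
  ([ffun i => if x.2 i == ord0 then inord (x.1 i).+1 else x.1 i], (x.2 * rot)%g).
Let shift_down (x : cube * 'S_M) : cube * 'S_M :=
  ([ffun i => if x.2 i == ord_max then inord (x.1 i).-1 else x.1 i], (x.2 * rot^-1)%g).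

Let rot_max (k : 'I_M) : (rot k == ord_max) = (k == ord0).
Proof. by rewrite -rot0 (inj_eq perm_inj). Qed.

Let rotV0 (k : 'I_M) : ((rot^-1)%g k == ord0) = (k == ord_max).
Proof. by rewrite -rot0 -(inj_eq (@perm_inj _ rot)) permKV. Qed.

Let permV_eq (pi : 'S_M) i k : (pi i == k) = (i == (pi^-1)%g k).
Proof. by rewrite -[RHS](inj_eq (@perm_inj _ pi)) permKV. Qed.

(** Moving the cube one step along the coordinate incremented first, and incrementing that
    coordinate last, turns the face opposite the first vertex into the face opposite the last one.
    The rotation of the times has sign [(-1) ^+ N]. *)
Lemma sum_glued_faces :
  \sum_(v | in_box v) \sum_(pi : 'S_M | (v ((pi^-1)%g ord0)).+1 != K ((pi^-1)%g ord0))
     (-1) ^+ pi * H (face v pi ord0) =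
  (-1) ^+ N * \sum_(v | in_box v) \sum_(pi : 'S_M | v ((pi^-1)%g ord_max) != 0%N :> nat)
     (-1) ^+ pi * H (face v pi ord_max).
Proof.
rewrite mulr_sumr; under [RHS]eq_bigr => v _ do rewrite mulr_sumr.
rewrite !pair_big_dep /=; symmetry; rewrite (reindex_onto shift_up shift_down) /=; last first.
  case=> v pi /= /andP[/forallP bv v0]; congr (_, _); last by rewrite -mulgA mulVg mulg1.
  apply/ffunP => i; rewrite !ffunE permM rotV0; case: eqP => // pimax.
  have ei : i = (pi^-1)%g ord_max by rewrite -pimax permK.
  have vB : ((v i).-1 < B.+1)%N by rewrite (leq_ltn_trans (leq_pred _)).
  by rewrite inordK // prednK ?inord_val // lt0n ei.
rewrite (eq_bigl (fun x : cube * 'S_M => in_box x.1 && ((x.1 ((x.2^-1)%g ord0)).+1 != K ((x.2^-1)%g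
  ord0)))); last first.
  case=> v pi /=.
  set i0 := (pi^-1)%g ord0.
  have i0E : ((pi * rot)^-1)%g ord_max = i0.
    by rewrite invMg permM -rot0 permK.
  rewrite i0E ffunE permKV eqxx.
  symmetry.
  apply/andP/andP => [[/forallP bv vK]|].
    have vB : ((v i0).+1 < B.+1)%N by have := bv i0; have := KB i0; move: vK; lia.
    split; first (apply/andP; split).
    - apply/forallP => i; rewrite ffunE permV_eq -/i0; case: eqP => [->|_]; last exact: bv.
      by rewrite inordK //; have := bv i0; move: vK; lia.
    - by rewrite inordK.
    apply/eqP; congr (_, _); last by rewrite -mulgA mulgV mulg1.
    apply/ffunP => i; rewrite !ffunE permM rot_max permV_eq -/i0; case: eqP => // ->.
    by apply: val_inj; rewrite /= inordK ?inordK // ltnW.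
  case=> /andP[/forallP bv v0] _; have := bv i0; rewrite ffunE permKV eqxx.
  have [vB|vB] := leqP (v i0).+1 B; last first.
    by move: v0; rewrite /inord val_insubd ltnS leqNgt vB.
  rewrite inordK // => h; split; last by lia.
  apply/forallP => i; have := bv i; rewrite ffunE permV_eq -/i0; case: eqP => [->|//] _.
  by move: h; lia.
apply: eq_bigr => [[v pi]] /= /andP[/forallP bv vK].
have -> : odd_perm (pi * rot) = odd_perm pi (+) odd N.
  by rewrite odd_permM odd_lift_perm odd_perm1 addbF.
have N2 : (-1) ^+ N * (-1) ^+ N = 1 :> int by rewrite -expr2 sqrr_sign.
rewrite signr_addb signr_odd [_ ^+ pi * _]mulrC mulrA mulrA N2 mul1r; congr (_ * H _).
apply/funext => q; apply/funext => i; rewrite /face /kuhn lift_max lift0 ffunE permM.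
set i0 := (pi^-1)%g ord0 in vK.
case: eqP => [pi0|/eqP pi0]; last first.
  rewrite rotS ?lt0n //; congr (_ + nat_of_bool _)%N.
  have : (pi i != 0 :> nat)%N by []; lia.
have -> : i = i0 by rewrite /i0 -pi0 permK.
rewrite permKV rot0 inordK; last by have := bv i0; have := KB i0; move: vK; lia.
by rewrite /= [(N < q)%N]ltnNge -ltnS ltn_ord addn0 addn1.
Qed.

(** Inner faces cancel within a cube. Faces shared by neighbouring cubes cancel because [(-1) ^+ N]
    and [(-1) ^+ M] are opposite. The boundary of the box remains. *)
Lemma sum_faces :
  \sum_(v | in_box v) \sum_(pi : 'S_M) (-1) ^+ pi * \sum_(r < M.+1) (-1) ^+ r * H (face v pi r) =
  \sum_(v | in_box v) \sum_(pi : 'S_M | (v ((pi^-1)%g ord0)).+1 == K ((pi^-1)%g ord0))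
     (-1) ^+ pi * H (face v pi ord0) +
  (-1) ^+ M * \sum_(v | in_box v) \sum_(pi : 'S_M | v ((pi^-1)%g ord_max) == 0%N :> nat)
     (-1) ^+ pi * H (face v pi ord_max).
Proof.
have step1 v : \sum_(pi : 'S_M) (-1) ^+ pi * (\sum_(r < M.+1) (-1) ^+ r * H (face v pi r)) =
   \sum_(pi : 'S_M) (-1) ^+ pi * H (face v pi ord0) +
   (-1) ^+ M * \sum_(pi : 'S_M) (-1) ^+ pi * H (face v pi ord_max).
  under eq_bigr => pi _ do rewrite mulr_sumr.
  rewrite exchange_big /= (bigD1 ord0) //= (bigD1 ord_max) //= [X in _ + (_ + X)]big1 ?addr0.
    by congr (_ + _); rewrite ?mulr_sumr; apply: eq_bigr => pi _; rewrite ?expr0 ?mul1r // mulrCA.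
  move=> r /andP[r0 rM]; under eq_bigr => pi _ do rewrite mulrCA.
  rewrite -mulr_sumr sum_inner_face ?mulr0 //.
  by move: r0 rM; rewrite -!val_eqE /=; have := ltn_ord r; lia.
under eq_bigr => v _ do rewrite step1.
rewrite big_split /= -mulr_sumr.
under eq_bigr => v _ do rewrite (bigID (fun pi : 'S_M =>
  (v ((pi^-1)%g ord0)).+1 == K ((pi^-1)%g ord0))) /=.
rewrite big_split /= sum_glued_faces -!addrA; congr (_ + _).
under [in X in _ + X]eq_bigr => v _ do
  rewrite (bigID (fun pi : 'S_M => v ((pi^-1)%g ord_max) == 0%N :> nat)) /=.
rewrite [in X in _ + X]big_split /= mulrDr addrCA -[RHS]addr0; congr (_ + _).
by rewrite exprS mulN1r mulNr subrr.
Qed.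
End Stokes.

(** * Coordinates of the cube and the action of permutations *)

Section Coordinates.
Variables m n : nat.
Notation M := (m * n).+1.
Notation coord := (option ('I_m * 'I_n)).

Lemma card_coord : #|{: coord}| = M.
Proof. by rewrite card_option card_prod !card_ord. Qed.

(** [None] is the time of the interpolation, [Some (k, j)] the matrix entry in row [k] and column
    [j]. *)
Definition enc (c : coord) : 'I_M := cast_ord card_coord (enum_rank c).
Definition dec (i : 'I_M) : coord := enum_val (cast_ord (esym card_coord) i).

Lemma encK : cancel enc dec.
Proof. by move=> c; rewrite /dec /enc cast_ordK enum_rankK. Qed.

Lemma decK : cancel dec enc.
Proof. by move=> i; rewrite /dec /enc enum_valK cast_ordKV. Qed.

Lemma enc_inj : injective enc. Proof. exact: can_inj encK. Qed.

Definition relabel (s : 'S_n) (c : coord) : coord := omap (fun kj => (kj.1, s kj.2)) c.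

Lemma relabelM s t c : relabel (s * t)%g c = relabel t (relabel s c).
Proof. by case: c => [[k j]|] //=; rewrite permM. Qed.

Lemma relabel1 c : relabel 1%g c = c.
Proof. by case: c => [[k j]|] //=; rewrite perm1. Qed.

Lemma relabelK s : cancel (relabel s) (relabel s^-1%g).
Proof. by move=> c; rewrite -relabelM mulgV relabel1. Qed.

Lemma coord_perm_subproof s : injective (fun i => enc (relabel s (dec i))).
Proof.
apply: (can_inj (g := fun i => enc (relabel s^-1%g (dec i)))) => i.
by rewrite encK relabelK decK.
Qed.

Definition coord_perm s : 'S_M := perm (@coord_perm_subproof s).

Lemma coord_permE s c : coord_perm s (enc c) = enc (relabel s c).
Proof. by rewrite permE encK. Qed.

Lemma coord_permV s : coord_perm s^-1%g = ((coord_perm s)^-1)%g.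
Proof.
apply/permP => i; apply: (@perm_inj _ (coord_perm s)); rewrite permKV -{1}(decK i) !coord_permE.
by rewrite -{1}(invgK s) relabelK decK.
Qed.

Definition act_point (s : 'S_n) (z : 'I_M -> nat) : 'I_M -> nat :=
  fun i => z (coord_perm s^-1%g i).

Lemma act_pointE s z c : act_point s z (enc (relabel s c)) = z (enc c).
Proof. by rewrite /act_point -coord_permE coord_permV permK. Qed.

Lemma act_pointE' s z k j : act_point s z (enc (Some (k, s j))) = z (enc (Some (k, j))).
Proof. exact: (act_pointE s z (Some (k, j))). Qed.

End Coordinates.
Arguments enc {m n} c.
Arguments dec {m n} i.

(** * Divisibility of the count at time 0 *)

Section Core.
Variables (m n p e K : nat).
Hypotheses (pr_p : prime p) (nE : n = (p ^ e)%N) (K_gt0 : (0 < K)%N).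
Notation M := (m * n).+1.
Notation cube := {ffun 'I_M -> 'I_K.+1}.
Notation time := (@enc m n None).
Notation space k j := (@enc m n (Some (k, j))).

(** One step suffices in the time direction: the interpolation is only sampled at its two ends. *)
Definition box (i : 'I_M) : nat := if i == time then 1%N else K.

Let box_le i : (box i <= K)%N. Proof. by rewrite /box; case: ifP. Qed.

Definition act_cube (s : 'S_n) (v : cube) : cube := [ffun i => v (coord_perm m s^-1%g i)].

Variable lab : ('I_M -> nat) -> 'I_M.
Notation H := (fun F : 'I_M -> 'I_M -> nat => label_sign (fun q => lab (F q))).

Definition lab_equivariant (v : cube) (s : 'S_n) :=
  forall (pi : 'S_M) r, lab (act_point s (kuhn (fun i => v i : nat) pi r)) =
               coord_perm m s (lab (kuhn (fun i => v i : nat) pi r)).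

Let act (s : 'S_n) (x : cube * 'S_M) : cube * 'S_M :=
  (act_cube s x.1, (coord_perm m s^-1 * x.2)%g).

Let actK s : cancel (act s) (act s^-1%g).
Proof.
case=> v pi; congr (_, _) => /=.
  by apply/ffunP => i; rewrite !ffunE invgK !coord_permV permK.
by rewrite invgK !coord_permV mulgA mulgV mul1g.
Qed.

Let in_box_act s v : in_box box v -> in_box box (act_cube s v).
Proof.
move=> /forallP bv; apply/forallP => i; rewrite ffunE.
have := bv (coord_perm m s^-1%g i); rewrite /box.
have -> : (coord_perm m s^-1%g i == time) = (i == time); last by [].
by rewrite -[RHS](inj_eq (@perm_inj _ (coord_perm m s^-1%g))) [in RHS]coord_permE.
Qed.

Let face_act s v pi r q :
  face (act_cube s v) (coord_perm m s^-1 * pi)%g r q = act_point s (face v pi r q).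
Proof. by apply/funext => i; rewrite /face /kuhn /act_point ffunE permM. Qed.

Let inv_act s (pi : 'S_M) t :
  ((coord_perm m s^-1 * pi)^-1)%g t = coord_perm m s ((pi^-1)%g t).
Proof. by rewrite coord_permV invMg invgK permM. Qed.

(** A permutation of the columns multiplies the sign of [pi] and the sign of the labelling by the
    same factor, the sign of [coord_perm m s], so the terms are invariant under the shuffles of the
    clusters. *)
Lemma dvd_side (k : 'I_m) (t : 'I_M) (r : 'I_M.+1) (V : pred nat) (cl : cube -> {set 'I_n}) :
  (forall (v : cube) (pi : 'S_M) j, in_box box v -> pi (space k j) = t -> V (v (space k j)) ->
     cl v = set0 \/ cl v = setT -> H (face v pi r) = 0) ->
  (forall v s, in_box box v -> increasing_on (cl v) s -> increasing_on (~: cl v) s ->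
     cl (act_cube s v) = s @: cl v /\ lab_equivariant v s) ->
  (p %| (\sum_(x : cube * 'S_M | in_box box x.1 && [exists j,
    ((x.2^-1)%g t == space k j) && V (x.1 (space k j))])
     (-1) ^+ x.2 * H (face x.1 x.2 r))%R)%Z.
Proof.
move=> H0 Hs; apply: (@dvd_sum_cluster n p e _ _ _ (fun x => cl x.1) act) => //.
  case=> v pi /= /andP[bv /existsP[j /andP[/eqP ej Vj]]] triv.
  by rewrite (H0 v pi j) ?mulr0 // -ej permKV.
move=> s [v pi] /= /andP[bv /existsP[j /andP[/eqP ej Vj]]] i1 i2.
have [cs le] := Hs v s bv i1 i2; split => //.
  rewrite in_box_act //=; apply/existsP; exists (s j); rewrite inv_act ej coord_permE eqxx /=.
  by rewrite ffunE coord_permE /= permK.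
have -> : odd_perm (coord_perm m s^-1 * pi)%g = coord_perm m s (+) pi.
  by rewrite odd_permM coord_permV odd_permV.
rewrite signr_addb.
have -> : (fun q => lab (face (act_cube s v) (coord_perm m s^-1 * pi)%g r q)) =
          (fun q => coord_perm m s (lab (face v pi r q))).
  by apply/funext => q; rewrite face_act; exact: le.
by rewrite label_sign_comp mulrACA -expr2 sqrr_sign mul1r.
Qed.

Variables clU clL : 'I_m -> cube -> {set 'I_n}.
Hypothesis time1 : forall (v : cube) (pi : 'S_M), in_box box v -> pi time = ord0 ->
  H (face v pi ord0) = 0.
Hypothesis upper0 : forall k (v : cube) (pi : 'S_M) j, in_box box v -> pi (space k j) = ord0 ->
  (v (space k j)).+1 = K -> clU k v = set0 \/ clU k v = setT -> H (face v pi ord0) = 0.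
Hypothesis lower0 : forall k (v : cube) (pi : 'S_M) j, in_box box v -> pi (space k j) = ord_max ->
  v (space k j) = 0%N :> nat -> clL k v = set0 \/ clL k v = setT -> H (face v pi ord_max) = 0.
Hypothesis upperS : forall k v s, in_box box v ->
  increasing_on (clU k v) s -> increasing_on (~: clU k v) s ->
  clU k (act_cube s v) = s @: clU k v /\ lab_equivariant v s.
Hypothesis lowerS : forall k v s, in_box box v ->
  increasing_on (clL k v) s -> increasing_on (~: clL k v) s ->
  clL k (act_cube s v) = s @: clL k v /\ lab_equivariant v s.

Let dvd_sides (t : 'I_M) (r : 'I_M.+1) (Q : cube * 'S_M -> bool) (V : pred nat) :
  (forall x : cube * 'S_M, in_box box x.1 -> (x.2^-1)%g t != time -> Q x = V (x.1 ((x.2^-1)%g t))) ->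
  (forall k, (p %| (\sum_(x : cube * 'S_M | in_box box x.1 && [exists j,
    ((x.2^-1)%g t == space k j) && V (x.1 (space k j))])
     (-1) ^+ x.2 * H (face x.1 x.2 r))%R)%Z) ->
  (p %| (\sum_(x : cube * 'S_M | (in_box box x.1 && Q x) && ((x.2^-1)%g t != time))
     (-1) ^+ x.2 * H (face x.1 x.2 r))%R)%Z.
Proof.
move=> QV dk; case: (posnP m) => [m0|m_gt0].
  rewrite big1 ?dvdz0 // => x /andP[_ /negP[]]; rewrite -(decK ((x.2^-1)%g t)).
  by case: (dec _) => [[k j]|//]; have := ltn_ord k; rewrite [X in (_ < X)%N]m0.
pose row (x : cube * 'S_M) := if dec ((x.2^-1)%g t) is Some (k, _) then k else Ordinal m_gt0.
rewrite (partition_big row predT) //=; apply: rpred_sum => k _.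
rewrite (eq_bigl (fun x : cube * 'S_M => in_box box x.1 && [exists j,
  ((x.2^-1)%g t == space k j) && V (x.1 (space k j))])); first exact: dk.
move=> x; apply/idP/idP => [/andP[/andP[/andP[bx Qx] tx] /eqP rx]|/andP[bx /existsP[j /andP[/eqP ex
  Vx]]]].
  rewrite bx /=; apply/existsP; move: tx rx; rewrite /row -{1}(decK ((x.2^-1)%g t)) (inj_eq
    (@enc_inj m n)).
  case ed: (dec _) => [[k' j]|//] _ kk; exists j.
  have ex : (x.2^-1)%g t = space k j by rewrite -kk -ed decK.
  rewrite ex eqxx /=; rewrite QV ?ex // in Qx.
  by rewrite (inj_eq (@enc_inj m n)).
rewrite bx /row ex encK eqxx andbT /= (inj_eq (@enc_inj m n)) andbT QV ?ex //.
by rewrite (inj_eq (@enc_inj m n)).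
Qed.

(** By the cocycle identity every simplex contributes 0, so the boundary faces add up to 0. Time 1
    contributes nothing by [time1], the lateral faces give a multiple of p row by row, and time 0 is
    what is left. *)
Theorem dvd_time0 :
  (p %| (\sum_(v : cube | in_box box v) \sum_(pi : 'S_M | pi time == ord_max)
     (-1) ^+ pi * H (face v pi ord_max))%R)%Z.
Proof.
have := sum_faces box_le H.
rewrite big1; last first.
  move=> v _; rewrite big1 // => pi _.
  by have := label_sign_cocycle (fun r => lab (kuhn (fun i => v i : nat) pi r)) => ->; rewrite mulr0.
rewrite !pair_big_dep /= (bigID (fun x : cube * 'S_M => (x.2^-1)%g ord0 == time)) /= big1 ?add0r;
  last first.
  by case=> v pi /= /andP[/andP[bv _] /eqP et]; rewrite time1 ?mulr0 // -et permKV.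
set S1 := (X in 0 = X + _); set S2 := (X in _ + _ * X).
have dS1 : (p %| S1)%Z.
  apply: (@dvd_sides ord0 ord0 (fun x => (x.1 ((x.2^-1)%g ord0)).+1 == box ((x.2^-1)%g ord0)) (fun
    a => a.+1 == K)) => [[v pi] /= bv tN|k].
    by rewrite /box (negPf tN).
  apply: (@dvd_side k ord0 ord0 (fun a => a.+1 == K) (clU k)) => [v pi j bv pj /eqP vj|];
    last exact: upperS.
  exact: (upper0 bv pj vj).
move=> /esym/eqP; rewrite addrC addr_eq0 => /eqP eS.
have dS2 : (p %| S2)%Z.
  have : (p %| (-1) ^+ M * S2)%Z by rewrite eS rpredN.
  by rewrite -signr_odd; case: odd; rewrite ?expr0 ?mul1r ?expr1 ?mulN1r // rpredN.
move: dS2; rewrite /S2 (bigID (fun x : cube * 'S_M => (x.2^-1)%g ord_max == time)) /=.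
set S3 := \sum_(i | _ && ~~ _) _.
have dS3 : (p %| S3)%Z.
  apply: (@dvd_sides ord_max ord_max (fun x => x.1 ((x.2^-1)%g ord_max) == 0%N :> nat) (fun a =>
    a == 0%N)) => [[v pi] /= bv tN|k] //.
  apply: (@dvd_side k ord_max ord_max (fun a => a == 0%N) (clL k)) => [v pi j bv pj /eqP vj|];
    last exact: lowerS.
  exact: (lower0 bv pj vj).
rewrite rpredDr // => d0.
rewrite (eq_bigl (fun i : cube * 'S_M => in_box box i.1 && (i.1 ((i.2^-1)%g ord_max) == 0%N :> nat)
  && ((i.2^-1)%g ord_max == time))) //.
case=> v pi /=; rewrite -andbA.
have -> : ((pi^-1)%g ord_max == time) = (pi time == ord_max).
  by rewrite -(inj_eq (@perm_inj _ pi)) permKV eq_sym.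
case bv: (in_box box v) => //=; case et: (pi time == ord_max); rewrite ?andbF // andbT.
have /forallP/(_ time) := bv; rewrite /box eqxx => v0.
by rewrite -(eqP et) permK -leqn0 -ltnS v0.
Qed.

End Core.

(** * The count at time 0 is one *)

Section Count.
Variables (m n K Q : nat).
Hypotheses (Q_gt0 : (0 < Q)%N) (QK : (Q <= K)%N).
Notation N := (m * n)%N.
Notation M := N.+1.
Notation cube := {ffun 'I_M -> 'I_K.+1}.
Notation time := (@enc m n None).
Notation bx := (@box m n K).
Variable lab : ('I_M -> nat) -> 'I_M.
Hypothesis lab_time : forall z, z time = 0%N -> lab z = time -> forall i, i != time -> (Q <= z i)%N.
Hypothesis lab_space : forall z, z time = 0%N -> lab z != time -> (z (lab z) < Q)%N.

(** Space labels occur only below height [Q] and the label [time] only from [Q] on, so a completely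
    labelled simplex must lie in this cube. *)
Let v0 : cube := [ffun i => if i == time then ord0 else inord Q.-1].

Let v0_time : v0 time = 0%N :> nat. Proof. by rewrite ffunE eqxx. Qed.

Let v0_space i : i != time -> v0 i = Q.-1 :> nat.
Proof. by move=> iN; rewrite ffunE (negPf iN) inordK //; lia. Qed.

Let in_box_v0 : in_box bx v0.
Proof.
apply/forallP => i; rewrite /box; have [->|iN] := eqVneq i time; first by rewrite v0_time.
by rewrite v0_space //; lia.
Qed.

Let pt (S : {set 'I_M}) : 'I_M -> nat := fun i => (v0 i + (i \in S))%N.

(** The label of a vertex names the coordinate to be incremented next; [St q] collects the
    coordinates incremented in the first [q] steps. *)
Let incr (S : {set 'I_M}) := lab (pt S) |: S.
Let St q := iter q incr set0.

Let lab_pt (S : {set 'I_M}) : time \notin S -> (lab (pt S) != time -> lab (pt S) \notin S) /\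
  (lab (pt S) = time -> forall i, i != time -> i \in S).
Proof.
move=> tS; have z0 : pt S time = 0%N by rewrite /pt v0_time (negPf tS).
split=> [lN|lt i iN].
  by have := lab_space z0 lN; rewrite {1}/pt v0_space //; case: (_ \in S) => //=; lia.
by have := lab_time z0 lt iN; rewrite {1}/pt v0_space //; case: (_ \in S) => //=; lia.
Qed.

Let St_card q : (q <= N)%N -> #|St q| = q /\ time \notin St q.
Proof.
elim: q => [|q IHq] qN; first by rewrite /St /= cards0 in_set0.
have [cS tS] := IHq (ltnW qN); have [l1 l2] := lab_pt tS.
have lN : lab (pt (St q)) != time.
  apply/negP => /eqP/l2 all_S; have : #|[set~ time]| = q.
    rewrite -cS; apply: eq_card => i; rewrite !inE; have [->|iN] := eqVneq i time;
      first by rewrite (negPf tS).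
    by rewrite all_S.
  by rewrite cardsC1 card_ord /=; lia.
split; first by rewrite /St iterS cardsU1 l1 // -/(St q) cS.
by rewrite /St iterS !inE negb_or eq_sym lN.
Qed.

Let sg (q : 'I_M) := lab (pt (St q)).

Let sg_notin q : sg q \notin St q.
Proof.
have [cS tS] := @St_card q (ltn_ord q : (q <= N)%N); have [l1 l2] := lab_pt tS.
by have [e|] := eqVneq (sg q) time; [rewrite e | exact: l1].
Qed.

Let St_mono q r : (q <= r)%N -> St q \subset St r.
Proof.
move=> /subnK <-; elim: (r - q)%N => [|k IHk]; first exact: subxx.
by rewrite addSn /St iterS (subset_trans IHk) // subsetUr.
Qed.

Let sg_inj : injective sg.
Proof.
suff lt (q r : 'I_M) : (q < r)%N -> sg q != sg r.
  move=> q r e; apply: val_inj; by case: (ltngtP q r) => // /lt; rewrite e eqxx.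
move=> qr; apply: contraNneq (sg_notin r) => <-.
by apply: (subsetP (St_mono qr)); rewrite /St iterS setU11.
Qed.

Let pi0 : 'S_M := ((perm sg_inj)^-1)%g.

Let pi0_lt i q : (q <= M)%N -> (pi0 i < q)%N = (i \in St q).
Proof.
elim: q => [|q IHq] qM; first by rewrite inE.
have IH := IHq (ltnW qM); rewrite ltnS leq_eqVlt IH /St iterS in_setU1 -/(St q); congr (_ || _).
rewrite -[LHS]/(pi0 i == Ordinal qM).
by rewrite -(inj_eq (@perm_inj _ (perm sg_inj))) permKV permE.
Qed.

Let kuhn_pi0 (q : 'I_M) : kuhn (fun i => v0 i : nat) pi0 q = pt (St q).
Proof. by apply/funext => i; rewrite /kuhn /pt pi0_lt // ltnW. Qed.

Let lab_pi0 (q : 'I_M) : lab (kuhn (fun i => v0 i : nat) pi0 q) = ((pi0)^-1)%g q.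
Proof. by rewrite kuhn_pi0 /pi0 invgK permE. Qed.

Let pi0_time : pi0 time = ord_max.
Proof.
have [_ tS] := St_card (leqnn N); apply: val_inj => /=; apply/eqP.
by rewrite eqn_leq -ltnS ltn_ord /= leqNgt pi0_lt.
Qed.

Let face_max (v : cube) (pi : 'S_M) (q : 'I_M) : face v pi ord_max q = kuhn (fun i => v i : nat) pi q.
Proof. by rewrite /face lift_max. Qed.

(** In a complete labelling, each space coordinate is below [Q] at the vertex carrying its label and
    at least [Q] at the vertex labelled [time], hence is [Q - 1] at the base. The label of vertex
    [q] is a coordinate not yet incremented, so its time is at least [q]; as these times are
    distinct, they are exactly [q]. *)
Let good v (pi : 'S_M) : in_box bx v -> pi time = ord_max ->
  label_sign (fun q => lab (face v pi ord_max q)) != 0 ->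
  v = v0 /\ forall q : 'I_M, lab (kuhn (fun i => v i : nat) pi q) = (pi^-1)%g q.
Proof.
move=> /forallP bv pt0 ls0; pose t (q : 'I_M) := lab (kuhn (fun i => v i : nat) pi q).
have vt : v time = 0%N :> nat by have := bv time; rewrite /box eqxx; lia.
have kt (q : 'I_M) : kuhn (fun i => v i : nat) pi q time = 0%N.
  by rewrite /kuhn vt pt0 /= [(N < q)%N]ltnNge -ltnS ltn_ord.
have surj j : exists q, t q = j.
  apply: contrapT => nq; move: ls0; rewrite (@label_sign_miss _ _ j) ?eqxx // => r.
  by rewrite face_max; apply/eqP => e; apply: nq; exists r.
have vE : v = v0.
  apply/ffunP => i; apply: val_inj; have [->|iN] := eqVneq i time; first by rewrite /= vt v0_time.
  rewrite /= v0_space //; have [q eq] := surj i; have [r er] := surj time.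
  have := lab_space (kt q); rewrite -/(t q) eq => /(_ iN); have := lab_time (kt r) er iN.
  rewrite /kuhn; case: (pi i < q)%N; case: (pi i < r)%N; rewrite /=;
    move: (nat_of_ord (v i)) => a; lia.
split=> //; pose f q := pi (t q).
have f_inj : injective f.
  have t_inj : injective t.
    apply/injectiveP/card_uniqP; rewrite size_codom card_ord -[RHS](card_ord M).
    by apply: eq_card => j; rewrite inE; have [q <-] := surj j; rewrite codom_f.
  by move=> q r /perm_inj/t_inj.
have f_ge (q : 'I_M) : (q <= f q)%N.
  rewrite /f; have [->|tN] := eqVneq (t q) time; first by rewrite pt0 -ltnS.
  have := lab_space (kt q) tN; rewrite -/(t q) {1}/kuhn vE v0_space // => h.
  by rewrite leqNgt; apply/negP => lt; move: h; rewrite lt /=; lia.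
have fE (q : 'I_M) : f q = q.
  pose F : 'S_M := perm f_inj.
  have e : (\sum_(q : 'I_M) f q = \sum_(q : 'I_M) q)%N.
    by rewrite [RHS](reindex_inj (@perm_inj _ F)); apply: eq_bigr => r _; rewrite permE.
  have : (\sum_(q : 'I_M) (f q - q) = 0)%N by rewrite sumnB // e subnn.
  by move/eqP; rewrite sum_nat_eq0 => /forallP/(_ q) /= /eqP h; apply: val_inj => /=;
    have := f_ge q; lia.
by move=> q; apply: (@perm_inj _ pi); rewrite permKV -[RHS]fE.
Qed.

(** Each label determines the next vertex, so only [pi0] survives, and the sign of its labelling is
    that of [pi0] itself. *)
Lemma time0_count :
  \sum_(v : cube | in_box bx v) \sum_(pi : 'S_M | pi time == ord_max)
     (-1) ^+ pi * label_sign (fun q => lab (face v pi ord_max q)) = 1.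
Proof.
have sgn1 (v : cube) (pi : 'S_M) : (forall q : 'I_M, lab (kuhn (fun i =>
  v i : nat) pi q) = (pi^-1)%g q) ->
    (-1) ^+ pi * label_sign (fun q => lab (face v pi ord_max q)) = 1.
  move=> e; have -> : (fun q => lab (face v pi ord_max q)) = (pi^-1)%g.
    by apply/funext => q; rewrite face_max e.
  by rewrite label_sign_perm odd_permV -expr2 sqrr_sign.
rewrite (bigD1 v0) //= [X in _ + X]big1 ?addr0; last first.
  move=> v /andP[bv vN]; apply: big1 => pi /eqP pt0.
  apply/eqP; rewrite mulf_eq0 signr_eq0 /=; apply: contraNT vN => ls.
  by have [-> _] := good bv pt0 ls.
rewrite (bigD1 pi0) /= ?pi0_time // [X in _ + X]big1 ?addr0; first exact: sgn1 lab_pi0.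
move=> pi /andP[/eqP pt0 piN].
apply/eqP; rewrite mulf_eq0 signr_eq0 /=; apply: contraNT piN => ls.
have [_ pE] := good in_box_v0 pt0 ls; apply/eqP/invg_inj/permP => q.
have [k] := ubnP (q : nat); elim: k q => // k IHk q; rewrite ltnS => qk.
rewrite -pE -lab_pi0; congr lab; apply/funext => i; rewrite /kuhn; congr (_ + nat_of_bool _)%N.
have st (s s' : 'S_M) j : (forall r : 'I_M, (r < q)%N -> (s^-1)%g r = (s'^-1)%g r) ->
  (s j < q)%N -> (s' j < q)%N.
  move=> h sj; have := h _ sj; rewrite permK => ->.
  by rewrite permKV.
have hh (r : 'I_M) : (r < q)%N -> (pi^-1)%g r = (pi0^-1)%g r by move=> rq; apply: IHk; lia.
by apply/idP/idP; apply: st => r rq; rewrite hh.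
Qed.

End Count.

(** * Nonexistence for prime powers *)

Section UniformContinuity.
Local Open Scope classical_set_scope.
Local Open Scope ring_scope.
Variable R : realType.

(** Compactness of the box in its near-covering form. Only [v] is confined to the box while [v'] may
    leave it, so both are compared with a centre in the box at half the tolerance. *)
Lemma unif_cont_box N (L : R) (g : 'rV[R]_N -> R) :
  (forall (v : 'rV[R]_N) (eps : R), 0 < eps -> exists delta : R, 0 < delta /\
     forall v' : 'rV[R]_N, (forall i, `|v' 0 i - v 0 i| < delta) -> `|g v' - g v| < eps) ->
  forall eps : R, 0 < eps -> exists delta : R, 0 < delta /\
    forall v v' : 'rV[R]_N, (forall i, `|v 0 i| <= L) -> (forall i, `|v' 0 i - v 0 i| < delta) ->
      `|g v' - g v| < eps.
Proof.
move=> gc eps eps0.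
have cA := @rV_compact R N (fun=> `[- L, L]%classic) (fun=> @segment_compact R (- L) L).
set A := (X in compact X) in cA.
have nA : near_covering A by apply/compact_near_coveringP.
have : \forall d \near (0 : R)^'+, forall v, A v ->
    forall v' : 'rV[R]_N, (forall i, `|v' 0 i - v 0 i| < d) -> `|g v' - g v| < eps.
  apply: (nA R (0 : R)^'+ (fun d v => forall v' : 'rV[R]_N, (forall i, `|v' 0 i - v 0 i| < d) ->
    `|g v' - g v| < eps)).
  move=> v Av; have [d [d0 hd]] := gc v (eps / 2) (divr_gt0 eps0 (ltr0Sn R 1)).
  have d20 : 0 < d / 2 by rewrite divr_gt0.
  exists (ball v (d / 2), [set x | x < d / 2]) => /=.
    split; first exact: nbhsx_ballx.
    near=> x; near: x; exact: nbhs_right_lt.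
  move=> [w x] /= [vw xd] v' hv'.
  have hw i : `|w 0 i - v 0 i| < d / 2.
    by rewrite distrC; have [_ h] := vw; exact: h.
  have e1 : `|g w - g v| < eps / 2.
    by apply: hd => i; apply: (lt_trans (hw i)); lra.
  have e2 : `|g v' - g v| < eps / 2.
    apply: hd => i; have := hw i; have := hv' i.
    have : `|v' 0 i - v 0 i| <= `|v' 0 i - w 0 i| + `|w 0 i - v 0 i| by exact: ler_distD.
    by lra.
  have : `|g v' - g w| <= `|g v' - g v| + `|g v - g w| by exact: ler_distD.
  by rewrite (distrC (g v)); lra.
case/nbhs_ballP => d /= d0 hd; exists (d / 2); split; first by rewrite divr_gt0.
move=> v v' vL vv'; have d2 : 0 < d / 2 by rewrite divr_gt0.
apply: (hd (d / 2) _ d2 v) => //=.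
  by rewrite -ball_normE /ball_ /= sub0r normrN gtr0_norm //; lra.
by move=> i /=; rewrite in_itv /= -ler_norml; exact: vL.
Unshelve. all: by end_near. Qed.
End UniformContinuity.

(** * Heights separating coincident columns *)

Section Lift.
Local Open Scope classical_set_scope.
Local Open Scope ring_scope.
Variables (R : realType) (m n : nat).
Implicit Types u w : 'I_m -> 'I_n -> R.

Definition col_dist u (j l : 'I_n) : R := \big[Num.max/0]_(k < m) `|u k j - u k l|.

Lemma col_distC u j l : col_dist u j l = col_dist u l j.
Proof. by apply: eq_bigr => k _; rewrite distrC. Qed.

Lemma col_dist_ge u j l k : `|u k j - u k l| <= col_dist u j l.
Proof. exact: le_bigmax. Qed.

Lemma col_dist_le u j l c : 0 <= c -> (forall k, `|u k j - u k l| <= c) -> col_dist u j l <= c.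
Proof. by move=> c0 h; apply/bigmax_leP; split=> // k _; exact: h. Qed.

Lemma col_dist_ge0 u j l : 0 <= col_dist u j l.
Proof. by apply/bigmax_geP; left. Qed.

Lemma col_dist0 u j l : (forall k, u k j = u k l) -> col_dist u j l = 0.
Proof.
move=> h; apply/le_anti; rewrite col_dist_ge0 andbT.
by apply: col_dist_le => // k; rewrite h subrr normr0.
Qed.

Definition closeness u j l : R := Num.max 0 (1 - col_dist u j l).

Definition side_sign (l j : 'I_n) : R := (l < j)%N%:R - (j < l)%N%:R.

(* Equal columns get distinct heights, ordered as their indices, and the heights only depend on
   the relative order of the pairs of columns at distance less than 1. *)
Definition height u (j : 'I_n) : R := \sum_l side_sign l j * closeness u j l.

Definition lift_conf u : 'I_m.+1 -> 'I_n -> R :=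
  fun i j => if unlift ord_max i is Some k then u k j else height u j.

(** Equal columns have the same closeness to every column [q], and [side_sign q] is nondecreasing in
    its second argument; so the difference has nonnegative terms, and the term at [l] is 1. *)
Lemma height_lt u (j l : 'I_n) : (l < j)%N -> (forall k, u k j = u k l) -> height u l < height u j.
Proof.
move=> lj ujl; rewrite -subr_gt0 /height -sumrB.
have cE q : closeness u l q = closeness u j q.
  by rewrite /closeness /col_dist; congr (Num.max _ (_ - _)); apply: eq_bigr => k _; rewrite ujl.
have c1 : closeness u j l = 1.
  by rewrite /closeness col_dist0 // subr0 max_r.
rewrite (bigD1 l) //= cE c1 /side_sign lj ltnn (ltnNge j) (ltnW lj) /= !subr0 mul1r mul0r subr0.
apply: ltr_pwDl => //; apply: sumr_ge0 => q _; rewrite cE -mulrBl mulr_ge0 //.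
  rewrite subr_ge0 /side_sign.
  by case: (ltngtP q l) => h1; case: (ltngtP q j) => h2; rewrite /=; first [lia | lra].
by rewrite le_max lexx.
Qed.

Lemma lift_conf_neq u j l : j <> l -> exists i, lift_conf u i j <> lift_conf u i l.
Proof.
move=> jl; case: (pselect (exists k, u k j <> u k l)) => [[k uk]|nuk].
  by exists (lift ord_max k); rewrite /lift_conf liftK.
have ujl k : u k j = u k l by apply: contrapT => h; apply: nuk; exists k.
exists ord_max; rewrite /lift_conf unlift_none => e.
case: (ltngtP j l) => [h|h|/val_inj//].
  by have := height_lt h (fun k => esym (ujl k)); rewrite e ltxx.
by have := height_lt h ujl; rewrite e ltxx.
Qed.

(** Columns at distance at least 1 have closeness 0, so the heights only see the order of the closer
    pairs, which [s] keeps. *)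
Lemma lift_conf_perm u (s : 'S_n) i j :
  (forall a b : 'I_n, (a < b)%N -> col_dist u a b < 1 -> (s a < s b)%N) ->
  lift_conf (fun k b => u k ((s^-1)%g b)) i j = lift_conf u i ((s^-1)%g j).
Proof.
move=> hs; rewrite /lift_conf; case: (unlift _ _) => // {i}.
rewrite /height (reindex_inj (@perm_inj _ s)) /=; apply: eq_bigr => l _.
rewrite -{1 2}(permKV s j); move: ((s^-1)%g j) => {}j.
have -> : closeness (fun k b => u k ((s^-1)%g b)) (s j) (s l) = closeness u j l.
  rewrite /closeness /col_dist; congr (Num.max _ (_ - _)).
  by apply: eq_bigr => k _; rewrite !permK.
have [d1|d1] := ltP (col_dist u j l) 1; last by rewrite /closeness max_l ?mulr0 // subr_le0.
congr (_ * _); rewrite /side_sign.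
case: (ltngtP j l) => [h|h|/val_inj ->]; last by rewrite !ltnn.
  by have := hs _ _ h d1 => h'; rewrite h' ltnNge ltnW.
by rewrite col_distC in d1; have := hs _ _ h d1 => h'; rewrite h' ltnNge ltnW.
Qed.

Lemma col_dist_lip u w c j l : (forall k a, `|u k a - w k a| <= c) ->
  0 <= c -> col_dist u j l <= col_dist w j l + c *+ 2.
Proof.
move=> h c0; apply: col_dist_le => [|k].
  by rewrite addr_ge0 ?mulrn_wge0 ?col_dist_ge0.
have := col_dist_ge w j l k; have := h k j; have := h k l.
by rewrite !ler_norml; lra.
Qed.

Lemma closeness_lip u w c j l : (forall k a, `|u k a - w k a| <= c) ->
  0 <= c -> `|closeness u j l - closeness w j l| <= c *+ 2.
Proof.
move=> h c0; have h' k a : `|w k a - u k a| <= c by rewrite distrC.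
have := col_dist_lip j l h c0; have := col_dist_lip j l h' c0; rewrite /closeness ler_norml.
set a := col_dist u j l; set b := col_dist w j l.
by case: (leP 0 (1 - a)); case: (leP 0 (1 - b)); lra.
Qed.

(** A height is a sum of [n] terms of Lipschitz constant 2, an original row has constant 1; 2n + 1
    bounds both. *)
Lemma lift_conf_lip u w c i j : (forall k a, `|u k a - w k a| <= c) -> 0 <= c ->
  `|lift_conf u i j - lift_conf w i j| <= c *+ (n.*2).+1.
Proof.
move=> h c0; rewrite /lift_conf; case: (unlift _ _) => [k|].
  by apply: le_trans (h k j) _; rewrite mulrS lerDl mulrn_wge0.
rewrite /height -sumrB; apply: le_trans (ler_norm_sum _ _ _) _.
apply: (@le_trans _ _ (\sum_(l < n) c *+ 2)).
  apply: ler_sum => l _; rewrite -mulrBr normrM -[leRHS]mul1r ler_pM ?closeness_lip //.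
  by rewrite /side_sign; case: (ltngtP l j); rewrite ?subr0 ?sub0r ?subrr ?normrN ?normr1 ?normr0.
by rewrite sumr_const card_ord -mulrnA mul2n mulrS lerDr.
Qed.
End Lift.

Lemma lex_leq (x x' m k k' : nat) : (k < m)%N -> (k' < m)%N ->
  (x * m + k <= x' * m + k')%N = (x < x')%N || (x == x') && (k <= k')%N.
Proof.
move=> km km'; case: (ltngtP x x') => [h|h|->] /=; last by rewrite leq_add2l.
  by apply/idP; nia.
by apply/negbTE; nia.
Qed.

(** * The labelling given by an equivariant map *)

Section NoMap.
Variables (R : realType) (m n qm : nat) (f : ('I_m.+1 -> 'I_n -> R) -> 'I_m -> 'I_n -> R).
Notation M := (m * n).+1.
Notation conf := ('I_m.+1 -> 'I_n -> R).
Definition is_conf (x : conf) := forall j l, j <> l -> exists i, x i j <> x i l.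
Hypothesis f_sum : forall x, is_conf x -> forall k, \sum_j f x k j = 0.
Hypothesis f_norm : forall x, is_conf x -> \sum_k \sum_j f x k j * f x k j = 1.
Hypothesis f_perm : forall (s : 'S_n) x, is_conf x ->
  forall k j, f (fun i b => x i (s b)) k j = f x k (s j).
Hypothesis qm_gt0 : (0 < qm)%N.

Local Notation time := (@enc m n None).
Local Notation space k j := (@enc m n (Some (k, j))).
(** In the units of [grid] the cube reaches 2n + 5 from the origin. A cluster at a side extends at
    most 2(n + 1) from it, so a row forming a single cluster stays at distance at least 2 from 0,
    beyond the size of the entries of [f]. *)
Definition half_width := ((n.*2 + 5) * qm)%N.
Local Notation Q := half_width.
Local Notation K := Q.*2.
Notation cube := {ffun 'I_M -> 'I_K.+1}.

Definition grid (z : 'I_M -> nat) : 'I_m -> 'I_n -> R :=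
  fun k j => ((z (space k j))%:R - Q%:R) / qm%:R.

(** The row means supply the component on which [f], whose rows have sum 0, has no influence: if all
    entries of the field are small, then the means are small and so is [f]. *)
Definition field_val (z : 'I_M -> nat) (c : 'I_m * 'I_n) : R :=
  if z time == 0%N then grid z c.1 c.2
  else f (lift_conf (grid z)) c.1 c.2 + (\sum_l grid z c.1 l) / n%:R.

(** Columns are compared by an injective code of their values, equal columns by their indices, and
    entries of one column by their rows. *)
Definition coord_key (z : 'I_M -> nat) (c : 'I_m * 'I_n) : nat :=
  ((pickle [seq z (space k c.2) | k <- enum 'I_m] * n + c.2) * m + c.1)%N.

(* The minimised key makes the label equivariant under all permutations preserving the order of
   equal columns. *)
Definition label_opt (z : 'I_M -> nat) : option ('I_m * 'I_n) :=
  if [pick c | field_val z c < 0] is Some c0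
  then Some [arg min_(c < c0 | field_val z c < 0) coord_key z c] else None.

Definition label (z : 'I_M -> nat) : 'I_M := enc (label_opt z).

Lemma label_None z : label_opt z = None -> forall c, 0 <= field_val z c.
Proof. by rewrite /label_opt; case: pickP => // h _ c; rewrite leNgt h. Qed.

Lemma label_Some z c : label_opt z = Some c ->
  field_val z c < 0 /\ forall c', field_val z c' < 0 -> (coord_key z c <= coord_key z c')%N.
Proof. by rewrite /label_opt; case: pickP => // c0 h [<-]; case: arg_minnP. Qed.

Lemma coord_key_inj z : injective (coord_key z).
Proof.
move=> [k j] [k' j'] /eqP; rewrite /coord_key /= eqn_leq !lex_leq // => h.
have ek : k = k' by apply: val_inj => /=; lia.
have : (pickle [seq z (space k j) | k <- enum 'I_m] * n + j ==
        pickle [seq z (space k j') | k <- enum 'I_m] * n + j')%N by lia.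
rewrite eqn_leq !lex_leq // => h2.
by have -> : j = j' by [apply: val_inj => /=; lia]; rewrite ek.
Qed.

Lemma is_conf_lift u : is_conf (@lift_conf R m n u).
Proof. by move=> j l; exact: lift_conf_neq. Qed.

Section Equivariance.
Variables (z : 'I_M -> nat) (s : 'S_n).
Hypothesis s_close : forall a b : 'I_n, (a < b)%N -> col_dist (grid z) a b < 1 -> (s a < s b)%N.

Lemma grid_act k j : grid (act_point s z) k j = grid z k ((s^-1)%g j).
Proof. by rewrite /grid -{1}(permKV s j) act_pointE'. Qed.

Lemma field_val_act k j : field_val (act_point s z) (k, s j) = field_val z (k, j).
Proof.
have tz : act_point s z time = z time by exact: (act_pointE s z None).
rewrite /field_val tz /=; case: ifP => _; first by rewrite grid_act permK.
have gE : grid (act_point s z) = (fun k b => grid z k ((s^-1)%g b)).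
  by apply/funext => k'; apply/funext => b; exact: grid_act.
congr (_ + _ / _); last first.
  by rewrite [RHS](reindex_inj (@perm_inj _ (s^-1)%g)) /=; apply: eq_bigr => l _; rewrite grid_act.
have -> : lift_conf (grid (act_point s z)) = (fun i b => lift_conf (grid z) i ((s^-1)%g b)).
  by apply/funext => i; apply/funext => b; rewrite gE; exact: lift_conf_perm.
by rewrite f_perm ?permK //; exact: is_conf_lift.
Qed.

Lemma coord_key_act k j k' j' :
  (coord_key (act_point s z) (k, s j) <= coord_key (act_point s z) (k', s j'))%N =
  (coord_key z (k, j) <= coord_key z (k', j'))%N.
Proof.
rewrite /coord_key /= !lex_leq //.
have colE b : [seq act_point s z (space i (s b)) | i <- enum 'I_m] = [seq z (space i b) | i <- enum
  'I_m].
  by apply: eq_map => i; exact: act_pointE'.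
have eqj : (s j == s j' :> nat) = (j == j' :> nat).
  by rewrite !val_eqE (inj_eq perm_inj).
rewrite !colE; set a := pickle _; set b := pickle _.
have e : ((a * n + s j)%N == (b * n + s j')%N) = ((a * n + j)%N == (b * n + j')%N).
  have aux (x y : 'I_n) : ((a * n + x)%N == (b * n + y)%N) = (a == b) && (x == y :> nat).
    by rewrite eqn_leq !lex_leq //; lia.
  by rewrite !aux eqj.
rewrite e; congr (_ || _); rewrite !ltnNge !lex_leq //.
have [ab|//] := eqVneq b a; congr (~~ (_ || _)); rewrite /=.
have col : [seq z (space i j) | i <- enum 'I_m] = [seq z (space i j') | i <- enum 'I_m] ->
   forall i, z (space i j) = z (space i j').
  by move=> h i; move/eq_in_map: h => /(_ i); apply; rewrite mem_enum.
have colj := col (esym (pcan_inj pickleK ab)).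
have d0 x y : (forall i, z (space i x) = z (space i y)) -> col_dist (grid z) x y < 1.
  by move=> h; rewrite col_dist0 // => i; rewrite /grid h.
case: (ltngtP j j') => [h|h|/val_inj->]; last by rewrite leqnn.
  by have := s_close h (d0 _ _ colj); lia.
by have := s_close h (d0 _ _ (fun i => esym (colj i))); lia.
Qed.

(** The field values move with the columns. The order of the keys is kept too, because equal columns
    are close and [s] preserves their order; keys being distinct, the minimiser is unique. *)
Lemma label_act : label (act_point s z) = coord_perm m s (label z).
Proof.
rewrite /label coord_permE; congr enc.
case eD: (label_opt (act_point s z)) => [[k j]|]; case eC: (label_opt z) => [[k' j']|] //=.
- move: eD; rewrite -(permKV s j); move: ((s^-1)%g j) => {}j eD.
  have [nD mD] := label_Some eD; have [nC mC] := label_Some eC.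
  rewrite field_val_act in nD.
  have h1 := mC _ nD; have := mD (k', s j'); rewrite field_val_act coord_key_act => /(_ nC) h2.
  have [-> ->] : (k, j) = (k', j') by apply: (@coord_key_inj z); apply/eqP; rewrite eqn_leq h1 h2.
  by [].
- have [nD _] := label_Some eD; move: nD; rewrite -(permKV s j) field_val_act.
  by rewrite ltNge (label_None eC).
have [nC _] := label_Some eC; move: nC; rewrite -field_val_act.
by rewrite ltNge (label_None eD).
Qed.
End Equivariance.

Section Clusters.
Variable upper : bool.

Definition near_side i (k : 'I_m) (v : cube) : {set 'I_n} :=
  [set j | if upper then (K <= v (space k j) + i.*2 * qm)%N else (v (space k j) <= i.*2 * qm)%N].

(** The sets [near_side 1], [near_side 2], ... cannot grow strictly [n + 1] times with only [n]
    columns. The first repetition leaves a strip two units wide without points. *)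
Definition gap_index k v :=
  find (fun i => near_side i.+1 k v == near_side i.+2 k v) (iota 0 n.+1).

Definition cluster k v := near_side (gap_index k v).+1 k v.

Lemma near_side_mono i i' k v : (i <= i')%N -> near_side i k v \subset near_side i' k v.
Proof. by move=> ii; apply/fintype.subsetP => j; rewrite !inE; case: upper; nia. Qed.

Lemma gap_indexP k v : near_side (gap_index k v).+1 k v = near_side (gap_index k v).+2 k v /\
  (gap_index k v <= n)%N.
Proof.
set P := fun i => near_side i.+1 k v == near_side i.+2 k v.
have hP : has P (iota 0 n.+1).
  apply: contraT => /hasPn h.
  have card_ge i : (i <= n.+1)%N -> (i <= #|near_side i.+1 k v|)%N.
    elim: i => // i IHi iN; apply: leq_ltn_trans (IHi (ltnW iN)) _; apply: proper_card.
    by rewrite finset.properEneq near_side_mono // andbT; apply: h; rewrite mem_iota add0n.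
  have := card_ge n.+1 (leqnn _); rewrite leqNgt ltnS.
  by rewrite -[X in (_ <= X)%N](card_ord n) max_card.
have lt_n : (gap_index k v < n.+1)%N by rewrite -[X in (_ < X)%N](size_iota 0) -has_find.
have := nth_find 0%N hP; rewrite -/(gap_index k v) nth_iota // add0n => /eqP ->.
by split.
Qed.

Lemma near_side_act i k (v : cube) s : near_side i k (act_cube s v) = s @: near_side i k v.
Proof.
apply/setP => j; rewrite -[in RHS](permKV s j) mem_imset ?inE; last exact: perm_inj.
by rewrite ffunE coord_permE.
Qed.

Lemma cluster_act k (v : cube) s : cluster k (act_cube s v) = s @: cluster k v.
Proof.
rewrite /cluster near_side_act; congr (_ @: near_side _.+1 _ _).
apply: eq_find => i; rewrite !near_side_act.
by rewrite (inj_eq (imset_inj (@perm_inj _ s))).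
Qed.

(** The empty strip is [2 * qm] steps wide and the vertices of a simplex differ from its base by at
    most one step, so [qm] steps remain: distance 1, where the heights no longer interact. *)
Lemma cluster_gap k (v : cube) (pi : 'S_M) r j l : j \in cluster k v -> l \notin cluster k v ->
  1 <= col_dist (grid (kuhn (fun i => v i : nat) pi r)) j l.
Proof.
move=> jc lc; apply: le_trans (col_dist_ge _ _ _ k).
have [e _] := gap_indexP k v; move: jc lc; rewrite /cluster {2}e !inE; set i := gap_index k v.
rewrite -mulrBl normrM normfV (@ger0_norm _ qm%:R) ?ler0n // ler_pdivlMr ?ltr0n // mul1r.
rewrite opprB addrA subrK /kuhn; set b1 := nat_of_bool _; set b2 := nat_of_bool _.
have [b1_le b2_le] : (b1 <= 1)%N /\ (b2 <= 1)%N by split; exact: leq_b1.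
set x := nat_of_ord (v _); set y := nat_of_ord (v (space k l)).
move=> jc lc; have : (x + b1 + qm <= y + b2)%N \/ (y + b2 + qm <= x + b1)%N.
  by move: jc lc; case: upper; nia.
rewrite !natrD ler_normr; case; rewrite -(ler_nat R) !natrD => h; apply/orP; [right|left]; lra.
Qed.

Lemma cluster_equivariant k (v : cube) s :
  increasing_on (cluster k v) s -> increasing_on (~: cluster k v) s ->
  cluster k (act_cube s v) = s @: cluster k v /\ lab_equivariant label v s.
Proof.
move=> i1 i2; split; first exact: cluster_act.
move=> pi r; apply: label_act => a b ab d1.
have [ac|ac] := boolP (a \in cluster k v); have [bc|bc] := boolP (b \in cluster k v).
- exact: i1.
- by move: d1; rewrite ltNge (cluster_gap pi r ac bc).
- by move: d1; rewrite col_distC ltNge (cluster_gap pi r bc ac).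
by apply: i2; rewrite ?finset.in_setC.
Qed.

End Clusters.

Lemma f_le1 x k j : is_conf x -> -1 <= f x k j <= 1.
Proof.
move=> cx; rewrite -ler_norml -(ler_pXn2r (n := 2)) ?nnegrE // expr1n real_normK ?num_real //.
rewrite -(f_norm cx) (bigD1 k) //= (bigD1 j) //= -expr2 -addrA lerDl addr_ge0 //.
  by apply: sumr_ge0 => i _; rewrite -expr2 sqr_ge0.
by apply: sumr_ge0 => i _; apply: sumr_ge0 => i' _; rewrite -expr2 sqr_ge0.
Qed.

Lemma field_val_bounds z k a b : (forall j, a <= grid z k j <= b) ->
  (forall j, Num.min a (a - 1) <= field_val z (k, j) <= Num.max b (b + 1)).
Proof.
move=> h j; have n0 : 0 < n%:R :> R by rewrite ltr0n; apply: leq_ltn_trans (ltn_ord j).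
rewrite min_r ?gerBl // max_r ?lerDl // /field_val /=; case: ifP => _.
  by have := h j; lra.
have := f_le1 k j (is_conf_lift (grid z)).
suff : a <= (\sum_l grid z k l) / n%:R <= b by lra.
rewrite ler_pdivlMr // ler_pdivrMr // !mulr_natr -[X in a *+ X](card_ord n) -[X in b *+ X](card_ord n).
by rewrite -!sumr_const; apply/andP; split; apply: ler_sum => l _; have /andP[] := h l.
Qed.

Lemma label_time z : label z = time -> forall c, 0 <= field_val z c.
Proof. by move=> /(@enc_inj m n); exact: label_None. Qed.

Lemma label_space z k j : label z = space k j -> field_val z (k, j) < 0.
Proof. by move=> /(@enc_inj m n)/label_Some[]. Qed.

(** The column on the face belongs to the cluster, which is therefore not empty. If it contains all
    columns, row [k] is at least 1 on the grid, its field values are nonnegative, and the label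
    [space k j] does not occur. *)
Lemma upper_vanish k (v : cube) (pi : 'S_M) j : (v (space k j)).+1 = K ->
  cluster true k v = finset.set0 \/ cluster true k v = finset.setT ->
  label_sign (fun q => label (face v pi ord0 q)) = 0.
Proof.
move=> vj cl; apply: (@label_sign_miss _ _ (space k j)) => q; apply/eqP => /label_space.
apply/negP; rewrite -leNgt.
case: cl => cl.
  have := finset.in_set0 j; rewrite -cl inE => /negbT; rewrite -ltnNge; move: vj.
  by set x := nat_of_ord _; set i := gap_index _ _ _; nia.
suff h l : 1 <= grid (face v pi ord0 q) k l.
  set z := face v pi ord0 q in h *.
  pose b := \big[Num.max/1]_l grid z k l.
  have /(field_val_bounds (a := 1) (b := b))/(_ j)/andP[] : forall l, 1 <= grid z k l <= b.
    by move=> l; rewrite h le_bigmax.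
  by rewrite subrr min_r.
have := finset.in_setT l; rewrite -cl inE; have [_] := gap_indexP true k v; set i := gap_index _ _ _.
move=> i_n; rewrite /grid /face /kuhn ler_pdivlMr ?ltr0n // mul1r; set y := nat_of_ord (v _) => h.
rewrite lerBrDr -natrD ler_nat.
have : (n.*2 * qm >= i.*2 * qm)%N by rewrite leq_mul2r leq_double i_n orbT.
by move: h; rewrite /half_width; nia.
Qed.

(** Here a cluster of all columns puts row [k] at -2 or below; its field values are negative, and
    the label [time] does not occur. *)
Lemma lower_vanish k (v : cube) (pi : 'S_M) j : v (space k j) = 0%N :> nat ->
  cluster false k v = finset.set0 \/ cluster false k v = finset.setT ->
  label_sign (fun q => label (face v pi ord_max q)) = 0.
Proof.
move=> vj cl; apply: (@label_sign_miss _ _ time) => q; apply/eqP => /label_time/(_ (k, j)).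
apply/negP; rewrite -ltNge.
case: cl => cl.
  by have := finset.in_set0 j; rewrite -cl inE vj.
suff h l : grid (face v pi ord_max q) k l <= -2.
  set z := face v pi ord_max q in h *.
  pose a := \big[Num.min/0]_l grid z k l.
  have /(field_val_bounds (a := a) (b := -2))/(_ j)/andP[_] : forall l, a <= grid z k l <= -2.
    by move=> l; rewrite h bigmin_le.
  by move/le_lt_trans; apply; rewrite max_r; lra.
have := finset.in_setT l; rewrite -cl inE; have [_] := gap_indexP false k v; set i := gap_index _ _ _.
move=> i_n; rewrite /grid /face /kuhn ler_pdivrMr ?ltr0n //; set y := nat_of_ord (v _) => h.
set b := nat_of_bool _.
have b1 : (b <= 1)%N by exact: leq_b1.
have : (n.*2 * qm >= i.*2 * qm)%N by rewrite leq_mul2r leq_double i_n orbT.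
move=> h2; have : (y + b + 2 * qm <= Q)%N by move: h; rewrite /half_width; nia.
by rewrite -(ler_nat R) natrD natrM; lra.
Qed.

Hypothesis qm_big : ((m * n).+1 * 2 < qm)%N.
Hypothesis f_unif : forall z z' k j, (forall i, (z i <= K)%N) ->
  (forall i, (z i <= z' i + 1)%N /\ (z' i <= z i + 1)%N) ->
  `|f (lift_conf (grid z)) k j - f (lift_conf (grid z')) k j| < ((m * n).+1 * 2)%:R^-1.

(** If all labels occurred, the vertex labelled [time] would have nonnegative field values, each
    close to a negative one at another vertex. All of them, hence the row means and the entries of
    [f], would be small, but the squares of the latter add up to 1. *)
Lemma time1_vanish (v : cube) (pi : 'S_M) : (0 < m)%N -> (0 < n)%N -> in_box (@box m n K) v ->
  pi time = ord0 ->
  label_sign (fun q => label (face v pi ord0 q)) = 0.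
Proof.
move=> m0 n0 /forallP bv pt0; apply/eqP; apply: contraT => ls0.
have surj i : exists q, label (face v pi ord0 q) = i.
  apply: contrapT => nq; move: ls0; rewrite (@label_sign_miss _ _ i) ?eqxx // => r.
  by apply/eqP => e; apply: nq; exists r.
have zt q : face v pi ord0 q time = 1%N.
  by rewrite /face /kuhn pt0 lift0 /=; have := bv time; rewrite /box eqxx; lia.
have z_le q i : (face v pi ord0 q i <= K)%N.
  have K0 : (0 < K)%N by rewrite /half_width; nia.
  apply: (@leq_trans (v i).+1); first by rewrite /face /kuhn -[leqRHS]addn1 leq_add2l; case: (_ < _)%N.
  by apply: leq_trans (bv i) _; rewrite /box; case: (_ == _).
have z_close q q' i : (face v pi ord0 q i <= face v pi ord0 q' i + 1)%N.
  by rewrite /face /kuhn -addnA leq_add2l addn1; apply: leq_trans (leq_b1 _) _.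
have [q0 /label_time F0] := surj time.
set z0 := face v pi ord0 q0 in F0.
pose N2 : R := ((m * n).+1 * 2)%:R.
have N2_gt0 : 0 < N2 by rewrite ltr0n.
have fE q : field_val (face v pi ord0 q) = fun c =>
   f (lift_conf (grid (face v pi ord0 q))) c.1 c.2 + (\sum_l grid (face v pi ord0 q) c.1 l) / n%:R.
  by apply/funext => c; rewrite /field_val zt.
have nR : 0 < n%:R :> R by rewrite ltr0n.
have qR : 0 < qm%:R :> R by rewrite ltr0n.
have qmi : qm%:R^-1 < N2^-1 by rewrite ltf_pV2 ?posrE // ltr_nat.
(* One [N2^-1] accounts for the variation of [f] between two vertices, the other for that of the
   mean, at most [qm%:R^-1]. *)
have F1 c : field_val z0 c < N2^-1 *+ 2.
  case: c => k j; have [q /label_space Fq] := surj (space k j).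
  have h1 := @f_unif z0 (face v pi ord0 q) k j (z_le q0) (fun i =>
    conj (z_close q0 q i) (z_close q q0 i)).
  have h2 : (\sum_l grid z0 k l) / n%:R <= (\sum_l grid (face v pi ord0 q) k l) / n%:R + qm%:R^-1.
    rewrite ler_pdivrMr // mulrDl divfK ?gt_eqF // mulr_natr -[X in _ *+ X](card_ord n) -sumr_const.
    rewrite -big_split /=; apply: ler_sum => l _; rewrite /grid -lerBlDl -mulrBl -[leRHS]mul1r
      ler_pM2r ?invr_gt0 //.
    rewrite opprB addrA subrK lerBlDl natr1 ler_nat -addn1; exact: z_close.
  have := fE q0; rewrite -/z0 => ->; move: Fq h1; rewrite fE /= -/N2 ltr_norml => Fq /andP[_ h1].
  move: Fq h1 h2 qmi; set A := f _ k j; set A0 := f _ k j; set B := _ / (n%:R : R);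
    set B0 := _ / (n%:R : R).
  set x := (qm%:R : R)^-1; set y := N2^-1; clearbody A A0 B B0 x y; lra.
(* As the rows of [f] have sum 0, the mean of a row of the grid is the mean of its field values. *)
have mean_b k : 0 <= (\sum_l grid z0 k l) / n%:R <= N2^-1 *+ 2.
  have e : \sum_l field_val z0 (k, l) = \sum_l grid z0 k l.
    rewrite fE big_split /= f_sum ?add0r; last exact: is_conf_lift.
    rewrite sumr_const card_ord /=; transitivity ((\sum_l grid z0 k l) / n%:R * n%:R);
      last by rewrite divfK ?gt_eqF.
    by rewrite mulr_natr.
  rewrite -e divr_ge0 ?ler0n ?sumr_ge0 //= ler_pdivrMr // mulr_natr -[X in _ *+ X](card_ord n)
    -sumr_const.
  by apply: ler_sum => l _; apply: ltW.
have f_small k j : `|f (lift_conf (grid z0)) k j| <= N2^-1 *+ 2.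
  rewrite ler_norml; move: (F0 (k, j)) (F1 (k, j)) (mean_b k); have := fE q0; rewrite -/z0 => -> /=.
  set A := f _ k j; set B := _ / (n%:R : R); set y := N2^-1; clearbody A B y; lra.
have := f_norm (is_conf_lift (grid z0)).
suff : \sum_k \sum_j f (lift_conf (grid z0)) k j * f (lift_conf (grid z0)) k j < 1 by lra.
(* There are mn entries, each of absolute value at most [N2^-1 *+ 2] = 1/(mn + 1), and so is each
   square. *)
apply: (@le_lt_trans _ _ (\sum_(k < m) \sum_(j < n) (N2^-1 *+ 2))).
  apply: ler_sum => k _; apply: ler_sum => j _.
  rewrite -expr2 -real_normK ?num_real // expr2 -[leRHS]mul1r ler_pM //.
  by apply: le_trans (f_small k j) _; rewrite -mulr_natr mulrC ler_pdivrMr // mul1r ler_nat; lia.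
rewrite !sumr_const !card_ord -!mulrnA -mulr_natr mulrC ltr_pdivrMr // mul1r ltr_nat; nia.
Qed.

Lemma no_map_prime_power p e : prime p -> (0 < m)%N -> (0 < n)%N -> n = (p ^ e)%N -> False.
Proof.
move=> pr_p m0 n0 nE; have K0 : (0 < K)%N by rewrite /half_width; nia.
have := @dvd_time0 m n p e K pr_p nE K0 label (cluster true) (cluster false).
have -> := @time0_count m n K Q.
- move=> H; suff : (p %| 1)%Z by rewrite dvdz1 /= => /eqP p1; rewrite p1 in pr_p.
  apply: H.
  + by move=> v pi; exact: time1_vanish.
  + by move=> k v pi j _ _; exact: upper_vanish.
  + by move=> k v pi j _ _; exact: lower_vanish.
  + by move=> k v s _; exact: cluster_equivariant.
  by move=> k v s _; exact: cluster_equivariant.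
- by rewrite /half_width; nia.
- by lia.
- move=> z z0 /label_time h i; rewrite -(decK i); case: (dec i) => [[k j]|]; last by rewrite eqxx.
  move=> _; have := h (k, j); rewrite /field_val z0 eqxx /grid /= pmulr_lge0 ?invr_gt0 ?ltr0n //.
  by rewrite subr_ge0 ler_nat.
move=> z z0; have := decK (label z); case: (dec (label z)) => [[k j]|] lE; last by rewrite -lE eqxx.
have /label_space := esym lE; rewrite -lE /field_val z0 eqxx /grid /= => h _; move: h.
by rewrite pmulr_llt0 ?invr_gt0 ?ltr0n // subr_lt0 ltr_nat.
Qed.
End NoMap.

Section NonExistence.
Variables (R : realType) (m n : nat).
Notation conf := ('I_m.+1 -> 'I_n -> R).

(** Continuity of [f] is only known on configurations, but the lift makes every matrix a
    configuration, so compactness of a whole box can be used. *)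
Lemma lift_conf_unif (f : conf -> 'I_m -> 'I_n -> R) (L eps : R) :
  (forall x, is_conf x -> forall eps : R, 0 < eps -> exists delta : R, 0 < delta /\
     forall y, is_conf y -> (forall i j, `|y i j - x i j| < delta) ->
     forall i j, `|f y i j - f x i j| < eps) ->
  0 < eps -> exists delta : R, 0 < delta /\
    forall u w, (forall k j, `|u k j| <= L) -> (forall k j, `|w k j - u k j| < delta) ->
    forall k j, `|f (lift_conf w) k j - f (lift_conf u) k j| < eps.
Proof.
move=> f_cont eps0.
pose U (v : 'rV[R]_(m * n)) : 'I_m -> 'I_n -> R := fun k j => v 0 (mxvec_index k j).
have /choice[delta hdelta] (c : 'I_m * 'I_n) : exists delta : R, 0 < delta /\
    forall v v' : 'rV[R]_(m * n), (forall i, `|v 0 i| <= L) -> (forall i, `|v' 0 i - v 0 i| < delta) ->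
      `|f (lift_conf (U v')) c.1 c.2 - f (lift_conf (U v)) c.1 c.2| < eps.
  case: c => k j; apply: unif_cont_box => // v e e0.
  have [d [d0 hd]] := f_cont _ (is_conf_lift (U v)) _ e0.
  exists (d / (n.*2).+2%:R); split; first by rewrite divr_gt0.
  move=> v' hv'; apply: hd => [|i b]; first exact: is_conf_lift.
  apply: (@le_lt_trans _ _ ((d / (n.*2).+2%:R) *+ (n.*2).+1)).
    apply: lift_conf_lip => [k' a|]; first exact/ltW/hv'.
    by rewrite divr_ge0 ?ltW.
  by rewrite -[_ *+ _]mulr_natr mulrAC ltr_pdivrMr // ltr_pM2l // ltr_nat.
exists (\big[Num.min/1]_c delta c); split.
  by apply/bigmin_gtP; split=> [|c _]; [exact: ltr01 | have [] := hdelta c].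
move=> u w hu hw k j; have [_ h] := hdelta (k, j).
pose V (x : 'I_m -> 'I_n -> R) : 'rV[R]_(m * n) := mxvec (\matrix_(k, j) x k j).
have VK x : U (V x) = x by apply/funext => a; apply/funext => b; rewrite /U /V mxvecE mxE.
rewrite -(VK u) -(VK w); apply: h => i; case/mxvec_indexP: i => a b; rewrite !mxvecE !mxE //.
by apply: lt_le_trans (hw a b) _; exact: bigmin_le.
Qed.

Theorem no_equivariant_map (f : conf -> 'I_m -> 'I_n -> R) p e :
  prime p -> n = (p ^ e)%N -> (0 < m)%N ->
  (forall x, is_conf x -> forall k, \sum_j f x k j = 0) ->
  (forall x, is_conf x -> \sum_k \sum_j f x k j * f x k j = 1) ->
  (forall (s : 'S_n) x, is_conf x -> forall k j, f (fun i b => x i (s b)) k j = f x k (s j)) ->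
  (forall x, is_conf x -> forall eps : R, 0 < eps -> exists delta : R, 0 < delta /\
     forall y, is_conf y -> (forall i j, `|y i j - x i j| < delta) ->
     forall i j, `|f y i j - f x i j| < eps) -> False.
Proof.
move=> pr_p nE m0 f_sum f_norm f_perm f_cont.
have n0 : (0 < n)%N by rewrite nE expn_gt0 prime_gt0.
have e0 : 0 < ((m * n).+1 * 2)%:R^-1 :> R by rewrite invr_gt0 ltr0n.
have [delta [delta0 hdelta]] := @lift_conf_unif f (n.*2 + 5)%:R _ f_cont e0.
(* The first summand keeps the variation of the means below 1/(2(mn + 1)), the second makes a grid
   step shorter than [delta]. *)
pose qm := ((m * n).+1 * 2 + (Num.bound delta^-1)).+1.
have qm0 : (0 < qm)%N by [].
have qR : 0 < qm%:R :> R by rewrite ltr0n.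
have qd : qm%:R^-1 < delta.
  rewrite invf_plt ?posrE //; apply: lt_trans (archi_boundP _) _; first by rewrite invr_ge0 ltW.
  by rewrite ltr_nat /qm ltnS leq_addl.
apply: (@no_map_prime_power R m n qm f f_sum f_norm f_perm qm0 _ _ p e) => //.
  by rewrite /qm ltnS leq_addr.
move=> z z' k j zK zz'; rewrite distrC; apply: hdelta => {k j} k j.
  rewrite /grid normrM normfV (@gtr0_norm _ qm%:R) // ler_pdivrMr // -natrM ler_norml.
  have := zK (enc (Some (k, j))); rewrite -/(half_width n qm) -(ler_nat R) -addnn natrD.
  have : 0 <= (z (enc (Some (k, j))))%:R :> R by [].
  by lra.
apply: le_lt_trans qd; rewrite /grid -mulrBl normrM normfV (@gtr0_norm _ qm%:R) //.
rewrite -[leRHS]mul1r ler_pM2r ?invr_gt0 // opprB addrA subrK ler_norml.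
by have [] := zz' (enc (Some (k, j))); rewrite -!(ler_nat R) !natrD; lra.
Qed.
End NonExistence.

Local Open Scope classical_set_scope.
Local Open Scope ring_scope.

(** * Euclidean geometry of the hyperplane *)

Section Euclid.
Variables (R : realType) (n : nat).
Notation V := 'rV[R]_n.
Implicit Types u v w : V.

Definition dot u v : R := \sum_j u 0 j * v 0 j.
Definition nrm u : R := Num.sqrt (dot u u).

Lemma dotC u v : dot u v = dot v u.
Proof. by apply: eq_bigr => j _; rewrite mulrC. Qed.

Lemma dotDl u v w : dot (u + v) w = dot u w + dot v w.
Proof. by rewrite /dot -big_split; apply: eq_bigr => j _; rewrite mxE mulrDl. Qed.

Lemma dotZl a u w : dot (a *: u) w = a * dot u w.
Proof. by rewrite /dot mulr_sumr; apply: eq_bigr => j _; rewrite mxE mulrA. Qed.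

Lemma dotNl u w : dot (- u) w = - dot u w.
Proof. by rewrite -scaleN1r dotZl mulN1r. Qed.

Lemma dotBl u v w : dot (u - v) w = dot u w - dot v w.
Proof. by rewrite dotDl dotNl. Qed.

Lemma dotDr u v w : dot w (u + v) = dot w u + dot w v.
Proof. by rewrite dotC dotDl !(dotC w). Qed.

Lemma dotZr a u w : dot w (a *: u) = a * dot w u.
Proof. by rewrite dotC dotZl dotC. Qed.

Lemma dotNr u w : dot w (- u) = - dot w u.
Proof. by rewrite dotC dotNl dotC. Qed.

Lemma dotBr u v w : dot w (u - v) = dot w u - dot w v.
Proof. by rewrite dotDr dotNr. Qed.

Lemma dot0l u : dot 0 u = 0. Proof. by rewrite -(scale0r 0) dotZl mul0r. Qed.
Lemma dot0r u : dot u 0 = 0. Proof. by rewrite dotC dot0l. Qed.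

Definition dotE := (dotDl, dotDr, dotBl, dotBr, dotNl, dotNr, dotZl, dotZr).

Lemma dot_ge0 u : 0 <= dot u u.
Proof. by apply: sumr_ge0 => j _; rewrite -expr2 sqr_ge0. Qed.

Lemma dot_eq0 u : (dot u u == 0) = (u == 0).
Proof.
apply/idP/idP => [|/eqP->]; last by rewrite dot0l.
rewrite psumr_eq0 => [|j _]; last by rewrite -expr2 sqr_ge0.
move/allP => h; apply/eqP/rowP => j; rewrite mxE; apply/eqP.
by have := h j; rewrite mem_index_enum => /(_ isT) /=; rewrite mulf_eq0 orbb.
Qed.

Lemma dot_gt0 u : (0 < dot u u) = (u != 0).
Proof. by rewrite lt_def dot_ge0 andbT dot_eq0. Qed.

Lemma nrm_ge0 u : 0 <= nrm u. Proof. exact: sqrtr_ge0. Qed.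

Lemma nrm_sqr u : nrm u ^+ 2 = dot u u.
Proof. by rewrite sqr_sqrtr // dot_ge0. Qed.

Lemma nrm_eq0 u : (nrm u == 0) = (u == 0).
Proof. by rewrite -dot_eq0 -nrm_sqr expf_eq0. Qed.

Lemma nrm_gt0 u : (0 < nrm u) = (u != 0).
Proof. by rewrite lt_def nrm_ge0 andbT nrm_eq0. Qed.

Lemma nrm1_dot u : nrm u = 1 -> dot u u = 1.
Proof. by move=> e; rewrite -nrm_sqr e expr1n. Qed.

Lemma nrmZ a u : nrm (a *: u) = `|a| * nrm u.
Proof. by rewrite /nrm dotZl dotZr mulrA -expr2 sqrtrM ?sqr_ge0 // sqrtr_sqr. Qed.

Lemma nrmN u : nrm (- u) = nrm u.
Proof. by rewrite -scaleN1r nrmZ normrN1 mul1r. Qed.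

Lemma nrmC u v : nrm (u - v) = nrm (v - u).
Proof. by rewrite -nrmN opprB. Qed.

Lemma cauchy_schwarz u v : `|dot u v| <= nrm u * nrm v.
Proof.
have [->|v0] := eqVneq v 0; first by rewrite dot0r normr0 mulr_ge0 ?nrm_ge0.
rewrite -(ler_pXn2r (n := 2)) ?nnegrE ?mulr_ge0 ?nrm_ge0 // exprMn !nrm_sqr real_normK ?num_real //.
have v1 : 0 < dot v v by rewrite dot_gt0.
have := dot_ge0 (dot v v *: u - dot u v *: v); rewrite !dotE (dotC v u).
rewrite -(pmulr_rge0 _ v1) => h; rewrite -subr_ge0 -(pmulr_rge0 _ v1) -(pmulr_rge0 _ v1).
by move: h; congr (0 <= _); ring.
Qed.

Lemma dot_le u v : dot u v <= nrm u * nrm v.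
Proof. exact: le_trans (ler_norm _) (cauchy_schwarz u v). Qed.

Lemma nrmD u v : nrm (u + v) <= nrm u + nrm v.
Proof.
rewrite -(ler_pXn2r (n := 2)) ?nnegrE ?addr_ge0 ?nrm_ge0 // sqrrD !nrm_sqr !dotE (dotC v u).
by have := dot_le u v; lra.
Qed.

Lemma nrm_triangle u v w : nrm (u - w) <= nrm (u - v) + nrm (v - w).
Proof. by apply: le_trans (nrmD _ _); rewrite addrA subrK. Qed.

Lemma dot_eq1 u v : nrm u = 1 -> nrm v = 1 -> dot u v = 1 -> u = v.
Proof.
move=> /nrm1_dot u1 /nrm1_dot v1 uv; apply/eqP; rewrite -subr_eq0 -dot_eq0 !dotE u1 v1 (dotC v) uv.
by apply/eqP; ring.
Qed.

End Euclid.

Lemma continuous_big (T U : topologicalType) (op : U -> U -> U) (idx : U)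
    (I : finType) (P : pred I) (F : I -> T -> U) :
  (forall f g : T -> U, continuous f -> continuous g -> continuous (fun x => op (f x) (g x))) ->
  (forall i, continuous (F i)) -> continuous (fun x => \big[op/idx]_(i | P i) F i x).
Proof.
move=> opc Fc; elim: (index_enum I) => [|i r IHr].
  rewrite [X in continuous X](_ : _ = fun=> idx); first by move=> x; exact: cvg_cst.
  by apply/funext => x; rewrite big_nil.
case Pi: (P i).
  rewrite [X in continuous X](_ : _ = fun x => op (F i x) (\big[op/idx]_(i <- r | P i) F i x)).
    exact: opc.
  by apply/funext => x; rewrite big_cons Pi.
rewrite [X in continuous X](_ : _ = fun x => \big[op/idx]_(i <- r | P i) F i x) //.
by apply/funext => x; rewrite big_cons Pi.
Qed.

Section Continuity.
Variables (R : realType) (n : nat) (T : topologicalType).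
Notation V := 'rV[R]_n.
Implicit Types (f g : T -> V) (a : T -> R).

Lemma cvg_rV f x : (forall j, f y 0 j @[y --> x] --> f x 0 j) -> f y @[y --> x] --> f x.
Proof.
move=> fc; apply/cvg_ballP => e e0.
have : \forall y \near x, forall j : 'I_n, ball (f x 0 j) e (f y 0 j).
  apply: filter_forall => j; have /cvg_ballP := fc j; exact.
by apply: filterS => y h; split=> // i j; rewrite (ord1 i).
Qed.

Lemma continuous_rV f : (forall j, continuous (fun x => f x 0 j)) -> continuous f.
Proof. by move=> fc x; apply: cvg_rV => j; exact: fc. Qed.

Lemma continuous_coord f j : continuous f -> continuous (fun x => f x 0 j).
Proof. by move=> fc x; apply: (@continuous_comp _ _ _ f) (fc x) (@coord_continuous R 1 n 0 j _). Qed.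

Lemma continuous_add f g : continuous f -> continuous g -> continuous (fun x => f x + g x).
Proof. by move=> fc gc x; exact: cvgD (fc x) (gc x). Qed.

Lemma continuous_sub f g : continuous f -> continuous g -> continuous (fun x => f x - g x).
Proof. by move=> fc gc x; exact: cvgB (fc x) (gc x). Qed.

Lemma continuous_scale a f : continuous a -> continuous f -> continuous (fun x => a x *: f x).
Proof. by move=> ac fc x; exact: cvgZ (ac x) (fc x). Qed.

Lemma continuous_cst (U : topologicalType) (c : U) : continuous (fun _ : T => c).
Proof. by move=> x; exact: cvg_cst. Qed.

Lemma continuous_addr (a b : T -> R) : continuous a -> continuous b -> continuous (fun x => a x + b x).
Proof. by move=> ac bc x; exact: cvgD (ac x) (bc x). Qed.

Lemma continuous_subr (a b : T -> R) : continuous a -> continuous b -> continuous (fun x => a x - b x).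
Proof. by move=> ac bc x; exact: cvgB (ac x) (bc x). Qed.

Lemma continuous_mulr (a b : T -> R) : continuous a -> continuous b -> continuous (fun x => a x * b x).
Proof. by move=> ac bc x; exact: cvgM (ac x) (bc x). Qed.

Lemma continuous_inv a : continuous a -> (forall x, a x != 0) -> continuous (fun x => (a x)^-1).
Proof. by move=> ac a0 x; apply: cvgV (ac x). Qed.

Lemma continuous_max (a b : T -> R) : continuous a -> continuous b -> continuous (fun x =>
  Num.max (a x) (b x)).
Proof. by move=> ac bc x; exact: (continuous_max (ac x) (bc x)). Qed.

Lemma continuous_min (a b : T -> R) : continuous a -> continuous b -> continuous (fun x =>
  Num.min (a x) (b x)).
Proof. by move=> ac bc x; exact: (continuous_min (ac x) (bc x)). Qed.

Lemma continuous_sum (I : finType) (P : pred I) (F : I -> T -> V) :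
  (forall i, continuous (F i)) -> continuous (fun x => \sum_(i | P i) F i x).
Proof. by apply: continuous_big => f g; exact: continuous_add. Qed.

Lemma continuous_sumr (I : finType) (P : pred I) (F : I -> T -> R) :
  (forall i, continuous (F i)) -> continuous (fun x => \sum_(i | P i) F i x).
Proof. by apply: continuous_big => f g; exact: continuous_addr. Qed.

Lemma continuous_dot f g : continuous f -> continuous g -> continuous (fun x => dot (f x) (g x)).
Proof.
move=> fc gc; apply: continuous_sumr => j; apply: continuous_mulr; exact: continuous_coord.
Qed.

Lemma continuous_nrm f : continuous f -> continuous (fun x => nrm (f x)).
Proof.
move=> fc x; apply: (@continuous_comp _ _ _ (fun x => dot (f x) (f x)) Num.sqrt);
  last exact: sqrt_continuous.
exact: continuous_dot.
Qed.

Lemma continuous_comp_fun (U W : topologicalType) (g : U -> W) (h : T -> U) :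
  continuous g -> continuous h -> continuous (fun x => g (h x)).
Proof. by move=> gc hc x; apply: (@continuous_comp _ _ _ h g) (hc x) (gc _). Qed.

Lemma continuous_pair (U W : topologicalType) (g : T -> U) (h : T -> W) :
  continuous g -> continuous h -> continuous (fun x => (g x, h x)).
Proof. by move=> gc hc x; apply: cvg_pair (gc x) (hc x). Qed.

Lemma continuous_mulmx f (M : T -> 'M[R]_n) : continuous f ->
  (forall i j, continuous (fun x => M x i j)) -> continuous (fun x => f x *m M x).
Proof.
move=> fc Mc; apply: continuous_rV => j.
have -> : (fun x => (f x *m M x) 0 j) = (fun x => \sum_k f x 0 k * M x k j).
  by apply/funext => x; rewrite mxE.
by apply: continuous_sumr => k; apply: continuous_mulr => //; exact: continuous_coord.
Qed.
End Continuity.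

(** The same block matrix is factored in two ways, eliminating one or the other of its diagonal
    blocks. *)
Lemma det_one_sub_mul (F : comUnitRingType) n (c : 'cV[F]_n) (r : 'rV[F]_n) :
  \det (1%:M - c *m r) = 1 - (r *m c) 0 0.
Proof.
pose A := block_mx (1%:M : 'M[F]_1) r c (1%:M : 'M[F]_n).
have e1 : A = block_mx 1%:M 0 c 1%:M *m block_mx 1%:M r 0 (1%:M - c *m r).
  rewrite mulmx_block !mul1mx !mulmx0 !mul0mx !mulmx1 !addr0 ?add0r.
  by rewrite addrC subrK.
have e2 : A = block_mx 1%:M r 0 1%:M *m block_mx (1%:M - r *m c) 0 c 1%:M.
  by rewrite mulmx_block !mul1mx !mulmx0 !mul0mx !mulmx1 !add0r subrK.
have d1 : \det A = \det (1%:M - c *m r) by rewrite e1 det_mulmx det_lblock det_ublock !det1 !mul1r.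
have d2 : \det A = \det (1%:M - r *m c) by rewrite e2 det_mulmx det_lblock det_ublock !det1 !mul1r mulr1.
by rewrite -d1 d2 det_mx11 !mxE eqxx.
Qed.

(** * Reflections and paths of isometries *)

Section Reflections.
Variables (R : realType) (n : nat).
Notation V := 'rV[R]_n.
Implicit Types (a b u v x y z : V) (O S : 'M[R]_n).

(** The Householder reflection with axis [a]; it is the identity for [a = 0]. *)
Definition refl a u : V := u - (2 * dot u a / dot a a) *: a.

Definition refl_mx a : 'M[R]_n := 1%:M - (2 / dot a a) *: (a^T *m a).

Lemma mulmx_dot u a : u *m (a^T *m a) = dot u a *: a.
Proof.
rewrite mulmxA; apply/rowP => j; rewrite !mxE big_ord1 !mxE; congr (_ * _).
by apply: eq_bigr => k _; rewrite mxE.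
Qed.

Lemma mul_refl_mx u a : u *m refl_mx a = refl a u.
Proof. by rewrite /refl_mx mulmxBr mulmx1 -scalemxAr mulmx_dot scalerA /refl; congr (_ - _ *: _);
  ring. Qed.

Lemma refl_dot a u v : dot (refl a u) (refl a v) = dot u v.
Proof.
have [->|a0] := eqVneq a 0; first by rewrite /refl !scaler0 !subr0.
have aa : dot a a != 0 by rewrite dot_eq0.
by rewrite /refl !dotE (dotC a v); field.
Qed.

Lemma refl_fix a u : dot u a = 0 -> refl a u = u.
Proof. by move=> h; rewrite /refl h mulr0 mul0r scale0r subr0. Qed.

Lemma refl_self a : refl a a = - a.
Proof.
have [->|a0] := eqVneq a 0; first by rewrite /refl scaler0 subr0 oppr0.
have aa : dot a a != 0 by rewrite dot_eq0.
by rewrite /refl mulfK // scaler_nat mulr2n opprD addNKr.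
Qed.

Lemma refl_swap x y : dot x x = dot y y -> refl (x - y) x = y.
Proof.
move=> h; have [e|d0] := eqVneq (x - y) 0.
  by rewrite e refl_fix ?dot0r //; apply/eqP; rewrite -subr_eq0 e.
have dd : dot (x - y) (x - y) != 0 by rewrite dot_eq0.
rewrite /refl; have -> : 2 * dot x (x - y) / dot (x - y) (x - y) = 1.
  apply/eqP; rewrite -(inj_eq (mulIf dd)) divfK // mul1r !dotE h (dotC y x); apply/eqP; ring.
by rewrite scale1r opprB addrCA subrr addr0.
Qed.

Lemma refl_bisect x y : dot x x = dot y y -> refl (x + y) x = - y.
Proof. by move=> h; rewrite -{1}(opprK y) refl_swap // !dotE opprK. Qed.

Lemma reflK a : involutive (refl a).
Proof.
move=> u; have [->|a0] := eqVneq a 0; first by rewrite /refl !scaler0 !subr0.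
have aa : dot a a != 0 by rewrite dot_eq0.
apply/rowP => j; rewrite /refl !dotE !mxE; field.
exact: aa.
Qed.

Lemma refl_mxK a : refl_mx a *m refl_mx a = 1%:M.
Proof.
by apply/row_matrixP => i; rewrite !rowE mulmxA !mul_refl_mx reflK mulmx1.
Qed.

Lemma refl_scale c a u : c != 0 -> refl (c *: a) u = refl a u.
Proof.
move=> c0; have [->|a0] := eqVneq a 0; first by rewrite scaler0.
have aa : dot a a != 0 by rewrite dot_eq0.
apply/rowP => j; rewrite /refl !dotE !mxE; field; by rewrite c0 aa.
Qed.

Lemma det_refl_mx a : a != 0 -> \det (refl_mx a) = -1.
Proof.
move=> a0; have aa : dot a a != 0 by rewrite dot_eq0.
rewrite /refl_mx scalemxAl det_one_sub_mul -scalemxAr mxE [X in _ * X]mxE.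
have -> : \sum_j a 0 j * a^T j 0 = dot a a by apply: eq_bigr => j _; rewrite mxE.
by rewrite divfK //; ring.
Qed.

Definition isometry O := forall u v, dot (u *m O) (v *m O) = dot u v.

Lemma isometry1 : isometry 1%:M. Proof. by move=> u v; rewrite !mulmx1. Qed.

Lemma isometryM O S : isometry O -> isometry S -> isometry (O *m S).
Proof. by move=> iO iS u v; rewrite !mulmxA iS iO. Qed.

Lemma isometry_refl a : isometry (refl_mx a).
Proof. by move=> u v; rewrite !mul_refl_mx refl_dot. Qed.

Lemma isometry_nrm O u : isometry O -> nrm (u *m O) = nrm u.
Proof. by move=> iO; rewrite /nrm iO. Qed.

Lemma isometry_eq0 O u : isometry O -> (u *m O == 0) = (u == 0).
Proof. by move=> iO; rewrite -(nrm_eq0 (u *m O)) (isometry_nrm u iO) nrm_eq0. Qed.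

Lemma isometry_unit O : isometry O -> O \in unitmx.
Proof.
move=> iO; rewrite -row_free_unit -kermx_eq0; apply/rowV0P => v /sub_kermxP vO.
by apply/eqP; rewrite -(isometry_eq0 _ iO) vO.
Qed.

Lemma isometry_inv O : isometry O -> isometry (invmx O).
Proof.
by move=> iO u v; rewrite -[LHS]iO -!mulmxA mulVmx ?isometry_unit // !mulmx1.
Qed.

Definition mx_continuous (g : R -> 'M[R]_n) := forall i j, continuous (fun t => g t i j).

Lemma mx_continuousM (g h : R -> 'M[R]_n) : mx_continuous g -> mx_continuous h ->
  mx_continuous (fun t => g t *m h t).
Proof.
move=> gc hc i j; have -> : (fun t => (g t *m h t) i j) = (fun t => \sum_k g t i k * h t k j).
  by apply/funext => t; rewrite mxE.
by apply: continuous_sumr => k; exact: continuous_mulr.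
Qed.

Lemma mx_continuous_cst O : mx_continuous (fun=> O).
Proof. by move=> i j; exact: continuous_cst. Qed.

Lemma mx_continuous_refl (a : R -> V) : continuous a -> (forall t, a t != 0) ->
  mx_continuous (fun t => refl_mx (a t)).
Proof.
move=> ac a0 i j.
have -> : (fun t => refl_mx (a t) i j) = (fun t =>
  (i == j)%:R - (2 / dot (a t) (a t)) * (a t 0 i * a t 0 j)).
  by apply/funext => t; rewrite !mxE big_ord1 !mxE.
apply: continuous_subr; first exact: continuous_cst.
apply: continuous_mulr; last by apply: continuous_mulr; exact: continuous_coord.
apply: continuous_mulr; first exact: continuous_cst.
by apply: continuous_inv => [|t]; [exact: continuous_dot | rewrite dot_eq0].
Qed.

(** Extends paths and homotopies parametrised by [0,1] to all of R. *)
Definition clamp01 (t : R) : R := Num.max 0 (Num.min 1 t).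

Lemma clamp01_itv t : 0 <= clamp01 t <= 1.
Proof. by rewrite /clamp01 le_max lexx /= ge_max ler01 ge_min lexx. Qed.

Lemma clamp01_id t : 0 <= t <= 1 -> clamp01 t = t.
Proof. by case/andP=> t0 t1; rewrite /clamp01 min_r // max_r. Qed.

Lemma clamp01_le0 t : t <= 0 -> clamp01 t = 0.
Proof. by move=> t0; rewrite /clamp01 max_l // ge_min t0 orbT. Qed.

Lemma clamp01_ge1 t : 1 <= t -> clamp01 t = 1.
Proof. by move=> t0; rewrite /clamp01 min_l // max_r. Qed.

Lemma continuous_clamp01 (T : topologicalType) (f : T -> R) : continuous f ->
  continuous (fun p : T => clamp01 (f p)).
Proof.
by move=> fc; apply: continuous_max; [|apply: continuous_min => //]; exact: continuous_cst.
Qed.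

(** The reflection exchanges the [j]-th basis vector with its image, so the product fixes that
    vector. A vector fixed by [O] has equal scalar products with both, hence is orthogonal to [a]
    and stays fixed. *)
Lemma refl_move O j : isometry O ->
  let a := row j O - row j 1%:M in
  [/\ isometry (O *m refl_mx a), row j (O *m refl_mx a) = row j 1%:M &
      forall z, z *m O = z -> dot z a = 0 /\ z *m (O *m refl_mx a) = z].
Proof.
move=> iO a; have rE : row j O = row j 1%:M *m O by rewrite -row_mul mul1mx.
split; first exact: isometryM (isometry_refl _).
  by rewrite row_mul mul_refl_mx refl_swap // rE iO.
move=> z zO; have za : dot z a = 0 by rewrite /a dotBr -{1}zO rE iO subrr.
by split=> //; rewrite mulmxA zO mul_refl_mx refl_fix.
Qed.

(** The segment from [a] or [- a] to [b], with the sign making the scalar product nonnegative,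
    avoids 0; a reflection does not depend on the sign of its axis. *)
Lemma refl_path a b : a != 0 -> b != 0 -> exists c : R -> V,
  [/\ continuous c, forall t, c t != 0, refl_mx (c 0) = refl_mx a, c 1 = b &
      forall t z, dot z a = 0 -> dot z b = 0 -> dot z (c t) = 0].
Proof.
move=> a0 b0; pose e : R := if 0 <= dot a b then 1 else -1.
have e0 : e != 0 by rewrite /e; case: ifP; rewrite ?oner_eq0 // oppr_eq0 oner_eq0.
have eab : 0 <= dot (e *: a) b.
  by rewrite dotZl /e; case: ifPn => h; rewrite ?mul1r // mulN1r oppr_ge0 ltW // ltNge.
exists (fun t => (1 - clamp01 t) *: (e *: a) + clamp01 t *: b); split.
- have cc : continuous clamp01 by apply: (continuous_clamp01 (f := id)) => p; exact: cvg_id.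
  apply: continuous_add; apply: continuous_scale => //; try exact: continuous_cst.
  by apply: continuous_subr => //; exact: continuous_cst.
- move=> t; have /andP[] := clamp01_itv t; set s := clamp01 t => s0 s1.
  rewrite -dot_gt0.
  have aa : 0 < dot (e *: a) (e *: a) by rewrite dot_gt0 scaler_eq0 negb_or e0.
  have bb : 0 < dot b b by rewrite dot_gt0.
  have -> : dot ((1 - s) *: (e *: a) + s *: b) ((1 - s) *: (e *: a) + s *: b) =
     (1 - s) ^+ 2 * dot (e *: a) (e *: a) + 2 * (s * (1 - s) * dot (e *: a) b) + s ^+ 2 * dot b b.
    by rewrite !dotE (dotC b a); ring.
  have [s12|s12] := leP s (1/2); [apply: ltr_pwDl; [apply: ltr_pwDl|] | apply: ltr_pwDr].
  + by apply: mulr_gt0 => //; apply: exprn_gt0; lra.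
  + by rewrite mulr_ge0 // !mulr_ge0 //; lra.
  + by rewrite mulr_ge0 ?sqr_ge0 // ltW.
  + by apply: mulr_gt0 => //; apply: exprn_gt0; lra.
  by rewrite addr_ge0 // ?mulr_ge0 ?sqr_ge0 // ?mulr_ge0 //; try lra; rewrite ltW.
- rewrite clamp01_le0 // subr0 scale1r scale0r addr0.
  apply/row_matrixP => i; rewrite !rowE !mul_refl_mx; exact: refl_scale.
- by rewrite clamp01_ge1 // subrr scale0r add0r scale1r.
by move=> t z za zb; rewrite !dotE za zb !mulr0 addr0.
Qed.

(** Induction on the number of basis vectors moved. Two reflections, with axes [a] and [b], reduce
    [O] to [O2], again of determinant 1. Turning the axis from [a] to [b] gives a path from the
    identity to [refl_mx b *m refl_mx a], which undoes the reduction. *)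
Lemma isometry_path O : isometry O -> \det O = 1 -> exists g : R -> 'M[R]_n,
  [/\ mx_continuous g, g 0 = 1%:M, g 1 = O, forall t, isometry (g t) &
      forall t z, z *m O = z -> z *m g t = z].
Proof.
have [k] := ubnP #|[pred j | row j O != row j 1%:M]|%N.
elim: k O => // k IHk O; rewrite ltnS => cO iO dO.
have [e|/eqP O1] := pselect (O = 1%:M).
  exists (fun=> O); split=> //; first exact: mx_continuous_cst.
have [j jO] : exists j, row j O != row j 1%:M.
  apply: contrapT => h; move/eqP: O1; apply; apply/row_matrixP => j.
  by apply/eqP; apply: contraT => hj; case: h; exists j.
have [i1 r1 f1] := refl_move j iO; set a := row j O - row j 1%:M in i1 r1 f1.
have a0 : a != 0 by rewrite subr_eq0.
set O1' := O *m refl_mx a in i1 r1 f1.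
have d1 : \det O1' = -1 by rewrite det_mulmx dO det_refl_mx // mul1r.
have [l lO] : exists l, row l O1' != row l 1%:M.
  apply: contrapT => h; have e : O1' = 1%:M.
    by apply/row_matrixP => q; apply/eqP; apply: contraT => hq; case: h; exists q.
  by move: d1; rewrite e det1; lra.
have [i2 r2 f2] := refl_move l i1; set b := row l O1' - row l 1%:M in i2 r2 f2.
have b0 : b != 0 by rewrite subr_eq0.
set O2 := O1' *m refl_mx b in i2 r2 f2.
have d2 : \det O2 = 1 by rewrite det_mulmx d1 det_refl_mx //; lra.
have rE S q : row q S = row q 1%:M *m S by rewrite -row_mul mul1mx.
have c2 : (#|[pred q | row q O2 != row q 1%:M]| < k)%N.
  apply: leq_trans cO; apply: proper_card; apply/properP; split.
    apply/fintype.subsetP => q; rewrite !inE; apply: contra => /eqP; rewrite rE => qO.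
    by have [_ h1] := f1 _ qO; have [_ h2] := f2 _ h1; rewrite rE h2.
  exists j; rewrite !inE ?jO // negbK rE.
  by rewrite rE in r1; have [_ ->] := f2 _ r1.
have [g [gc g0 g1 gi gf]] := IHk O2 c2 i2 d2.
have [c [cc cn c0 c1 cz]] := refl_path a0 b0.
exists (fun t => g t *m refl_mx (c t) *m refl_mx a); split.
- by do 2?apply: mx_continuousM => //; [exact: mx_continuous_refl | exact: mx_continuous_cst].
- by rewrite g0 c0 mul1mx refl_mxK.
- by rewrite g1 c1 /O2 -(mulmxA O1') refl_mxK mulmx1 /O1' -mulmxA refl_mxK mulmx1.
- by move=> t; apply: isometryM (isometry_refl _); apply: isometryM (isometry_refl _).
move=> t z zO; have [za h1] := f1 _ zO; have [zb h2] := f2 _ h1.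
by rewrite !mulmxA gf // !mul_refl_mx (refl_fix (cz t _ za zb)) refl_fix.
Qed.

End Reflections.

(** * Extending fields without zeros over the unit ball of W *)

Section Extension.
Variables (R : realType) (n : nat).
Notation V := 'rV[R]_n.
Implicit Types (a b u v x y z : V) (O S : 'M[R]_n).

Definition ones : V := const_mx 1.
Definition in_W u := dot u ones = 0.

Lemma in_W_add u v : in_W u -> in_W v -> in_W (u + v).
Proof. by rewrite /in_W dotDl => -> ->; rewrite addr0. Qed.

Lemma in_W_scale (c : R) u : in_W u -> in_W (c *: u).
Proof. by rewrite /in_W dotZl => ->; rewrite mulr0. Qed.

Lemma in_W_opp u : in_W u -> in_W (- u).
Proof. by rewrite /in_W dotNl => ->; rewrite oppr0. Qed.

Lemma in_W_sub u v : in_W u -> in_W v -> in_W (u - v).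
Proof. by move=> uW vW; apply: in_W_add => //; apply: in_W_opp. Qed.

Lemma in_W_sum (I : finType) (P : pred I) (F : I -> V) : (forall i, P i -> in_W (F i)) ->
  in_W (\sum_(i | P i) F i).
Proof.
by move=> h; apply: (big_ind in_W) => //; [rewrite /in_W dot0l | move=> *; apply: in_W_add].
Qed.

Lemma in_W_refl a u : in_W a -> in_W u -> in_W (refl a u).
Proof. by move=> aW uW; apply: in_W_sub => //; apply: in_W_scale. Qed.

Lemma in_W_mul O u : isometry O -> ones *m O = ones -> in_W u -> in_W (u *m O).
Proof. by move=> iO oO uW; rewrite /in_W -oO iO. Qed.

Lemma nrm_normalize v : v != 0 -> nrm ((nrm v)^-1 *: v) = 1.
Proof. by move=> v0; rewrite nrmZ ger0_norm ?invr_ge0 ?nrm_ge0 // mulVf ?nrm_eq0. Qed.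

(** Sphere and ball are those of W, but [F] is continuous on the whole space, so that no subspace
    topology enters. *)
Definition extends (f : V -> V) := exists F : V -> V,
  [/\ continuous F, forall u, in_W u -> nrm u = 1 -> F u = f u &
      forall u, in_W u -> nrm u <= 1 -> in_W (F u) /\ F u != 0].

Lemma extends_cst y : in_W y -> y != 0 -> extends (fun=> y).
Proof. by move=> yW y0; exists (fun=> y); split=> //; exact: continuous_cst. Qed.

(** The homotopy runs on the shell 1/2 <= |u| <= 1, and [G], rescaled by 2, fills the rest. On the
    shell [G - g] vanishes, inside it [H] is [g]; so the single formula [H + (G - g)] is right in
    both places and continuous. *)
Lemma extends_homotopy (H : R * V -> V) (f g : V -> V) : continuous H ->
  (forall u, in_W u -> nrm u = 1 -> H (0, u) = f u) -> (forall u, H (1, u) = g u) ->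
  (forall t u, 0 <= t <= 1 -> in_W u -> nrm u = 1 -> in_W (H (t, u)) /\ H (t, u) != 0) ->
  extends g -> extends f.
Proof.
move=> Hc H0 H1 Hn [G [Gc Gg Gn]].
pose m u := Num.max (nrm u) (1/2).
have m0 u : m u != 0 by rewrite gt_eqF // /m lt_max divr_gt0 ?orbT.
pose s u := (m u)^-1 *: u.
pose t u := clamp01 (2 - 2 * nrm u).
have mc : continuous m.
  by apply: continuous_max; [apply: continuous_nrm => x; exact: cvg_id | exact: continuous_cst].
have sc : continuous s.
  by apply: continuous_scale; [exact: continuous_inv | move=> x; exact: cvg_id].
have tc : continuous t.
  apply: continuous_clamp01; apply: continuous_subr; first exact: continuous_cst.
  by apply: continuous_mulr; [exact: continuous_cst | apply: continuous_nrm => x; exact: cvg_id].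
have gc : continuous g.
  have -> : g = (fun u => H (1, u)) by apply/funext => u.
  apply: (continuous_comp_fun Hc); apply: continuous_pair; first exact: continuous_cst.
  by move=> x; exact: cvg_id.
exists (fun u => H (t u, s u) + (G (s u) - g (s u))); split.
- apply: continuous_add; first by apply: (continuous_comp_fun Hc); exact: continuous_pair.
  by apply: continuous_sub; exact: continuous_comp_fun.
- move=> u uW u1; have -> : s u = u by rewrite /s /m u1 max_l ?invr1 ?scale1r //; lra.
  by rewrite /t u1 mulr1 subrr clamp01_le0 // Gg // subrr addr0 H0.
move=> u uW u1; have [u2|u2] := leP (1/2) (nrm u).
  have mu : m u = nrm u by rewrite /m max_l.
  have u0 : u != 0 by rewrite -nrm_gt0; lra.
  have s1 : nrm (s u) = 1 by rewrite /s mu nrm_normalize.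
  have sW : in_W (s u) by exact: in_W_scale.
  by rewrite Gg // subrr addr0; apply: Hn => //; exact: clamp01_itv.
have -> : t u = 1 by rewrite /t clamp01_ge1 //; lra.
rewrite H1 addrC subrK; apply: Gn; first exact: in_W_scale.
rewrite /s /m max_r; last exact: ltW.
by rewrite nrmZ ger0_norm ?invr_ge0; lra.
Qed.

(** The two terms can only cancel where [u *m O] is opposite to [y], that is at [u = a]; but there
    [l = 1] and the second term stands alone. *)
Lemma core_neq0 O a y (c l : R) u : isometry O -> a *m O = - y -> nrm a = 1 -> 0 < c ->
  0 <= l <= 1 -> (u = a -> l = 1) -> nrm u = 1 -> ((1 - l) * c) *: y + l *: (u *m O) != 0.
Proof.
move=> iO aO a1 c0 /andP[l0 l1] ul u1; apply/eqP => e.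
have e2 : (l *: u) *m O = (((1 - l) * c) *: a) *m O.
  by rewrite -!scalemxAl aO scalerN; apply/eqP; rewrite -addr_eq0 addrC e.
have e3 : l *: u = ((1 - l) * c) *: a.
  by apply/eqP; rewrite -subr_eq0 -(isometry_eq0 _ iO) mulmxBl e2 subrr.
have := congr1 (@nrm R n) e3; rewrite !nrmZ u1 a1 !mulr1 !ger0_norm //; last first.
  by rewrite mulr_ge0 ?subr_ge0 // ltW.
move=> lE; have l_gt0 : l != 0.
  apply/eqP => l00; move: lE; rewrite l00 subr0 mul1r => c00; by rewrite -c00 ltxx in c0.
have ua : u = a by apply: (scalerI l_gt0); rewrite e3 -lE.
by move: lE; rewrite (ul ua) subrr mul0r => /eqP; rewrite oner_eq0.
Qed.

End Extension.

(** * Great arcs and folding *)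

Section Cancellation.
Variables (R : realType) (n : nat).
Notation V := 'rV[R]_n.
Implicit Types (a b u v x y z : V) (O S : 'M[R]_n).

Definition chord a b (t : R) : V := (1 - clamp01 t) *: a + clamp01 t *: b.
Definition arc a b (t : R) : V := (nrm (chord a b t))^-1 *: chord a b t.

Section Arc.
Variables (a b : V).
Hypotheses (a1 : nrm a = 1) (b1 : nrm b = 1) (aDNb : a != - b).
Let g := dot a b.

Lemma dot_unit_gtN1 : -1 < g.
Proof.
rewrite lt_def; apply/andP; split; last first.
  by have := cauchy_schwarz a b; rewrite a1 b1 mulr1 ler_norml => /andP[].
apply: contra aDNb => /eqP gE; apply/eqP/dot_eq1; rewrite ?nrmN //.
by rewrite dotNr -/g gE opprK.
Qed.

Lemma chord_sum t : dot (chord a b t) (a + b) = 1 + g.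
Proof. by rewrite /chord !dotE (dotC b a) -/g (nrm1_dot a1) (nrm1_dot b1); ring. Qed.

Lemma chord_neq0 t : chord a b t != 0.
Proof.
apply/eqP => e; have := chord_sum t; rewrite e dot0l => /eqP.
by rewrite lt_eqF //; have := dot_unit_gtN1; lra.
Qed.

Lemma arc_unit t : nrm (arc a b t) = 1.
Proof. by rewrite nrm_normalize // chord_neq0. Qed.

Lemma arc_add_neq0 t : a + arc a b t != 0.
Proof.
apply/eqP => e; have : dot (a + arc a b t) (a + b) = 0 by rewrite e dot0l.
rewrite dotDl /arc dotZl chord_sum dotDr (nrm1_dot a1) -/g.
have h : 0 < 1 + g by have := dot_unit_gtN1; lra.
have i0 : 0 < (nrm (chord a b t))^-1 by rewrite invr_gt0 nrm_gt0 chord_neq0.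
by have := mulr_gt0 i0 h; lra.
Qed.

Lemma continuous_chord : continuous (chord a b).
Proof.
have cc : continuous (@clamp01 R) by apply: (continuous_clamp01 (f := id)) => p; exact: cvg_id.
apply: continuous_add; apply: continuous_scale => //; try exact: continuous_cst.
by apply: continuous_subr => //; exact: continuous_cst.
Qed.

Lemma continuous_arc : continuous (arc a b).
Proof.
apply: continuous_scale continuous_chord; apply: continuous_inv;
  first exact: continuous_nrm continuous_chord.
by move=> t; rewrite nrm_eq0 chord_neq0.
Qed.

Lemma arc0 : arc a b 0 = a.
Proof. by rewrite /arc /chord clamp01_le0 // subr0 scale1r scale0r addr0 a1 invr1 scale1r. Qed.

Lemma arc1 : arc a b 1 = b.
Proof. by rewrite /arc /chord clamp01_ge1 // subrr scale1r scale0r add0r b1 invr1 scale1r. Qed.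

(** Multiplied by the length N of the chord, the claim is [g * N < 1 - s + s * g]. For g >= 0 it
    follows from N <= 1. For g < 0 only a negative right-hand side is a problem, and then squares
    are compared. *)
Lemma arc_closer t : a != b -> clamp01 t < 1 -> g < dot (arc a b t) a.
Proof.
move=> ab; rewrite /arc dotZl mulrC ltr_pdivlMr ?nrm_gt0 ?chord_neq0 //.
have -> : dot (chord a b t) a = (1 - clamp01 t) + clamp01 t * g.
  by rewrite /chord !dotE (nrm1_dot a1) (dotC b) -/g; ring.
have N2 : nrm (chord a b t) ^+ 2 = (1 - clamp01 t) ^+ 2 + 2 * clamp01 t * (1 - clamp01 t) * g +
  clamp01 t ^+ 2.
  by rewrite nrm_sqr /chord !dotE (nrm1_dot a1) (nrm1_dot b1) (dotC b) -/g; ring.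
have N0 : 0 < nrm (chord a b t) by rewrite nrm_gt0 chord_neq0.
have /andP[s0 _] := clamp01_itv t.
have g1 : g < 1.
  rewrite lt_neqAle; apply/andP; split; last by have := dot_le a b; rewrite a1 b1 mulr1.
  by apply: contra ab => /eqP /(dot_eq1 a1 b1) ->.
have gN1 := dot_unit_gtN1.
move: (nrm (chord a b t)) (clamp01 t) N2 N0 s0 => N s N2 N0 s0 s1.
have sg : 0 < (1 - s) * (1 - g) by rewrite mulr_gt0 // subr_gt0.
have [g0|g0] := leP 0 g.
  have N_le1 : N <= 1.
    rewrite -(ler_pXn2r (n := 2)) ?nnegrE ?ler01 ?(ltW N0) // N2 expr1n -subr_ge0.
    have -> : 1 - ((1 - s) ^+ 2 + 2 * s * (1 - s) * g + s ^+ 2) = 2 * s * ((1 - s) * (1 - g)) by ring.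
    by apply: mulr_ge0; [apply: mulr_ge0 | exact: ltW].
  have : g * N <= g * 1 by rewrite ler_wpM2l.
  by move: sg; rewrite mulr1; lra.
have gN : g * N < 0 by rewrite nmulr_rlt0.
have [X0|X0] := leP 0 (1 - s + s * g); first by lra.
rewrite ltNge; apply/negP => XgN.
have h1 : (g * N) ^+ 2 <= (1 - s + s * g) ^+ 2.
  by rewrite -sqrrN -[leRHS]sqrrN ler_pXn2r ?nnegrE ?oppr_ge0 ?lerN2 // ltW.
have h2 : (1 - s + s * g) ^+ 2 < (s * g) ^+ 2.
  have sg0 : s * g <= 0 by rewrite mulr_ge0_le0 // ltW.
  by rewrite -sqrrN -[ltRHS]sqrrN ltr_pXn2r ?nnegrE //; lra.
have h3 : 0 < 1 - g ^+ 2.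
  have -> : 1 - g ^+ 2 = (1 - g) * (1 + g) by ring.
  by rewrite mulr_gt0 //; lra.
have : (1 - g ^+ 2) * ((1 - s + s * g) ^+ 2 - (s * g) ^+ 2) = (1 - s + s * g) ^+ 2 - (g * N) ^+ 2.
  by rewrite [(g * N) ^+ 2]exprMn N2; ring.
have : (1 - g ^+ 2) * ((1 - s + s * g) ^+ 2 - (s * g) ^+ 2) < 0 by rewrite pmulr_rlt0 // subr_lt0.
by lra.
Qed.

End Arc.

Lemma clamp01_rev (t : R) : clamp01 (1 - t) = 1 - clamp01 t.
Proof.
have [t0|t0] := leP t 0; first by rewrite (clamp01_le0 t0) clamp01_ge1 ?subr0 //; lra.
have [t1|t1] := leP 1 t; first by rewrite (clamp01_ge1 t1) clamp01_le0 ?subrr //; lra.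
by rewrite !clamp01_id //; apply/andP; split; lra.
Qed.

Lemma arc_rev a b t : arc b a (1 - t) = arc a b t.
Proof.
have e : chord b a (1 - t) = chord a b t by rewrite /chord clamp01_rev subKr addrC.
by rewrite /arc e.
Qed.

Lemma refl_add a u v : refl a (u + v) = refl a u + refl a v.
Proof. by rewrite -!mul_refl_mx mulmxDl. Qed.

Lemma reflZ a (c : R) u : refl a (c *: u) = c *: refl a u.
Proof. by rewrite -!mul_refl_mx scalemxAl. Qed.

Lemma refl_opp a u : refl a (- u) = - refl a u.
Proof. by rewrite -!mul_refl_mx mulNmx. Qed.

Lemma refl_sub a u v : refl a (u - v) = refl a u - refl a v.
Proof. by rewrite -!mul_refl_mx mulmxBl. Qed.

Lemma refl_nrm a u : nrm (refl a u) = nrm u.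
Proof. by rewrite /nrm refl_dot. Qed.

Lemma reflN a u : refl (- a) u = refl a u.
Proof. by rewrite -scaleN1r refl_scale // oppr_eq0 oner_eq0. Qed.

Lemma refl_arc a b t : nrm a = 1 -> nrm b = 1 -> refl (b - a) (arc a b t) = arc a b (1 - t).
Proof.
move=> a1 b1; have aa : dot a a = dot b b by rewrite !nrm1_dot.
have e : refl (b - a) (chord a b t) = chord a b (1 - t).
  rewrite /chord refl_add !reflZ refl_swap // -reflN opprB refl_swap // clamp01_rev subKr.
  by rewrite addrC.
by rewrite /arc reflZ e -(refl_nrm (b - a)) e.
Qed.

(** For unit vectors: the reflection exchanging [a] and [b], applied only on the side of [b], so
    that everything ends on the side of [a]. *)
Definition fold_map a b u : V := u - (2 * Num.max 0 (dot u (b - a)) / dot (b - a) (b - a)) *: (b - a).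

Lemma fold_pos a b u : 0 <= dot u (b - a) -> fold_map a b u = refl (b - a) u.
Proof. by move=> h; rewrite /fold_map max_r. Qed.

Lemma fold_neg a b u : dot u (b - a) <= 0 -> fold_map a b u = u.
Proof. by move=> h; rewrite /fold_map max_l // mulr0 mul0r scale0r subr0. Qed.

Lemma fold_nrm a b u : nrm (fold_map a b u) = nrm u.
Proof.
by case: (leP 0 (dot u (b - a))) => [/fold_pos ->|/ltW/fold_neg->]; rewrite ?refl_nrm.
Qed.

Lemma fold_dot a b u : dot (fold_map a b u) (b - a) <= 0.
Proof.
case: (leP 0 (dot u (b - a))) => [h|/ltW h]; last by rewrite fold_neg.
rewrite fold_pos // -(refl_dot (b - a)) reflK refl_self dotNr oppr_le0 //.
Qed.

Lemma continuous_fold a b : continuous (fold_map a b).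
Proof.
have ic : continuous (@id V) by move=> x; exact: cvg_id.
apply: continuous_sub => //; apply: continuous_scale; last exact: continuous_cst.
apply: continuous_mulr; last exact: continuous_cst.
apply: continuous_mulr; first exact: continuous_cst.
apply: continuous_max; first exact: continuous_cst.
by apply: continuous_dot => //; exact: continuous_cst.
Qed.

Lemma continuous_refl (T : topologicalType) (f g : T -> V) : continuous f -> continuous g ->
  (forall p, f p != 0) -> continuous (fun p => refl (f p) (g p)).
Proof.
move=> fc gc f0; apply: continuous_sub => //; apply: continuous_scale => //.
apply: continuous_mulr.
  by apply: continuous_mulr; [exact: continuous_cst | exact: continuous_dot].
by apply: continuous_inv => [|p]; [exact: continuous_dot | rewrite dot_eq0].
Qed.

End Cancellation.

(** * Extending a field of total degree zero over the ball *)

Section BubbleHeight.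
Variables (R : realType) (n : nat).
Notation V := 'rV[R]_n.

Lemma nrm0 : nrm (0 : V) = 0. Proof. by apply/eqP; rewrite nrm_eq0. Qed.

Definition bump (r : R) (v : V) : R := Num.max 0 (1 - nrm v / r).

Lemma bump_ge0 r v : 0 <= bump r v. Proof. by rewrite /bump le_max lexx. Qed.

Lemma bump_le1 r v : 0 < r -> bump r v <= 1.
Proof. by move=> r0; rewrite /bump ge_max ler01 gerBl divr_ge0 ?nrm_ge0 // ltW. Qed.

Lemma bump0 r : bump r 0 = 1.
Proof. by rewrite /bump nrm0 mul0r subr0 max_r. Qed.

Lemma bump_far r v : 0 < r -> r <= nrm v -> bump r v = 0.
Proof. by move=> r0 rv; rewrite /bump max_l // subr_le0 ler_pdivlMr // mul1r. Qed.

Lemma bump_near r v : 0 < r -> bump r v != 0 -> nrm v < r.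
Proof. by move=> r0; rewrite ltNge; apply: contra => /(bump_far r0)/eqP. Qed.

Lemma continuous_bump (T : topologicalType) r (f : T -> V) : continuous f ->
  continuous (fun t => bump r (f t)).
Proof.
move=> fc; apply: continuous_max; first exact: continuous_cst.
apply: continuous_subr; first exact: continuous_cst.
by apply: continuous_mulr; [exact: continuous_nrm | exact: continuous_cst].
Qed.

End BubbleHeight.

Section Bubbles.
Variables (R : realType) (n : nat) (Q : finType).
Notation V := 'rV[R]_n.
Notation ones := (@ones R n).
Implicit Types (u v : V) (D : {set Q}) (M : Q -> 'M[R]_n).
Variables (p : Q -> V) (y : V) (r : R).
Hypotheses (p1 : forall q, nrm (p q) = 1) (pW : forall q, in_W (p q)).
Hypotheses (y1 : nrm y = 1) (yW : in_W y) (r0 : 0 < r).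
Hypothesis p_anti : forall q q', p q != - p q'.
Hypothesis p_far : forall q q', q != q' -> 4 * r < nrm (p q - p q').
Hypothesis arc_far : forall q q' q'', q'' != q -> q'' != q' ->
  (forall t, p q'' <> arc (p q) (p q') t) -> forall t, 2 * r <= nrm (p q'' - arc (p q) (p q') t).

(** Around [p q] the field [bubbles] passes from [y] on the rim of the cap to [u *m M q], which is
    [- y] at the centre. It takes the direction of [- y] only there, so a bubble contributes
    [\det (M q)] to the degree. *)
Definition framing (M : Q -> 'M[R]_n) :=
  forall q, [/\ isometry (M q), ones *m M q = ones & p q *m M q = - y].

Definition bubbles (D : {set Q}) (M : Q -> 'M[R]_n) (u : V) : V :=
  y + \sum_(q in D) bump r (u - p q) *: (u *m M q - y).

Lemma bump_uniq u q q' : bump r (u - p q) != 0 -> bump r (u - p q') != 0 -> q = q'.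
Proof.
move=> /(bump_near r0) h /(bump_near r0) h'; apply/eqP; apply: contraT => /p_far h4; exfalso;
  have r0' := r0.
by have := nrm_triangle (p q) u (p q'); rewrite (nrmC (p q) u) => tri; lra.
Qed.

Lemma bubbles_at D M u q : q \in D -> bump r (u - p q) != 0 ->
  bubbles D M u = y + bump r (u - p q) *: (u *m M q - y).
Proof.
move=> qD h; rewrite /bubbles (bigD1 q) //= [X in _ + (_ + X)]big1 ?addr0 // => q' /andP[_ qq].
apply/eqP; rewrite scaler_eq0; apply/orP; left; apply: contraT => h'.
by rewrite (bump_uniq h h') eqxx in qq.
Qed.

Lemma bubbles_none D M u : (forall q, q \in D -> bump r (u - p q) = 0) -> bubbles D M u = y.
Proof. by move=> h; rewrite /bubbles big1 ?addr0 // => q qD; rewrite h // scale0r. Qed.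

Lemma y_neq0 : y != 0. Proof. by rewrite -nrm_gt0 y1. Qed.

Lemma bubble_shape (l : R) v : y + l *: (v - y) = ((1 - l) * 1) *: y + l *: v.
Proof. by rewrite mulr1 scalerBl scale1r scalerBr -!addrA; congr (_ + _); rewrite addrC. Qed.

Lemma bubbles_neq0 D M u : framing M -> nrm u = 1 -> bubbles D M u != 0.
Proof.
move=> fM u1; have [[q [qD h]]|nq] := pselect (exists q, q \in D /\ bump r (u - p q) != 0).
  rewrite (bubbles_at M qD h) bubble_shape; have [iM _ pM] := fM q.
  apply: (core_neq0 iM pM (p1 q)) => //; first by rewrite bump_ge0 bump_le1.
  by move=> ->; rewrite subrr bump0.
rewrite bubbles_none ?y_neq0 // => q qD; apply/eqP; apply: contraT => h.
by case: nq; exists q.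
Qed.

Lemma bubbles_W D M u : framing M -> in_W u -> in_W (bubbles D M u).
Proof.
move=> fM uW; apply: in_W_add => //; apply: in_W_sum => q _; apply: in_W_scale.
by apply: in_W_sub => //; have [iM oM _] := fM q; exact: in_W_mul.
Qed.

Lemma framing_det M q : framing M -> \det (M q) = 1 \/ \det (M q) = -1.
Proof.
move=> fM; have [iM _ _] := fM q.
have : M q *m (M q)^T = 1%:M.
  apply/matrixP => i j; rewrite mxE -[RHS]/((1%:M : 'M[R]_n) i j).
  have := iM (row i 1%:M) (row j 1%:M); rewrite -!row_mul !mul1mx => h.
  transitivity (dot (row i (M q)) (row j (M q))).
    by apply: eq_bigr => k _; rewrite !mxE.
  rewrite h /dot (bigD1 i) //= big1 ?addr0 => [|k ki]; rewrite !mxE ?eqxx ?mul1r;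
    first by rewrite eq_sym.
  by rewrite eq_sym (negPf ki) mul0r.
move/(congr1 determinant); rewrite det_mulmx det_tr det1 -expr2 => /eqP.
by rewrite sqrf_eq1 => /orP[] /eqP; [left | right].
Qed.

Definition reframe (M : Q -> 'M[R]_n) b N : Q -> 'M[R]_n := fun q => if q == b then N else M q.

(** The isometry [invmx (M b) *m N] has determinant 1 and fixes [y] and [ones]. It is joined to the
    identity by isometries with the same fixed vectors, and the framing stays valid along the
    path. *)
Lemma extends_reframe D M b N : framing M -> framing (reframe M b N) -> \det (M b) = \det N ->
  extends (bubbles D (reframe M b N)) -> extends (bubbles D M).
Proof.
move=> fM fN dN; have [iM oM pM] := fM b; have [iN oN pN] := fN b.
rewrite /reframe eqxx in iN oN pN.
pose T := invmx (M b) *m N.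
have iT : isometry T by apply: isometryM iN; exact: isometry_inv.
have uM := isometry_unit iM.
have dT : \det T = 1.
  rewrite det_mulmx -dN -det_mulmx mulVmx //; exact: det1.
have [g [gc g0 g1 gi gf]] := isometry_path iT dT.
have yT : y *m T = y.
  have e : y = - (p b *m M b) by rewrite pM opprK.
  by rewrite /T mulmxA {1}e mulNmx -(mulmxA (p b)) mulmxV // mulmx1 mulNmx pN opprK.
have oT : ones *m T = ones by rewrite /T mulmxA -{1}oM -(mulmxA ones) mulmxV // mulmx1.
have fg t : framing (reframe M b (M b *m g t)).
  move=> q; rewrite /reframe; case: eqP => [->|_]; last exact: fM.
  split; first exact: isometryM.
    by rewrite mulmxA oM gf.
  by rewrite mulmxA pM mulNmx gf.
apply: (@extends_homotopy _ _ (fun tu : R * V => bubbles D (reframe M b (M b *m g tu.1)) tu.2)).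
- have ic : continuous (fun tu : R * V => tu.2) by move=> tu; exact: cvg_snd.
  apply: continuous_add; first exact: continuous_cst.
  apply: continuous_sum => q; apply: continuous_scale.
    by apply: continuous_bump; apply: continuous_sub => //; exact: continuous_cst.
  apply: continuous_sub; last exact: continuous_cst.
  apply: continuous_mulmx => // i j; rewrite /reframe; case: eqP => _; last exact: continuous_cst.
  have h := @mx_continuousM _ _ _ _ (@mx_continuous_cst _ _ (M b)) gc i j.
  by apply: (continuous_comp_fun h) => tu; exact: cvg_fst.
- move=> u uW u1 /=; rewrite g0 mulmx1; congr (_ + _); apply: eq_bigr => q _.
  by rewrite /reframe; case: eqP => [->|].
- move=> u /=; congr (_ + _); apply: eq_bigr => q _; rewrite g1 /T mulmxA mulmxV // mul1mx.
  by [].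
by move=> t u _ uW u1 /=; split; [exact: bubbles_W | exact: bubbles_neq0].
Qed.

(** A third centre on the arc would be closer to each end than the ends are to each other, and its
    determinant differs from that of one end. This contradicts the choice of a closest pair. *)
Lemma arc_avoid a b q D M : framing M -> a \in D -> b \in D -> q \in D -> q != a -> q != b ->
  a != b -> \det (M a) != \det (M b) ->
  (forall c d, c \in D -> d \in D -> \det (M c) != \det (M d) -> dot (p c) (p d) <= dot (p a) (p b)) ->
  forall t, p q <> arc (p a) (p b) t.
Proof.
move=> fM aD bD qD qa qb ab dab mx t e; have r0' := r0.
have p_neq c d : c != d -> p c != p d.
  move=> cd; have := p_far cd; apply: contraTneq => ->; rewrite subrr -leNgt.
  by rewrite nrm0 mulr_ge0 // ltW.
have /andP[s0 s1] := clamp01_itv t.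
have t1 : clamp01 t < 1.
  rewrite lt_neqAle s1 andbT; apply: contra (p_neq _ _ qb) => /eqP h.
  apply/eqP; rewrite e -[RHS](arc1 (p a) (p1 b)).
  by rewrite /arc /chord h clamp01_ge1.
have t0 : clamp01 (1 - t) < 1.
  rewrite clamp01_rev ltrBlDr ltrDl lt_def s0 andbT; apply: contra (p_neq _ _ qa) => /eqP h.
  apply/eqP; rewrite e -[RHS](arc0 (p b) (p1 a)).
  by rewrite /arc /chord h clamp01_le0.
have ha := arc_closer (p1 a) (p1 b) (p_anti a b) (p_neq _ _ ab) t1.
have ba : b != a by rewrite eq_sym.
have hb := arc_closer (p1 b) (p1 a) (p_anti b a) (p_neq _ _ ba) t0.
rewrite arc_rev -e in hb; rewrite -e in ha.
have [da|da] := eqVneq (\det (M q)) (\det (M a)).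
  have := mx q b qD bD; rewrite da => /(_ dab); rewrite leNgt.
  by rewrite (dotC (p a)) hb.
by have := mx q a qD aD da; rewrite leNgt ha.
Qed.

(** In this framing the bubble at [b] is the mirror image of the one at [a], and both together are
    one bubble at [p a] composed with the fold. Its centre is moved along the arc to [p b], out of
    the image of the fold: the two bubbles meet at the mirror and disappear. *)
Lemma extends_cancel D M a b : framing M -> a \in D -> b \in D -> a != b ->
  (forall q t, q \in D -> q != a -> q != b -> p q <> arc (p a) (p b) t) ->
  extends (bubbles (D :\ a :\ b) M) ->
  extends (bubbles D (reframe M b (refl_mx (p b - p a) *m M a))).
Proof.
move=> fM aD bD ab avoid.
have [iMa oMa pMa] := fM a; have r0' := r0.
pose g t := arc (p a) (p b) (clamp01 t).
pose fo := fold_map (p a) (p b).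
(* A rotation taking the moving centre back to [p a]: the first reflection sends [g t] to [- p a],
   the second to [p a]. *)
pose rot (t : R) (v : V) := refl (p a) (refl (p a + g t) v).
pose nu := p b - p a.
have clid : continuous (@clamp01 R) by apply: (continuous_clamp01 (f := id)) => x; exact: cvg_id.
have gc : continuous g by apply: continuous_comp_fun clid; exact: continuous_arc.
have g1 t : nrm (g t) = 1 by exact: arc_unit.
have gW t : in_W (g t).
  by apply: in_W_scale; apply: in_W_add; apply: in_W_scale.
have ag0 t : p a + g t != 0 by exact: arc_add_neq0.
have pa0 : p a != 0 by rewrite -nrm_gt0 p1.
have rot_g t : rot t (g t) = p a.
  by rewrite /rot addrC refl_bisect ?(nrm1_dot (p1 a)) ?(nrm1_dot (g1 t)) // -scaleN1r reflZ
    refl_self scaleN1r opprK.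
have rot_nrm t v : nrm (rot t v) = nrm v by rewrite /rot !refl_nrm.
have rot_inj t v w : rot t v = rot t w -> v = w.
  by move=> h; rewrite -(reflK (p a + g t) v) -(reflK (p a) (refl _ v)) -/(rot t v) h /rot !reflK.
pose E := D :\ a :\ b.
pose H (tu : R * V) := bubbles E M tu.2 + bump r (fo tu.2 - g tu.1) *: (rot tu.1 (fo tu.2) *m M a - y).
have nu2 : 4 * r < nrm nu by apply: p_far; rewrite eq_sym.
have nu_nu : dot nu nu = 2 * dot (p b) nu.
  by rewrite /nu !dotE (nrm1_dot (p1 a)) (nrm1_dot (p1 b)) (dotC (p b)); ring.
have pa_nu : dot (p a) nu = - dot (p b) nu.
  by rewrite /nu !dotE (nrm1_dot (p1 a)) (nrm1_dot (p1 b)) (dotC (p b)); ring.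
(* The centres are more than 4r apart, so a point on the other side of the mirror is more than 2r
   away from either one. *)
have far_b v : dot v nu <= 0 -> bump r (v - p b) = 0.
  move=> h; apply: bump_far => //.
  have := cauchy_schwarz (v - p b) nu; rewrite dotBl distrC => /(le_trans (ler_norm _)) h2.
  have n0 : 0 < nrm nu by lra.
  have h3 : nrm nu * nrm nu <= 2 * nrm (v - p b) * nrm nu.
    by rewrite -expr2 nrm_sqr nu_nu; lra.
  by move: h3; rewrite ler_pM2r //; lra.
have far_a v : 0 <= dot v nu -> bump r (v - p a) = 0.
  move=> h; apply: bump_far => //.
  have := cauchy_schwarz (v - p a) nu; rewrite dotBl => /(le_trans (ler_norm _)) h2.
  have n0 : 0 < nrm nu by lra.
  have h3 : nrm nu * nrm nu <= 2 * nrm (v - p a) * nrm nu.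
    by rewrite -expr2 nrm_sqr nu_nu; lra.
  by move: h3; rewrite ler_pM2r //; lra.
have ic : continuous (fun tu : R * V => tu.2) by move=> tu; exact: cvg_snd.
have fc : continuous (fun tu : R * V => tu.1) by move=> tu; exact: cvg_fst.
apply: (@extends_homotopy _ _ H).
- apply: continuous_add.
    apply: continuous_add; first exact: continuous_cst.
    apply: continuous_sum => q; apply: continuous_scale.
      by apply: continuous_bump; apply: continuous_sub => //; exact: continuous_cst.
    apply: continuous_sub; last exact: continuous_cst.
    by apply: continuous_mulmx => // i j; exact: continuous_cst.
  have foc : continuous (fun tu : R * V => fo tu.2).
    by apply: continuous_comp_fun ic; exact: continuous_fold.
  have gcc : continuous (fun tu : R * V => g tu.1) by exact: continuous_comp_fun.
  apply: continuous_scale.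
    exact: (continuous_bump (continuous_sub foc gcc)).
  apply: continuous_sub; last exact: continuous_cst.
  apply: continuous_mulmx; last by move=> i j; exact: continuous_cst.
  have ac : continuous (fun _ : R * V => p a) by exact: continuous_cst.
  have agc := continuous_add ac gcc.
  have h1 := continuous_refl agc foc (fun tu => ag0 tu.1).
  exact: (continuous_refl ac h1 (fun=> pa0)).
- move=> u uW u1; rewrite /H /bubbles /=.
  rewrite [in RHS](bigD1 a) //= [in RHS](bigD1 b) /=; last by rewrite bD eq_sym.
  have -> : g 0 = p a by rewrite /g clamp01_le0 // arc0.
  have rot0 v : rot 0 v = v.
    rewrite /rot (_ : g 0 = p a); last by rewrite /g clamp01_le0 // arc0.
    by rewrite -mulr2n -scaler_nat refl_scale ?reflK // pnatr_eq0.
  rewrite rot0 /reframe (negPf ab) eqxx mulmxA mul_refl_mx -[LHS]addrA; congr (_ + _).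
  rewrite [LHS]addrC [RHS]addrA; congr (_ + _); last first.
    apply: eq_big => [q|q]; first by rewrite /E !inE; case: (q \in D); case: (q == a); case: (q == b).
    by rewrite /E !inE => /andP[/negPf-> _].
  have [h|h] := leP (dot u nu) 0.
    by rewrite far_b // scale0r addr0 /fo fold_neg.
  rewrite /fo fold_pos ?(ltW h) // (far_a u) ?(ltW h) // scale0r add0r.
  have -> : refl (p b - p a) u - p a = refl (p b - p a) (u - p b).
    by rewrite refl_sub refl_swap // !nrm1_dot.
  by rewrite /bump refl_nrm.
- move=> u; rewrite /H /= (_ : g 1 = p b); last by rewrite /g clamp01_ge1 // arc1.
  by rewrite far_b ?scale0r ?addr0 //; exact: fold_dot.
move=> t u _ uW u1; rewrite /H /=.
have fo1 : nrm (fo u) = 1 by rewrite /fo fold_nrm.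
have foW : in_W (fo u).
  by apply: in_W_sub => //; apply: in_W_scale; exact: in_W_sub.
have rW : in_W (rot t (fo u)).
  by apply: in_W_refl => //; apply: in_W_refl => //; exact: in_W_add.
split.
  apply: in_W_add; first exact: bubbles_W.
  by apply: in_W_scale; apply: in_W_sub => //; exact: in_W_mul.
have [h|h] := eqVneq (bump r (fo u - g t)) 0.
  by rewrite h scale0r addr0; exact: bubbles_neq0.
(* The mirror preserves the arc, so [u] itself is within r of the arc wherever the moving bubble
   acts; the remaining centres are at least 2r from the arc. *)
rewrite bubbles_none; last first.
  move=> q; rewrite /E !inE => /andP[qb /andP[qa qD]].
  have near := bump_near r0 h.
  have av := arc_far qa qb (fun t => avoid q t qD qa qb).
  have [s us] : exists s, nrm (u - arc (p a) (p b) s) < r.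
    have [h0|h0] := leP (dot u nu) 0.
      by exists (clamp01 t); move: near; rewrite /fo fold_neg.
    exists (1 - clamp01 t); move: near; rewrite /fo (fold_pos (ltW h0)).
    by rewrite -(refl_nrm nu) refl_sub reflK /g refl_arc.
  apply: bump_far => //; have := av s; have := nrm_triangle (p q) u (arc (p a) (p b) s).
  by rewrite (nrmC (p q) u) => tri; lra.
rewrite bubble_shape; apply: (core_neq0 iMa pMa (p1 a)) => //.
- by rewrite bump_ge0 bump_le1.
- by move=> e; have -> : fo u = g t; [apply: (rot_inj t); rewrite rot_g | rewrite subrr bump0].
by rewrite rot_nrm.
Qed.

(** Determinants are 1 or -1, so two of them differ. The closest pair with different determinants is
    cancelled, after the second bubble has been reframed as the mirror image of the first; a mirror
    image has the opposite determinant, as required. *)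
Theorem extends_bubbles D M : framing M -> \sum_(q in D) \det (M q) = 0 -> extends (bubbles D M).
Proof.
have [k] := ubnP #|D|; elim: k D M => // k IHk D M; rewrite ltnS => cD fM sD.
have [D0|[a0 a0D]] := set_0Vmem D.
  have -> : bubbles D M = fun=> y; last exact: extends_cst yW y_neq0.
  by apply/funext => u; rewrite bubbles_none // => q; rewrite D0 inE.
have [b0 b0D b0M] : exists2 b, b \in D & \det (M a0) != \det (M b).
  apply: contrapT => h; have dE q : q \in D -> \det (M q) = \det (M a0).
    by move=> qD; apply/eqP; apply: contraT => hq; case: h; exists q => //; rewrite eq_sym.
  move: sD; rewrite (eq_bigr (fun=> \det (M a0))) // sumr_const => /eqP.
  rewrite mulrn_eq0 cards_eq0 => /orP[/eqP D0|]; first by rewrite D0 inE in a0D.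
  by case: (framing_det a0 fM) => ->; rewrite ?oppr_eq0 oner_eq0.
pose P (c : Q * Q) := [&& c.1 \in D, c.2 \in D & \det (M c.1) != \det (M c.2)].
have P0 : P (a0, b0) by apply/and3P.
have [[a b] /and3P[/= aD bD abM] mx] := @arg_maxP _ _ _ (a0, b0) P (fun c => dot (p c.1) (p c.2)) P0.
have ab : a != b by apply: contraNneq abM => ->.
set N := refl_mx (p b - p a) *m M a.
have pba : p b - p a != 0.
  have := p_far ab; rewrite nrmC; apply: contraTneq => ->; rewrite -leNgt.
  by rewrite nrm0 mulr_ge0 // ltW.
have fN : framing (reframe M b N).
  move=> q; rewrite /reframe; case: eqP => [->|_]; last exact: fM.
  have [iMa oMa pMa] := fM a; split; first exact: isometryM (isometry_refl _) iMa.
    by rewrite mulmxA mul_refl_mx refl_fix // dotC; exact: in_W_sub.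
  by rewrite mulmxA mul_refl_mx refl_swap // !nrm1_dot.
have dab : \det (M b) = - \det (M a).
  by case: (framing_det a fM) (framing_det b fM) abM => -> [] -> //; rewrite ?eqxx // opprK.
apply: (extends_reframe fM fN); first by rewrite det_mulmx det_refl_mx // mulN1r dab.
apply: extends_cancel => //.
  move=> q t qD qa qb; apply: (arc_avoid fM aD bD qD qa qb ab abM) => c d c_D d_D cdM.
  by apply: (mx (c, d)); apply/and3P.
apply: IHk => //.
  apply: leq_trans cD; apply: proper_card; apply: (@proper_sub_trans _ _ (D :\ a)).
    by apply: properD1; rewrite !inE eq_sym ab.
  exact: subsetDl.
move: sD; rewrite (bigD1 a) //= (bigD1 b) /=; last by rewrite bD eq_sym.
rewrite dab addrA subrr add0r => sE; rewrite -[RHS]sE; apply: eq_bigl => q.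
by rewrite !inE; case: (q \in D); case: (q == a); case: (q == b).
Qed.

End Bubbles.

Section Radius.
Variables (R : realType) (n : nat) (Q : finType).
Notation V := 'rV[R]_n.
Variable p : Q -> V.
Hypotheses (p1 : forall q, nrm (p q) = 1) (p_anti : forall q q', p q != - p q').
Hypothesis p_inj : injective p.

Lemma arc_dist (a b c : V) : nrm a = 1 -> nrm b = 1 -> a != - b -> (forall t, c <> arc a b t) ->
  exists rho : R, 0 < rho /\ forall t, rho <= nrm (c - arc a b t).
Proof.
move=> a1 b1 ab cN; pose f t := nrm (c - arc a b t).
have fc : continuous f.
  by apply: continuous_nrm; apply: continuous_sub; [exact: continuous_cst | exact: continuous_arc].
have [t0 _ ht] := EVT_min (@ler01 R) (continuous_subspaceT fc).
exists (f t0); split.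
  by rewrite /f nrm_gt0 subr_eq0; apply/eqP; exact: cN.
move=> t; have -> : nrm (c - arc a b t) = f (clamp01 t).
  by rewrite /f /arc /chord (@clamp01_id _ (clamp01 t)) ?clamp01_itv.
by apply: ht; rewrite in_itv /= clamp01_itv.
Qed.

(** There are finitely many conditions, and by compactness each arc has a positive distance from a
    centre not on it. An eighth of the minimum meets all the inequalities. *)
Lemma exists_radius (bound : R) : 0 < bound -> exists r : R, [/\ 0 < r, r <= bound,
  forall q q', q != q' -> 4 * r < nrm (p q - p q') &
  forall q q' q'', q'' != q -> q'' != q' ->
    (forall t, p q'' <> arc (p q) (p q') t) -> forall t, 2 * r <= nrm (p q'' - arc (p q) (p q') t)].
Proof.
move=> bound0.
have /choice[rho hrho] (c : Q * Q * Q) : exists rho : R, 0 < rho /\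
    ((forall t, p c.2 <> arc (p c.1.1) (p c.1.2) t) ->
     forall t, rho <= nrm (p c.2 - arc (p c.1.1) (p c.1.2) t)).
  case: c => [[a b] c] /=.
  have [h|h] := pselect (forall t, p c <> arc (p a) (p b) t); last by exists 1.
  by have [rho [r0 hr]] := arc_dist (p1 a) (p1 b) (p_anti a b) h; exists rho.
pose d (c : Q * Q) := if c.1 == c.2 then 1 else nrm (p c.1 - p c.2).
have d0 c : 0 < d c.
  rewrite /d; case: ifPn => // cN; rewrite nrm_gt0 subr_eq0.
  by apply: contra cN => /eqP/p_inj ->.
pose m := Num.min bound (Num.min (\big[Num.min/1]_c rho c) (\big[Num.min/1]_c d c)).
have m0 : 0 < m.
  rewrite !lt_min bound0 /=; apply/andP; split; apply/bigmin_gtP; split=> [|c _]; try exact: ltr01.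
    by have [] := hrho c.
  exact: d0.
exists (m / 8); split.
- by rewrite divr_gt0.
- have : m <= bound by rewrite /m ge_min lexx.
  by lra.
- move=> q q' qq; have : m <= nrm (p q - p q').
    apply: (@le_trans _ _ (d (q, q'))); last by rewrite /d (negPf qq).
    apply: (@le_trans _ _ (\big[Num.min/1]_c d c)); last exact: bigmin_le.
    by rewrite /m !ge_min lexx !orbT.
  by lra.
move=> q q' q'' _ _ h t; have [_ /(_ h t)] := hrho (q, q', q'').
have : m <= rho (q, q', q'').
  apply: (@le_trans _ _ (\big[Num.min/1]_c rho c)); last exact: bigmin_le.
  by rewrite /m !ge_min lexx !orbT.
by rewrite /=; lra.
Qed.
End Radius.

(** * Spheres inserted into the identity field *)

Section Outer.
Variables (R : realType) (n : nat).
Notation V := 'rV[R]_n.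
Notation ones := (@ones R n).
Implicit Types (u v b a : V) (M : 'M[R]_n).

(** Equal to 1 within r of [a] and to 0 beyond 2r, since [bump (2 * r)] is 1/2 at distance r. *)
Definition collar (r : R) a v : R := Num.min 1 (2 * bump (2 * r) (v - a)).

(* Close to [a], the background [b] is replaced first by the constant [a], then by [v *m M]. *)
Definition insertion (r : R) a M b v : V :=
  collar r a v *: (a - b) + bump r (v - a) *: (v *m M - a).

Lemma collar_ge0 r a v : 0 <= collar r a v.
Proof. by rewrite /collar le_min ler01 mulr_ge0 // bump_ge0. Qed.

Lemma collar_le1 r a v : collar r a v <= 1.
Proof. by rewrite /collar ge_min lexx. Qed.

Lemma collar_near r a v : 0 < r -> collar r a v != 0 -> nrm (v - a) < 2 * r.
Proof.
move=> r0 h; have r2 : 0 < 2 * r by rewrite mulr_gt0.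
apply: (bump_near r2); apply: contra h => /eqP e.
by rewrite /collar e mulr0 min_r.
Qed.

Lemma collar1 r a v : 0 < r -> bump r (v - a) != 0 -> collar r a v = 1.
Proof.
move=> r0 /(bump_near r0) h; have r2 : 0 < 2 * r by rewrite mulr_gt0.
have h2 : nrm (v - a) / (2 * r) <= 1 / 2 by rewrite ler_pdivrMr //; lra.
have : 1 / 2 <= bump (2 * r) (v - a) by rewrite /bump le_max; apply/orP; right; lra.
by rewrite /collar => h3; rewrite min_l //; lra.
Qed.

Lemma continuous_collar (T : topologicalType) r a (f : T -> V) : continuous f ->
  continuous (fun t => collar r a (f t)).
Proof.
move=> fc; apply: continuous_min; first exact: continuous_cst.
apply: continuous_mulr; first exact: continuous_cst.
by apply: continuous_bump; apply: continuous_sub => //; exact: continuous_cst.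
Qed.

Lemma insertion_far r a M b v : 0 < r -> 2 * r <= nrm (v - a) -> insertion r a M b v = 0.
Proof.
move=> r0 h; rewrite /insertion bump_far //; last by lra.
by rewrite /collar bump_far ?mulr_gt0 // mulr0 min_r // !scale0r addr0.
Qed.

End Outer.

Lemma big_option (A : nmodType) (Q : finType) (F : option Q -> A) :
  \sum_o F o = F None + \sum_q F (Some q).
Proof.
rewrite (bigD1 None) //=; congr (_ + _).
rewrite (reindex_omap Some id) => [|[]//] /=.
by apply: eq_bigl => q; rewrite eqxx.
Qed.

Lemma big_set_option (A : nmodType) (Q : finType) (F : option Q -> A) :
  \sum_(o in finset.setT) F o = F None + \sum_q F (Some q).
Proof. by rewrite -big_option; apply: eq_bigl => o; rewrite inE. Qed.

Section OuterExtends.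
Variables (R : realType) (n : nat) (Q : finType).
Notation V := 'rV[R]_n.
Notation ones := (@ones R n).
Variables (p : Q -> V) (M : Q -> 'M[R]_n) (y : V).
Hypotheses (p1 : forall q, nrm (p q) = 1) (pW : forall q, in_W (p q)) (p_inj : injective p).
Hypothesis p_anti : forall q q', p q != - p q'.
Hypotheses (y1 : nrm y = 1) (yW : in_W y).
Hypotheses (y_p : forall q, y != p q) (y_Np : forall q, y != - p q).
Hypothesis M_ok : forall q, [/\ isometry (M q), ones *m M q = ones & p q *m M q = - p q].
Hypothesis M_det : 1 + \sum_q \det (M q) = 0.

Definition outer (r : R) (u : V) : V := u + \sum_q insertion r (p q) (M q) u u.

(** The extra centre [- y] represents the background: the identity field deforms to the constant [y]
    with one bubble there, framed by the identity matrix. *)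
Let p' (o : option Q) : V := if o is Some q then p q else - y.

Let p'1 o : nrm (p' o) = 1. Proof. by case: o => [q|] //=; rewrite nrmN. Qed.

Let neqN (v : V) : v = - v -> nrm v = 1 -> False.
Proof.
move=> e v1; have : dot v v = - dot v v by rewrite {1}e dotNl.
by rewrite (nrm1_dot v1); lra.
Qed.

Let p'_anti o o' : p' o != - p' o'.
Proof.
case: o => [q|]; case: o' => [q'|] /=; rewrite ?opprK.
- exact: p_anti.
- by rewrite eq_sym.
- by rewrite eqr_opp.
by apply/eqP => e; exact: (neqN (esym e) y1).
Qed.

Let p'_inj : injective p'.
Proof.
move=> [q|] [q'|] //=; first by move/p_inj ->.
  by move=> e; have := y_Np q; rewrite e opprK eqxx.
by move=> e; have := y_Np q'; rewrite -e opprK eqxx.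
Qed.

(** The background is deformed from [u] to [y] outside a cap around [- y], while the constant around
    each insertion moves from [p q] to [y] along the chord. Each isometry is followed by two
    reflections, which keep its determinant and send [- p q] opposite to the current constant. What
    results is a family of bubbles of total determinant 0. *)
Theorem outer_extends (bound : R) : 0 < bound -> exists r : R, [/\ 0 < r, r <= bound,
  forall q q', q != q' -> 4 * r < nrm (p q - p q') & extends (outer r)].
Proof.
move=> b0; have [r [r0 rb far avoid]] := exists_radius p'1 p'_anti p'_inj b0.
exists r; split=> // [q q' qq|]; first exact: (far (Some q) (Some q')).
pose M' (o : option Q) := if o is Some q then M q *m (refl_mx (p q) *m refl_mx (p q + y)) else 1%:M.
have fM : @framing R n _ p' y M'.
  case=> [q|] /=; last by split; [exact: isometry1 | rewrite mulmx1 | rewrite mulmx1].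
  have [iM oM pM] := M_ok q; split.
  - by apply: isometryM => //; apply: isometryM; exact: isometry_refl.
  - have o_fix v : in_W v -> refl v ones = ones by move=> vW; rewrite refl_fix // dotC.
    by rewrite !mulmxA oM !mul_refl_mx !o_fix //; exact: in_W_add.
  by rewrite !mulmxA pM !mulNmx !mul_refl_mx refl_self refl_opp opprK refl_bisect // (nrm1_dot (p1
    q)) (nrm1_dot y1).
have eB : extends (bubbles p' y r finset.setT M').
  have p'W o : in_W (p' o) by case: o => [q|] //=; exact: in_W_opp.
  apply: (extends_bubbles p'1 p'W y1 yW r0 p'_anti far avoid fM).
  rewrite -[RHS]M_det big_set_option /= det1; congr (_ + _); apply: eq_bigr => q _.
  rewrite !det_mulmx !det_refl_mx ?mulrNN ?mulr1 //.
    by rewrite addr_eq0 -eqr_oppLR eq_sym.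
  by rewrite -nrm_gt0 p1.
pose mu u := 1 - bump r (u + y).
pose bg (t : R) u := (1 - clamp01 t * mu u) *: u + (clamp01 t * mu u) *: y.
pose c q t := chord (p q) y t.
(* The axis bisects [p q] and [c q t]. At t = 0 it is [2 *: p q] and the two reflections cancel; at
   t = 1 it is [p q + y], as in [M']. *)
pose w q t := nrm (c q t) *: p q + c q t.
pose H (tu : R * V) := bg tu.1 tu.2 + \sum_q
  (collar r (p q) tu.2 *: (c q tu.1 - bg tu.1 tu.2) +
   bump r (tu.2 - p q) *: (refl (w q tu.1) (refl (p q) (tu.2 *m M q)) - c q tu.1)).
have pNy q : p q != - y by rewrite -eqr_oppLR eq_sym.
have c_sum q t : dot (c q t) (p q + y) = 1 + dot (p q) y by exact: chord_sum.
have g_gt q : 0 < 1 + dot (p q) y by have := dot_unit_gtN1 (p1 q) y1 (pNy q); lra.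
have c_neq0 q t : c q t != 0 by exact: chord_neq0.
have w_neq0 q t : w q t != 0.
  apply/eqP => e; have := dot0l (p q + y); rewrite -e /w dotDl dotZl c_sum dotDr (nrm1_dot (p1 q)).
  have := mulr_ge0 (nrm_ge0 (c q t)) (ltW (g_gt q)); have := g_gt q; lra.
have ic : continuous (fun tu : R * V => tu.2) by move=> tu; exact: cvg_snd.
have fc : continuous (fun tu : R * V => tu.1) by move=> tu; exact: cvg_fst.
have muc : continuous (fun tu : R * V => clamp01 tu.1 * mu tu.2).
  apply: continuous_mulr; first exact: continuous_clamp01.
  apply: continuous_subr; first exact: continuous_cst.
  by apply: continuous_bump; apply: continuous_add => //; exact: continuous_cst.
have bgc : continuous (fun tu : R * V => bg tu.1 tu.2).
  apply: continuous_add; apply: continuous_scale => //; last exact: continuous_cst.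
  by apply: continuous_subr => //; exact: continuous_cst.
have cc q : continuous (fun tu : R * V => c q tu.1).
  by apply: (continuous_comp_fun (@continuous_chord _ _ (p q) y)).
have wc q : continuous (fun tu : R * V => w q tu.1).
  apply: continuous_add => //; apply: continuous_scale; [exact: continuous_nrm | exact: continuous_cst].
apply: (extends_homotopy (H := H) _ _ _ _ eB).
- apply: (continuous_add bgc); apply: continuous_sum => q.
  have k1 : continuous (fun tu : R * V => collar r (p q) tu.2) by exact: continuous_collar ic.
  have h0 := continuous_scale k1 (continuous_sub (cc q) bgc).
  have k2 : continuous (fun tu : R * V => bump r (tu.2 - p q)).
    have pc : continuous (fun _ : R * V => p q) by exact: continuous_cst.
    exact: (continuous_bump (continuous_sub ic pc)).
  apply: (continuous_add h0); apply: (continuous_scale k2).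
  have h1 : continuous (fun tu : R * V => tu.2 *m M q).
    by apply: continuous_mulmx => // i j; exact: continuous_cst.
  have h2 : continuous (fun tu : R * V => refl (p q) (tu.2 *m M q)).
    apply: continuous_refl => //; first exact: continuous_cst.
    by move=> _; rewrite -nrm_gt0 p1.
  have h3 := continuous_refl (wc q) h2 (fun tu => w_neq0 q tu.1).
  exact: (continuous_sub h3 (cc q)).
- move=> u uW u1; rewrite /H /= /bg clamp01_le0 // !mul0r subr0 scale1r scale0r addr0.
  congr (_ + _); apply: eq_bigr => q _.
  have -> : c q 0 = p q by rewrite /c /chord clamp01_le0 // subr0 scale1r scale0r addr0.
  have -> : w q 0 = 2 *: p q.
    by rewrite /w /c /chord clamp01_le0 // subr0 scale1r scale0r addr0 p1 scale1r scaler_nat mulr2n.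
  by rewrite refl_scale ?pnatr_eq0 // reflK.
- move=> u; rewrite /H /= /bg clamp01_ge1 // !mul1r /bubbles big_set_option /=.
  rewrite mulmx1 opprK addrA; congr (_ + _).
    rewrite /mu subKr scalerBl scale1r scalerBr [LHS]addrC -!addrA; congr (_ + _).
    by rewrite addrC.
  apply: eq_bigr => q _.
  have -> : c q 1 = y by rewrite /c /chord clamp01_ge1 // subrr scale1r scale0r add0r.
  have -> : w q 1 = p q + y.
    by rewrite /w /c /chord clamp01_ge1 // subrr scale1r scale0r add0r y1 scale1r.
  rewrite !mulmxA !mul_refl_mx; set S := (X in X + _ = _); suff -> : S = 0 by rewrite add0r.
  rewrite /S; have [cq|cq] := eqVneq (collar r (p q) u) 0; first by rewrite cq scale0r.
  rewrite /mu bump_far ?subr0 ?scale1r ?subrr ?scale0r ?add0r ?subrr ?scaler0 //.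
  have := far (Some q) None isT; have := collar_near r0 cq; have := nrm_triangle (p q) u (- y).
  by rewrite /= opprK (nrmC (p q) u); lra.
move=> t u _ uW u1; rewrite /H /=.
have bgW : in_W (bg t u) by apply: in_W_add; exact: in_W_scale.
have cW q : in_W (c q t) by apply: in_W_add; exact: in_W_scale.
have wW q : in_W (w q t) by apply: in_W_add => //; exact: in_W_scale.
split.
  apply: in_W_add => //; apply: in_W_sum => q _; apply: in_W_add; apply: in_W_scale;
    first exact: in_W_sub.
  apply: in_W_sub => //; apply: in_W_refl => //; apply: in_W_refl => //.
  by have [iM oM _] := M_ok q; exact: in_W_mul.
have /andP[s0 s1] := clamp01_itv t.
have [[q hq]|nq] := pselect (exists q, collar r (p q) u != 0); last first.
  rewrite big1 ?addr0; last first.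
    move=> q _; have cq : collar r (p q) u = 0 by apply/eqP; apply: contraT => h; case: nq; exists q.
    rewrite cq scale0r add0r; have [->|bq] := eqVneq (bump r (u - p q)) 0; first by rewrite scale0r.
    by move: cq; rewrite (collar1 r0 bq) => /eqP; rewrite oner_eq0.
  have -> : bg t u = ((1 - (1 - clamp01 t * mu u)) * 1) *: y + (1 - clamp01 t * mu u) *: (u *m 1%:M).
    by rewrite mulmx1 mulr1 subKr /bg addrC.
  apply: (@core_neq0 R n 1%:M (- y)) => //; rewrite ?mulmx1 ?nrmN //; first exact: isometry1.
    have mu0 : 0 <= mu u by rewrite subr_ge0 bump_le1.
    have mu1 : mu u <= 1 by rewrite gerBl bump_ge0.
    rewrite subr_ge0 gerBl mulr_ge0 // andbT -[leRHS]mulr1; exact: ler_pM.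
  by move=> ->; rewrite /mu addNr bump0 subrr mulr0 subr0.
have near_q := collar_near r0 hq.
rewrite (bigD1 q) //= [X in _ + (_ + X)]big1 ?addr0; last first.
  move=> q' qq; have f : 2 * r <= nrm (u - p q').
    have := far (Some q') (Some q) qq; have := nrm_triangle (p q') u (p q);
      rewrite /= (nrmC (p q') u); lra.
  have cq : collar r (p q') u = 0.
    by apply/eqP; apply: contraT => h; have := collar_near r0 h; rewrite ltNge f.
  rewrite cq scale0r add0r; have [->|bq] := eqVneq (bump r (u - p q')) 0; first by rewrite scale0r.
  by move: cq; rewrite (collar1 r0 bq) => /eqP; rewrite oner_eq0.
have farq := far (Some q) None isT; rewrite /= opprK in farq.
have mu1 : mu u = 1.
  rewrite /mu bump_far ?subr0 //; have := nrm_triangle (p q) u (- y).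
  by rewrite opprK (nrmC (p q) u); lra.
have bgE : bg t u = (1 - clamp01 t) *: u + clamp01 t *: y by rewrite /bg mu1 mulr1.
have gq := g_gt q; have py := nrm_sqr (p q + y).
rewrite !dotE (nrm1_dot (p1 q)) (nrm1_dot y1) (dotC y) in py.
(* On the collar the field is a convex combination of [bg t u] and [c q t], and both have a positive
   scalar product with [p q + y]: [u] is within 2r of [p q], and 4r is less than the length of
   [p q + y]. *)
have [b0'|bq] := eqVneq (bump r (u - p q)) 0.
  rewrite b0' scale0r addr0; apply/eqP => e.
  have : dot (bg t u + collar r (p q) u *: (c q t - bg t u)) (p q + y) = 0 by rewrite e dot0l.
  have -> : dot (bg t u + collar r (p q) u *: (c q t - bg t u)) (p q + y) =
     (1 - collar r (p q) u) * dot (bg t u) (p q + y) + collar r (p q) u * (1 + dot (p q) y).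
    by rewrite dotDl dotZl dotBl c_sum; ring.
  have bg_gt : 0 < dot (bg t u) (p q + y).
    have u_gt : 0 < dot u (p q + y).
      have := cauchy_schwarz (u - p q) (p q + y); rewrite ler_norml => /andP[+ _].
      rewrite dotBl [dot (p q) (p q + y)]dotDr (nrm1_dot (p1 q)) => h.
      have : nrm (u - p q) * nrm (p q + y) <= 2 * r * nrm (p q + y) by rewrite ler_wpM2r ?nrm_ge0 // ltW.
      have : 4 * r * nrm (p q + y) < nrm (p q + y) * nrm (p q + y) by rewrite ltr_pM2r //; lra.
      by rewrite -expr2; lra.
    have y_gt : 0 < dot y (p q + y) by rewrite dotDr (nrm1_dot y1) dotC addrC.
    rewrite bgE dotDl !dotZl; have [s12|s12] := leP (clamp01 t) (1/2).
      by apply: ltr_pwDl; [apply: mulr_gt0 => //; lra | apply: mulr_ge0 => //; exact: ltW].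
    by apply: ltr_pwDr; [apply: mulr_gt0 => //; lra | apply: mulr_ge0; [lra | exact: ltW]].
  have k0 := collar_ge0 r (p q) u; have k1 := collar_le1 r (p q) u.
  have [k12|k12] := leP (collar r (p q) u) (1/2).
    have : 0 < (1 - collar r (p q) u) * dot (bg t u) (p q + y) by apply: mulr_gt0 => //; lra.
    by have := mulr_ge0 k0 (ltW gq); lra.
  have : 0 < collar r (p q) u * (1 + dot (p q) y) by apply: mulr_gt0 => //; lra.
  have : 0 <= (1 - collar r (p q) u) * dot (bg t u) (p q + y) by apply: mulr_ge0; [lra | exact: ltW].
  by lra.
rewrite (collar1 r0 bq) scale1r addrA addrC; have ->
  : bg t u + (c q t - bg t u) = c q t by rewrite addrC subrK.
have [iM oM pM] := M_ok q.
pose N := M q *m (refl_mx (p q) *m refl_mx (w q t)).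
have iN : isometry N by apply: isometryM => //; apply: isometryM; exact: isometry_refl.
pose yc := (nrm (c q t))^-1 *: c q t.
have cn : 0 < nrm (c q t) by rewrite nrm_gt0.
have pN : p q *m N = - yc.
  rewrite /N !mulmxA pM !mulNmx !mul_refl_mx refl_self refl_opp opprK.
  have -> : w q t = nrm (c q t) *: (p q + yc) by rewrite /w /yc scalerDr scalerA mulfV ?gt_eqF //
    scale1r.
  rewrite refl_scale ?gt_eqF // refl_bisect // (nrm1_dot (p1 q)) (nrm1_dot (nrm_normalize (c_neq0 q t))).
  by [].
have := @core_neq0 R n N (p q) yc (nrm (c q t)) (bump r (u - p q)) u iN pN (p1 q) cn.
rewrite bump_ge0 bump_le1 //= => /(_ isT) h.
have -> : refl (w q t) (refl (p q) (u *m M q)) = u *m N by rewrite /N !mulmxA !mul_refl_mx.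
set l := bump r (u - p q); have l1 : u = p q -> l = 1 by move=> e; rewrite /l e subrr bump0.
have -> : l *: (u *m N - c q t) + c q t = ((1 - l) * nrm (c q t)) *: yc + l *: (u *m N).
  rewrite /yc scalerA -mulrA mulfV ?gt_eqF // mulr1 scalerBl scale1r scalerBr.
  by rewrite addrC addrA addrAC.
exact: h.
Qed.
End OuterExtends.

(** * Equivariant fields in the plane *)

Section ColPerm.
Variables (R : realType) (n : nat).
Notation V := 'rV[R]_n.
Implicit Types (u v : V) (s : 'S_n).

Lemma coord_nrm u j : `|u 0 j| <= nrm u.
Proof.
rewrite -(ler_pXn2r (n := 2)) ?nnegrE ?nrm_ge0 // nrm_sqr real_normK ?num_real //.
rewrite /dot (bigD1 j) //= -expr2 lerDl; apply: sumr_ge0 => k _; rewrite -expr2; exact: sqr_ge0.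
Qed.

Lemma col_perm_mulV s u : col_perm s^-1%g u = u *m perm_mx s.
Proof. by rewrite col_permE invgK. Qed.

Lemma perm_mxKV s : perm_mx s *m perm_mx s^-1%g = 1%:M :> 'M[R]_n.
Proof. by rewrite -perm_mxM mulgV perm_mx1. Qed.

Lemma dot_col_perm s u v : dot (col_perm s u) (col_perm s v) = dot u v.
Proof.
rewrite /dot [RHS](reindex_inj (@perm_inj _ s)) /=.
by apply: eq_bigr => j _; rewrite !mxE.
Qed.

Lemma isometry_perm s : isometry (perm_mx s : 'M[R]_n).
Proof. by move=> u v; rewrite -!col_perm_mulV dot_col_perm. Qed.

Lemma nrm_col_perm s u : nrm (col_perm s u) = nrm u.
Proof. by rewrite /nrm dot_col_perm. Qed.

Lemma ones_col_perm s : col_perm s (ones R n) = ones R n.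
Proof. by apply/rowP => j; rewrite !mxE. Qed.

Lemma in_W_col_perm s u : in_W u -> in_W (col_perm s u).
Proof. by move=> uW; rewrite /in_W -(ones_col_perm s) dot_col_perm. Qed.

Lemma col_permA s s' u : col_perm s' (col_perm s u) = col_perm (s' * s)%g u.
Proof. by apply/rowP => j; rewrite !mxE permM. Qed.

Lemma col_permK s u : col_perm s^-1%g (col_perm s u) = u.
Proof. by rewrite col_permA mulVg; apply/rowP => j; rewrite mxE perm1. Qed.

Lemma col_permKV s u : col_perm s (col_perm s^-1%g u) = u.
Proof. by rewrite col_permA mulgV; apply/rowP => j; rewrite mxE perm1. Qed.

Lemma col_permD s u v : col_perm s (u + v) = col_perm s u + col_perm s v.
Proof. by rewrite !col_permE mulmxDl. Qed.

Lemma col_perm_sub s u v : col_perm s (u - v) = col_perm s u - col_perm s v.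
Proof. by rewrite !col_permE mulmxBl. Qed.

Lemma col_permZ s (c : R) u : col_perm s (c *: u) = c *: col_perm s u.
Proof. by rewrite !col_permE scalemxAl. Qed.

Lemma col_perm0 s : col_perm s (0 : V) = 0.
Proof. by rewrite col_permE mul0mx. Qed.

Lemma col_perm_sum s (I : finType) (P : pred I) (F : I -> V) :
  col_perm s (\sum_(i | P i) F i) = \sum_(i | P i) col_perm s (F i).
Proof. by rewrite col_permE mulmx_suml; apply: eq_bigr => i _; rewrite col_permE. Qed.

Lemma continuous_col_perm (T : topologicalType) s (f : T -> V) : continuous f ->
  continuous (fun t => col_perm s (f t)).
Proof.
move=> fc; have -> : (fun t => col_perm s (f t)) = (fun t => f t *m perm_mx s^-1%g).
  by apply/funext => t; rewrite col_permE.
by apply: continuous_mulmx => // i j; exact: continuous_cst.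
Qed.

Lemma insertion_col_perm r s (a : V) (M : 'M[R]_n) b v :
  col_perm s^-1%g (insertion r a M (col_perm s b) (col_perm s v)) =
  insertion r (col_perm s^-1%g a) (perm_mx s^-1%g *m M *m perm_mx s) b v.
Proof.
have e : nrm (col_perm s v - a) = nrm (v - col_perm s^-1%g a).
  by rewrite -(nrm_col_perm s^-1%g) col_perm_sub col_permK.
have eb r' : bump r' (col_perm s v - a) = bump r' (v - col_perm s^-1%g a) by rewrite /bump e.
rewrite /insertion /collar !eb col_permD !col_permZ !col_perm_sub col_permK; congr (_ + _ *: (_ - _)).
by rewrite col_perm_mulV !mulmxA col_permE.
Qed.

Lemma insertion_in_W r (a : V) (M : 'M[R]_n) b v : isometry M -> ones R n *m M = ones R n ->
  in_W a -> in_W b -> in_W v -> in_W (insertion r a M b v).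
Proof.
move=> iM oM aW bW vW; apply: in_W_add; apply: in_W_scale; apply: in_W_sub => //.
exact: in_W_mul.
Qed.

Lemma insertion_near r (a : V) (M : 'M[R]_n) b v : 0 < r -> insertion r a M b v != 0 ->
  nrm (v - a) < 2 * r.
Proof. by move=> r0; rewrite ltNge; apply: contra => /(insertion_far M b r0) ->. Qed.

Lemma continuous_insertion (T : topologicalType) r (a : V) (M : 'M[R]_n) (b v : T -> V) :
  continuous b -> continuous v -> continuous (fun t => insertion r a M (b t) (v t)).
Proof.
move=> bc vc; have ac : continuous (fun _ : T => a) by exact: continuous_cst.
have h1 : continuous (fun t => collar r a (v t)) by exact: continuous_collar.
have h2 := continuous_scale h1 (continuous_sub ac bc).
have h3 := continuous_bump (r := r) (continuous_sub vc ac).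
have h4 : continuous (fun t => v t *m M) by apply: continuous_mulmx => // i j; exact: continuous_cst.
exact: (continuous_add h2 (continuous_scale h3 (continuous_sub h4 ac))).
Qed.
End ColPerm.

(** * Two clusters at an arbitrary distance *)

Section TwoClusters.
Variables (R : realType) (n i : nat).
Notation V := 'rV[R]_n.
Hypothesis i_n : (0 < i < n)%N.
Implicit Types (u v : V).

Definition right_sum u : R := \sum_(j : 'I_n | (i <= j)%N) u 0 j.

(** The direction in W that moves the two clusters apart rigidly, normalised to have [right_sum]
    1. *)
Definition spread : V := \row_j if (j < i)%N then - (i%:R)^-1 else (n - i)%:R^-1.

(* The two clusters of [u] are moved towards each other until [right_sum] is at most [n]; on the
   unit ball nothing happens. *)
Definition pull u : V := u - Num.max 0 (right_sum u - n%:R) *: spread.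

(** The radial projection of [pull u] to the sphere when |u| >= 1; the bound 1/2 only prevents a
    division by 0. *)
Definition shape u : V := (Num.max (nrm (pull u)) (1/2))^-1 *: pull u.

Let i0 : (0 : R) < i%:R. Proof. by rewrite ltr0n; case/andP: i_n. Qed.
Let ni0 : (0 : R) < (n - i)%:R. Proof. by rewrite ltr0n subn_gt0; case/andP: i_n. Qed.

Lemma card_right : #|[pred j : 'I_n | (i <= j)%N]| = (n - i)%N.
Proof.
have le_in : (i <= n)%N by case/andP: i_n => _ /ltnW.
have := cardsC (segment n i); rewrite card_ord card_segment // => h.
have -> : (n - i)%N = #|~: segment n i| by lia.
apply: eq_card => j; rewrite finset.in_setC.
by rewrite !inE -leqNgt.
Qed.

Lemma sum_right_cst (c : R) : \sum_(j : 'I_n | (i <= j)%N) c = c * (n - i)%:R.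
Proof. by rewrite mulr_natr -card_right -sumr_const. Qed.

Lemma right_sum_spread : right_sum spread = 1.
Proof.
rewrite /right_sum (eq_bigr (fun=> (n - i)%:R^-1)).
  by rewrite sum_right_cst mulVf // gt_eqF.
by move=> j ij; rewrite mxE ltnNge ij.
Qed.

Lemma spread_W : in_W spread.
Proof.
rewrite /in_W /dot (bigID (fun j : 'I_n => (i <= j)%N)) /=.
rewrite (eq_bigr (fun j => spread 0 j)) => [|j _]; last by rewrite !mxE mulr1.
rewrite -/(right_sum spread) right_sum_spread.
rewrite (eq_bigr (fun=> - i%:R^-1)) => [|j ij]; last by rewrite !mxE mulr1 ltnNge ij.
rewrite sumr_const (_ : #|_| = i); last first.
  have le_in : (i <= n)%N by case/andP: i_n => _ /ltnW.
  by rewrite -[RHS](card_segment le_in); apply: eq_card => j; rewrite !inE ltnNge.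
by rewrite -[(- _) *+ _]mulr_natr mulNr mulVf ?gt_eqF // subrr.
Qed.

Lemma right_sumB u v : right_sum (u - v) = right_sum u - right_sum v.
Proof. by rewrite /right_sum -sumrB; apply: eq_bigr => j _; rewrite !mxE. Qed.

Lemma right_sumZ c u : right_sum (c *: u) = c * right_sum u.
Proof. by rewrite /right_sum mulr_sumr; apply: eq_bigr => j _; rewrite !mxE. Qed.

Lemma right_sum_le u : right_sum u <= n%:R * nrm u.
Proof.
apply: (@le_trans _ _ (\sum_(j : 'I_n | (i <= j)%N) nrm u)).
  by apply: ler_sum => j _; apply: le_trans (coord_nrm u j); exact: ler_norm.
rewrite sum_right_cst mulrC ler_wpM2r ?nrm_ge0 // ler_nat; exact: leq_subr.
Qed.

Lemma pull_ball u : nrm u <= 1 -> pull u = u.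
Proof.
move=> u1; rewrite /pull max_l ?scale0r ?subr0 // subr_le0.
apply: (le_trans (right_sum_le u)); rewrite -[leRHS]mulr1 ler_wpM2l //.
Qed.

Lemma shape_sphere u : nrm u = 1 -> shape u = u.
Proof. by move=> u1; rewrite /shape pull_ball ?u1 // max_l ?invr1 ?scale1r //; lra. Qed.

Let n_gt0 : (0 : R) < n%:R.
Proof. by rewrite ltr0n; case/andP: i_n => _; case: (n). Qed.

Lemma right_sum_pull u : right_sum (pull u) <= n%:R.
Proof.
rewrite right_sumB right_sumZ right_sum_spread mulr1.
by case: (leP 0 (right_sum u - n%:R)) => h; rewrite ?max_r ?max_l //; lra.
Qed.

(** Where the pull acts, it leaves a right sum of exactly n, and a right sum is at most n times the
    norm. *)
Lemma nrm_pull u : 1 <= nrm u -> 1 <= nrm (pull u).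
Proof.
move=> u1; have [h|h] := leP (right_sum u - n%:R) 0.
  by rewrite /pull max_l // scale0r subr0.
have := right_sum_le (pull u); rewrite {1}/pull max_r ?(ltW h) //.
rewrite right_sumB right_sumZ right_sum_spread mulr1 subKr.
by rewrite -{1}[n%:R]mulr1 ler_pM2l.
Qed.

Lemma nrm_shape u : 1 <= nrm u -> nrm (shape u) = 1.
Proof.
move=> /nrm_pull h; rewrite /shape max_l; last by lra.
by rewrite nrm_normalize // -nrm_gt0; lra.
Qed.

Lemma scale_gt0 u : 0 < Num.max (nrm (pull u)) (1/2).
Proof. by rewrite lt_max divr_gt0 // orbT. Qed.

Lemma pullE u : pull u = Num.max (nrm (pull u)) (1/2) *: shape u.
Proof. by rewrite /shape scalerA mulfV ?scale1r // gt_eqF // scale_gt0. Qed.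

Lemma coordE u j : u 0 j =
  Num.max (nrm (pull u)) (1/2) * shape u 0 j + Num.max 0 (right_sum u - n%:R) * spread 0 j.
Proof.
have -> : u = pull u + Num.max 0 (right_sum u - n%:R) *: spread by rewrite /pull subrK.
rewrite [LHS]mxE {1}pullE; congr (_ + _); first by rewrite mxE /pull subrK.
by rewrite mxE /pull subrK.
Qed.

Let jump_ge0 u : 0 <= Num.max 0 (right_sum u - n%:R). Proof. by rewrite le_max lexx. Qed.

Lemma shape_neg u (j : 'I_n) : (j < i)%N -> shape u 0 j < 0 -> u 0 j < 0.
Proof.
move=> ji h; rewrite coordE (_ : spread 0 j = - i%:R^-1) ?mulrN; last by rewrite mxE ji.
have h1 : Num.max (nrm (pull u)) (1/2) * shape u 0 j < 0 by rewrite pmulr_rlt0 ?scale_gt0.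
have : 0 <= Num.max 0 (right_sum u - n%:R) * (i%:R)^-1 by rewrite mulr_ge0 // invr_ge0 ltW.
by lra.
Qed.

Lemma shape_pos u (j : 'I_n) : (i <= j)%N -> 0 < shape u 0 j -> 0 < u 0 j.
Proof.
move=> ij h; rewrite coordE (_ : spread 0 j = (n - i)%:R^-1); last by rewrite mxE ltnNge ij.
have h1 : 0 < Num.max (nrm (pull u)) (1/2) * shape u 0 j by rewrite mulr_gt0 ?scale_gt0.
have : 0 <= Num.max 0 (right_sum u - n%:R) * ((n - i)%:R)^-1 by rewrite mulr_ge0 // invr_ge0 ltW.
by lra.
Qed.

Lemma shape_nrm_le u : nrm (shape u) <= 1.
Proof.
rewrite /shape nrmZ ger0_norm ?invr_ge0 ?(ltW (scale_gt0 u)) //.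
rewrite -(ler_pM2l (scale_gt0 u)) mulr1 mulVKf ?gt_eqF ?scale_gt0 //.
by rewrite le_max lexx.
Qed.

(** The right sum after the pull is at most n, while a right coordinate of the shape is at least
    [d], so the scaling factor is at most n/d. The pull itself does not change differences inside a
    cluster. *)
Lemma shape_tight u (d : R) (a b : 'I_n) : 0 < d -> d <= 1 -> (forall j : 'I_n, (i <= j)%N ->
  d <= shape u 0 j) ->
  same_side i a b -> `|u 0 a - u 0 b| <= 2 * n%:R / d.
Proof.
move=> d0 d1 hd ab; rewrite (coordE u a) (coordE u b).
have -> : spread 0 a = spread 0 b by rewrite !mxE (eqP ab).
set c := Num.max (nrm (pull u)) _; set m := Num.max 0 _ * _.
have -> : c * shape u 0 a + m - (c * shape u 0 b + m) = c * (shape u 0 a - shape u 0 b) by ring.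
have c0 : 0 < c by exact: scale_gt0.
have cn : c * d <= n%:R.
  have := right_sum_pull u; rewrite pullE right_sumZ -/c; apply: le_trans.
  rewrite ler_pM2l //; have i_last : (i <= n.-1)%N by move: i_n; lia.
  have last_n : (n.-1 < n)%N by move: i_n; lia.
  rewrite /right_sum (bigD1 (Ordinal last_n)) //=; apply: ler_wpDr; last exact: hd.
  by apply: sumr_ge0 => j /andP[ij _]; apply: le_trans (hd j ij); exact: ltW.
rewrite normrM (ger0_norm (ltW c0)) ler_pdivlMr //.
have h : `|shape u 0 a - shape u 0 b| <= 2.
  have := coord_nrm (shape u) a; have := coord_nrm (shape u) b; have := shape_nrm_le u.
  by have := ler_normB (shape u 0 a) (shape u 0 b); lra.
have : c * d * `|shape u 0 a - shape u 0 b| <= n%:R * 2.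
  by apply: ler_pM => //; rewrite mulr_ge0 // ltW.
by rewrite [2 * _]mulrC mulrAC.
Qed.

Lemma in_W_pull u : in_W u -> in_W (pull u).
Proof. by move=> uW; apply: in_W_sub => //; apply: in_W_scale; exact: spread_W. Qed.

Lemma in_W_shape u : in_W u -> in_W (shape u).
Proof. by move=> uW; apply: in_W_scale; exact: in_W_pull. Qed.

Lemma continuous_pull : continuous pull.
Proof.
have ic : continuous (@id V) by move=> x; exact: cvg_id.
apply: continuous_sub => //; apply: continuous_scale; last exact: continuous_cst.
apply: continuous_max; first exact: continuous_cst.
apply: continuous_subr; last exact: continuous_cst.
by apply: continuous_sumr => j; exact: continuous_coord.
Qed.

Lemma continuous_shape : continuous shape.
Proof.
apply: (continuous_scale _ continuous_pull); apply: continuous_inv => [|u];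
  last by rewrite gt_eqF ?scale_gt0.
by apply: continuous_max; [exact: continuous_nrm continuous_pull | exact: continuous_cst].
Qed.
End TwoClusters.

(** * Tubes and their shuffles *)

Section LocalFields.
Variables (R : realType) (n : nat) (Q : finType).
Notation V := 'rV[R]_n.
Notation ones := (@ones R n).
Variables (side : Q -> nat) (p : Q -> V) (M : Q -> 'M[R]_n).
Hypothesis n3 : (2 < n)%N.
Hypothesis side_n : forall q, (0 < side q < n)%N.
Hypotheses (p1 : forall q, nrm (p q) = 1) (pW : forall q, in_W (p q)) (p_inj : injective p).
Hypothesis p_neg : forall q (j : 'I_n), (j < side q)%N -> p q 0 j < 0.
Hypothesis p_pos : forall q (j : 'I_n), (side q <= j)%N -> 0 < p q 0 j.
Hypothesis p_skew : forall q, exists j, forall l, - p q 0 l < p q 0 j.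
Hypothesis M_ok : forall q, [/\ isometry (M q), ones *m M q = ones & p q *m M q = - p q].
Hypothesis M_det : 1 + \sum_q ('C(n, side q))%:R * \det (M q) = 0.
Implicit Types (u v : V) (s : 'S_n).

(** Applying the insertion to the shape continues it outside the unit ball. The two clusters may
    move apart without limit, but each keeps a bounded diameter, which later allows its points to be
    told apart by the second coordinate. *)
Definition tube (r : R) q u : V := insertion r (p q) (M q) u (shape (side q) u).

Definition tube_field (r : R) u : V :=
  u + \sum_q \sum_(s | shuffle (side q) s) col_perm s^-1%g (tube r q (col_perm s u)).

Let cfg := {x in [pred x : Q * 'S_n | shuffle (side x.1) x.2]}.
Let P (x : cfg) : V := col_perm (val x).2^-1%g (p (val x).1).
Let N (x : cfg) : 'M[R]_n := perm_mx (val x).2^-1%g *m M (val x).1 *m perm_mx (val x).2.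

Let P1 x : nrm (P x) = 1. Proof. by rewrite nrm_col_perm. Qed.
Let PW x : in_W (P x). Proof. exact: in_W_col_perm. Qed.

Let P_skew x : exists j, forall l, - P x 0 l < P x 0 j.
Proof.
have [j hj] := p_skew (val x).1; exists ((val x).2 j) => l.
by rewrite !mxE permK.
Qed.

(** The largest entry of a centre exceeds the absolute value of every negative entry; the opposite
    vector cannot have this property as well. *)
Let P_anti x x' : P x != - P x'.
Proof.
apply/eqP => e; have [j hj] := P_skew x; have [j' hj'] := P_skew x'.
have h : P x 0 j < P x' 0 j' by have := hj' j; rewrite e [in X in _ -> X]mxE.
by have := lt_trans (hj j') h; rewrite e [X in - X]mxE opprK ltxx.
Qed.

Let P_neq0 x j : P x 0 j != 0.
Proof.
rewrite mxE; have [h|h] := ltnP ((val x).2^-1%g j) (side (val x).1).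
  by rewrite lt_eqF // p_neg.
by rewrite gt_eqF // p_pos.
Qed.

Lemma neg_coords q s (v : V) : (forall j : 'I_n, (j < side q)%N -> v 0 (s j) < 0) ->
  (forall j : 'I_n, (side q <= j)%N -> 0 < v 0 (s j)) ->
  s @: segment n (side q) = [set j | v 0 j < 0]%SET.
Proof.
move=> hn hp; apply/setP => j; rewrite !inE -{1}(permKV s j) mem_imset; last exact: perm_inj.
rewrite inE; have [h|h] := ltnP (s^-1%g j) (side q); first by rewrite -(permKV s j) hn // permKV.
by apply/esym/negbTE; rewrite -leNgt ltW // -(permKV s j) hp.
Qed.

(** The negative coordinates are the image of the left cluster: their number is the side, and a
    shuffle is determined by the image of the initial segment. *)
Lemma side_inj q q' s s' (v : V) : shuffle (side q) s -> shuffle (side q') s' ->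
  s @: segment n (side q) = [set j | v 0 j < 0]%SET ->
  s' @: segment n (side q') = [set j | v 0 j < 0]%SET -> side q = side q' /\ s = s'.
Proof.
move=> hs hs' e e'; have ee := etrans e (esym e').
have [/andP[_ /ltnW l] /andP[_ /ltnW l']] := (side_n q, side_n q').
have sE : side q = side q'.
  have := congr1 (fun A : {set 'I_n} => #|A|) ee.
  by rewrite !card_imset ?card_segment //; exact: perm_inj.
split=> //; rewrite -sE in hs' ee; exact: (shuffle_inj hs hs' ee).
Qed.

Let P_inj : injective P.
Proof.
case=> [[q s] hs] [[q' s'] hs'] /= e; apply: val_inj; rewrite /= /P /= in e *.
have h1 : s @: segment n (side q) = [set j | col_perm s^-1%g (p q) 0 j < 0]%SET.
  by apply: neg_coords => j hj; rewrite mxE permK ?p_neg ?p_pos.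
have h2 : s' @: segment n (side q') = [set j | col_perm s^-1%g (p q) 0 j < 0]%SET.
  by rewrite e; apply: neg_coords => j hj; rewrite mxE permK ?p_neg ?p_pos.
rewrite !inE /= in hs hs'; have [_ ss] := side_inj hs hs' h1 h2; rewrite -ss in e *.
by congr (_, _); apply: p_inj; rewrite -(col_permKV s (p q)) e col_permKV.
Qed.

Let N_ok x : [/\ isometry (N x), ones *m N x = ones & P x *m N x = - P x].
Proof.
have [iM oM pM] := M_ok (val x).1; split.
- by apply: isometryM; [apply: isometryM => // |]; exact: isometry_perm.
- have oP s : ones *m perm_mx s = ones by rewrite -col_perm_mulV ones_col_perm.
  by rewrite !mulmxA oP oM oP.
by rewrite /P /N col_perm_mulV !mulmxA -(mulmxA (p _)) perm_mxKV mulmx1 pM mulNmx.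
Qed.

Let N_det : 1 + \sum_x \det (N x) = 0.
Proof.
rewrite -[RHS]M_det; congr (_ + _).
transitivity (\sum_(x : cfg) (\det (M (val x).1))).
  apply: eq_bigr => x _; rewrite /N !det_mulmx mulrC mulrA -det_mulmx perm_mxKV det1 mul1r.
  by [].
rewrite -(big_sub [pred x : Q * 'S_n | shuffle (side x.1) x.2] (fun x => \det (M x.1))).
rewrite (eq_bigl (fun x : Q * 'S_n => predT x.1 && shuffle (side x.1) x.2)) //.
rewrite -(pair_big_dep predT (fun q s => shuffle (side q) s) (fun q s => \det (M q))) /=.
apply: eq_bigr => q _; rewrite sumr_const mulr_natl; congr (_ *+ _).
have /andP[_ /ltnW l] := side_n q; rewrite -(card_shuffle l); apply: eq_card => s.
by rewrite !inE.
Qed.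

Lemma tube_sphere r u : nrm u = 1 -> tube_field r u = outer P N r u.
Proof.
move=> u1; congr (_ + _).
rewrite (pair_big_dep predT (fun q s => shuffle (side q) s)
  (fun q s => col_perm s^-1%g (tube r q (col_perm s u)))) /=.
rewrite (eq_bigl (mem [pred x : Q * 'S_n | shuffle (side x.1) x.2])) // big_sub.
apply: eq_bigr => x _; rewrite /tube shape_sphere ?nrm_col_perm //.
by rewrite insertion_col_perm.
Qed.

Lemma exists_margin : exists d : R, [/\ 0 < d, d <= 1 & forall q j, d <= `|p q 0 j|].
Proof.
pose F (c : Q * 'I_n) := `|p c.1 0 c.2|; exists (\big[Num.min/1]_c F c); split.
- apply/bigmin_gtP; split=> [|[q j] _]; first exact: ltr01.
  rewrite /F /= normr_gt0; have [h|h] := ltnP j (side q); first by rewrite lt_eqF // p_neg.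
  by rewrite gt_eqF // p_pos.
- exact: bigmin_le_id.
by move=> q j; rewrite -[X in _ <= X]/(F (q, j)); exact: bigmin_le.
Qed.

Section Radius.
Variables (d r : R).
Hypotheses (d0 : 0 < d) (d1 : d <= 1) (dp : forall q j, d <= `|p q 0 j|) (r0 : 0 < r) (rd : r <= d / 4).
Hypothesis P_far : forall x x', x != x' -> 4 * r < nrm (P x - P x').

Let near q v := nrm (shape (side q) v - p q) < 2 * r.

Let near_coord q v j : near q v -> `|shape (side q) v 0 j - p q 0 j| < d / 2.
Proof.
move=> h; have := coord_nrm (shape (side q) v - p q) j; rewrite !mxE => h2.
by apply: (le_lt_trans h2); apply: (lt_le_trans h); have := rd; lra.
Qed.

Let near_right q v (j : 'I_n) : near q v -> (side q <= j)%N -> d / 2 <= shape (side q) v 0 j.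
Proof.
move=> h hj; have := near_coord j h; have := dp q j; rewrite (ger0_norm (ltW (p_pos hj))) ltr_norml.
by move=> h1 /andP[h2 _]; lra.
Qed.

Let near_left q v (j : 'I_n) : near q v -> (j < side q)%N -> shape (side q) v 0 j < 0.
Proof.
move=> h hj; have := near_coord j h; have := dp q j; rewrite (ltr0_norm (p_neg hj)) ltr_norml.
by move=> h1 /andP[_ h2]; have := d0; lra.
Qed.

Let near_neg q s u : near q (col_perm s u) -> s @: segment n (side q) = [set j | u 0 j < 0]%SET.
Proof.
move=> h; apply: neg_coords => j hj.
  by have := shape_neg hj (near_left h hj); rewrite mxE.
have : 0 < shape (side q) (col_perm s u) 0 j.
  by apply: lt_le_trans (near_right h hj); rewrite divr_gt0.
by move/(shape_pos hj); rewrite mxE.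
Qed.

(** Near a tube the coordinates have the signs of its centre, so overlapping tubes agree in side and
    shuffle; the distance between the centres then excludes different [q]. *)
Let near_uniq q s q' s' u : shuffle (side q) s -> shuffle (side q') s' ->
  near q (col_perm s u) -> near q' (col_perm s' u) -> q = q' /\ s = s'.
Proof.
move=> hs hs' h h'; have [sE ss] := side_inj hs hs' (near_neg h) (near_neg h').
split=> //; apply/eqP; apply: contraT => qq.
have hx : (q, s) \in [pred x : Q * 'S_n | shuffle (side x.1) x.2] by rewrite inE.
have hx' : (q', s) \in [pred x : Q * 'S_n | shuffle (side x.1) x.2] by rewrite inE /= ss.
have : 4 * r < nrm (p q - p q').
  pose x1 : cfg := exist _ (q, s) hx; pose x2 : cfg := exist _ (q', s) hx'.
  have := @P_far x1 x2; rewrite /P /= -col_perm_sub nrm_col_perm; apply.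
  by apply: contra qq => /eqP/(congr1 val) /= [->].
rewrite -ss /near -sE in h'.
have := nrm_triangle (p q) (shape (side q) (col_perm s u)) (p q').
by rewrite (nrmC (p q) (shape _ _)); move: h h'; rewrite /near; lra.
Qed.

Lemma tube_near q v : tube r q v != 0 -> near q v. Proof. exact: insertion_near. Qed.

Lemma tube_tight q v a b : tube r q v != 0 -> same_side (side q) a b ->
  `|v 0 a - v 0 b| <= 4 * n%:R / d.
Proof.
move=> /tube_near h ab.
have h1 : d / 2 <= 1 by have := d1; lra.
have h2 : 0 < d / 2 by rewrite divr_gt0.
have := shape_tight (side_n q) h2 h1 (fun j => near_right h) ab.
have -> : 4 * n%:R / d = 2 * n%:R / (d / 2) by field; rewrite gt_eqF.
by [].
Qed.

(** In the core the field has the form of a bubble, as the shape has norm 1. On the collar it is a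
    convex combination of [u] and [p q], which are both negative at coordinate 0. *)
Lemma tube_core q u : 1 <= nrm u -> near q u -> u + tube r q u != 0.
Proof.
move=> u1 h; rewrite /tube /insertion; set v := shape _ _ in h *.
have v1 : nrm v = 1 by exact: nrm_shape.
have [e|e] := eqVneq (bump r (v - p q)) 0; last first.
  rewrite (collar1 r0 e) scale1r addrA [u + _]addrC subrK.
  have [iM _ pM] := M_ok q.
  rewrite bubble_shape; apply: (core_neq0 iM pM (p1 q)) => //.
    by rewrite bump_ge0 bump_le1.
  by move=> ->; rewrite subrr bump0.
rewrite e scale0r addr0; pose j0 : 'I_n := Ordinal (ltn_trans (ltn0Sn 1) n3).
have j0q : (j0 < side q)%N by have /andP[] := side_n q.
apply/eqP => /(congr1 (fun w : V => w 0 j0)); rewrite !mxE => E.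
have un := shape_neg j0q (near_left h j0q); have pn := p_neg j0q.
have k0 := collar_ge0 r (p q) v; have k1 := collar_le1 r (p q) v.
have : (1 - collar r (p q) v) * u 0 j0 + collar r (p q) v * p q 0 j0 = 0 by rewrite -E; ring.
have [k12|k12] := leP (collar r (p q) v) (1/2).
  have : (1 - collar r (p q) v) * u 0 j0 < 0 by rewrite pmulr_rlt0 //; lra.
  have : collar r (p q) v * p q 0 j0 <= 0 by rewrite mulr_ge0_le0 // ltW.
  by lra.
have : (1 - collar r (p q) v) * u 0 j0 <= 0 by rewrite mulr_ge0_le0 //; [lra | exact: ltW].
have : collar r (p q) v * p q 0 j0 < 0 by rewrite pmulr_rlt0 //; lra.
by lra.
Qed.

Lemma tube_field_neq0 u : 1 <= nrm u -> tube_field r u != 0.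
Proof.
move=> u1.
have [[[q s] /= [hs hq]]|h] := pselect (exists x : Q * 'S_n,
  shuffle (side x.1) x.2 /\ near x.1 (col_perm x.2 u)).
  have z q' s' : shuffle (side q') s' -> (q', s') != (q, s) ->
      col_perm s'^-1%g (tube r q' (col_perm s' u)) = 0.
    move=> hs' ne; have [->|/tube_near nq] := eqVneq (tube r q' (col_perm s' u)) 0;
      first exact: col_perm0.
    by have [e1 e2] := near_uniq hs' hs nq hq; rewrite e1 e2 eqxx in ne.
  rewrite /tube_field (bigD1 q) //= (bigD1 s) //= [X in _ + (_ + X + _)]big1 ?addr0; last first.
    by move=> s' /andP[hs' ne]; apply: z => //; apply: contra ne => /eqP[->].
  rewrite [X in _ + (_ + X)]big1 ?addr0; last first.
    by move=> q' qq; apply: big1 => s' hs'; apply: z => //; apply: contra qq => /eqP[->].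
  have : col_perm s u + tube r q (col_perm s u) != 0 by apply: tube_core; rewrite ?nrm_col_perm.
  apply: contra => /eqP/(congr1 (col_perm s)); rewrite col_permD col_permKV col_perm0 => ->.
  by [].
rewrite /tube_field big1 ?addr0; first by rewrite -nrm_gt0; lra.
move=> q _; apply: big1 => s hs.
have [->|/tube_near nq] := eqVneq (tube r q (col_perm s u)) 0; first exact: col_perm0.
by case: h; exists (q, s).
Qed.
End Radius.

Lemma continuous_tube r q : continuous (tube r q).
Proof.
apply: continuous_insertion; first by move=> x; exact: cvg_id.
exact: continuous_shape.
Qed.

Lemma continuous_tube_field r : continuous (tube_field r).
Proof.
apply: continuous_add; first by move=> x; exact: cvg_id.
apply: continuous_sum => q; apply: continuous_sum => s; apply: continuous_col_perm.
apply: (continuous_comp_fun (@continuous_tube r q)); apply: continuous_col_perm.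
by move=> x; exact: cvg_id.
Qed.

Lemma in_W_tube r q u : in_W u -> in_W (tube r q u).
Proof.
move=> uW; have [iM oM _] := M_ok q; apply: insertion_in_W => //.
exact: (in_W_shape (side_n q)).
Qed.

Lemma in_W_tube_field r u : in_W u -> in_W (tube_field r u).
Proof.
move=> uW; apply: in_W_add => //; apply: in_W_sum => q _; apply: in_W_sum => s _.
by apply: in_W_col_perm; apply: in_W_tube; exact: in_W_col_perm.
Qed.

(** The centres have no zero coordinate, so a unit vector of W vanishing at one coordinate is
    neither a centre nor opposite to one. *)
Let exists_y : exists y : V, [/\ nrm y = 1, in_W y, forall x, y != P x & forall x, y != - P x].
Proof.
pose j0 : 'I_n := Ordinal (ltn_trans (ltn0Sn 1) n3).
pose j1 : 'I_n := Ordinal (ltn_trans (ltnSn 1) n3).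
pose j2 : 'I_n := Ordinal n3.
pose w : V := delta_mx 0 j0 - delta_mx 0 j1.
have w0 : w != 0 by apply/eqP => /rowP/(_ j0) /eqP; rewrite !mxE eqxx subr0 oner_eq0.
have w2 : w 0 j2 = 0 by rewrite !mxE subrr.
have d_ones j : dot (delta_mx 0 j) ones = 1 :> R.
  rewrite /dot (bigD1 j) //= big1 ?addr0 => [|k kj]; first by rewrite !mxE !eqxx mulr1.
  by rewrite !mxE (negPf kj) andbF mul0r.
have neq x (c : R) : c != 0 -> (nrm w)^-1 *: w != c *: P x.
  move=> c0; apply/eqP => /rowP/(_ j2) /eqP; rewrite mxE w2 mulr0 mxE eq_sym mulf_eq0 (negPf c0).
  by rewrite (negPf (P_neq0 x j2)).
exists ((nrm w)^-1 *: w); split.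
- exact: nrm_normalize.
- by apply: in_W_scale; rewrite /in_W dotBl !d_ones subrr.
- by move=> x; rewrite -[P x]scale1r; apply: neq; exact: oner_neq0.
by move=> x; rewrite -scaleN1r; apply: neq; rewrite oppr_eq0 oner_neq0.
Qed.

(** The correction in the unit ball gets side 0: all points form one cluster and the identity is the
    only shuffle. *)
Definition side_of (o : option Q) : nat := if o is Some q then side q else 0%N.

(** [B None] replaces the tube field inside the unit ball by its extension without zeros; it
    vanishes outside because the two agree on the sphere. It need not be symmetric, since all points
    are close together where it acts. *)
Theorem local_fields : exists (B : option Q -> V -> V) (c : R),
  [/\ 0 < c, forall o, continuous (B o), forall o u, in_W u -> in_W (B o u),
      forall o u a b, in_W u -> B o u != 0 -> same_side (side_of o) a b -> `|u 0 a - u 0 b| < c &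
      forall u, in_W u ->
        u + \sum_o \sum_(s | shuffle (side_of o) s) col_perm s^-1%g (B o (col_perm s u)) != 0].
Proof.
have [d [d0 d1 dp]] := exists_margin.
have [y [y1 yW y_P y_NP]] := exists_y.
have d4 : 0 < d / 4 by rewrite divr_gt0.
have [r [r0 rd P_far [F [Fc Fs Fn]]]] := outer_extends P1 PW P_inj P_anti y1 yW y_P y_NP N_ok N_det d4.
pose cap (u : V) : V := (Num.max (nrm u) 1)^-1 *: u.
have m0 (u : V) : 0 < Num.max (nrm u) 1 by rewrite lt_max ltr01 orbT.
have cap_ball u : nrm u <= 1 -> cap u = u by move=> u1; rewrite /cap max_r // invr1 scale1r.
have cap_out u : 1 <= nrm u -> nrm (cap u) = 1.
  by move=> u1; rewrite /cap max_l // nrm_normalize // -nrm_gt0; lra.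
pose B o u := if o is Some q then tube r q u else F (cap u) - tube_field r (cap u).
have capW u : in_W u -> in_W (cap u) by exact: in_W_scale.
have cap_le1 u : nrm (cap u) <= 1.
  by have [h|/ltW h] := leP (nrm u) 1; [rewrite cap_ball | rewrite cap_out].
have capc : continuous cap.
  have ic : continuous (@id V) by move=> x; exact: cvg_id.
  apply: continuous_scale => //; apply: continuous_inv => [|u]; last by rewrite gt_eqF.
  by apply: continuous_max; [exact: continuous_nrm | exact: continuous_cst].
have B_out u : in_W u -> 1 <= nrm u -> B None u = 0.
  by move=> uW u1; rewrite /B Fs ?cap_out // -?tube_sphere ?cap_out ?subrr //; exact: capW.
(* The first summand bounds the clusters of a tube; in the open unit ball any two coordinates differ
   by less than 2. *)
exists B, (4 * n%:R / d + 3); split.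
- by have : 0 <= 4 * n%:R / d; [rewrite divr_ge0 // ltW | lra].
- case=> [q|]; first exact: continuous_tube.
  by apply: continuous_sub; apply: continuous_comp_fun capc => //; exact: continuous_tube_field.
- case=> [q|] u uW; first exact: in_W_tube.
  by apply: in_W_sub; [apply: (Fn _ _ _).1 => //; exact: capW | apply: in_W_tube_field; exact: capW].
- have c0 : 0 <= 4 * n%:R / d by rewrite divr_ge0 // ltW.
  case=> [q|] u a b uW; first by move=> h /(tube_tight d0 d1 dp r0 rd h); lra.
  move=> h _; have u1 : nrm u < 1 by rewrite ltNge; apply: contra h => /(B_out u uW) ->.
  have := ler_normB (u 0 a) (u 0 b); have := coord_nrm u a; have := coord_nrm u b.
  by lra.
move=> u uW; rewrite big_option /= (bigD1 1%g) /=; last by apply/shuffleP => a b ab _; rewrite !perm1.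
rewrite [X in _ + (_ + X + _)]big1 ?addr0; last first.
  move=> s /andP[hs s1]; exfalso; move/negP: s1; apply; apply/eqP.
  exact: side_increasing_id hs _.
have e1 v : col_perm 1%g v = v :> V by apply/rowP => j; rewrite mxE perm1.
rewrite invg1 !e1 [F _ - _ + _]addrC addrA -/(tube_field r u).
have [h|/ltW h] := leP (nrm u) 1.
  rewrite cap_ball // addrC subrK; exact: (Fn _ uW h).2.
by rewrite -[X in _ + X]/(B None u) B_out // addr0; exact: (tube_field_neq0 d0 dp r0 rd P_far).
Qed.
End LocalFields.

(** * Separation, sorting and centring *)

Section Separation.
Variables (R : realType) (n : nat).
Notation V := 'rV[R]_n.
Implicit Types (u t v : V) (s : 'S_n).

Definition gap u t (a b : 'I_n) : R := Num.max `|u 0 a - u 0 b| `|t 0 a - t 0 b|.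

Definition separation u t : R :=
  \big[Num.min/1]_(c : 'I_n * 'I_n | c.1 != c.2) gap u t c.1 c.2.

Definition planar_conf u t := forall a b : 'I_n, a != b -> u 0 a != u 0 b \/ t 0 a != t 0 b.

Lemma gap_ge0 u t a b : 0 <= gap u t a b. Proof. by rewrite le_max normr_ge0. Qed.

Lemma separation_le1 u t : separation u t <= 1. Proof. exact: bigmin_le_id. Qed.

Lemma separation_le u t a b : a != b -> separation u t <= gap u t a b.
Proof. by move=> ab; exact: (@bigmin_le_cond _ _ _ 1 (a, b) (fun c => c.1 != c.2) (fun c =>
  gap u t c.1 c.2)). Qed.

Lemma separation_ge u t (d : R) : d <= 1 -> (forall a b, a != b -> d <= gap u t a b) ->
  d <= separation u t.
Proof. by move=> d1 h; apply/bigmin_geP; split=> // -[a b] /= /h. Qed.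

Lemma separation_ge0 u t : 0 <= separation u t.
Proof. by apply: separation_ge => // a b _; exact: gap_ge0. Qed.

Lemma separation_gt0 u t : planar_conf u t -> 0 < separation u t.
Proof.
move=> h; apply/bigmin_gtP; split; first exact: ltr01.
by case=> a b /= /h [] ab; rewrite lt_max !normr_gt0 !subr_eq0 ab ?orbT.
Qed.

Lemma separation_col_perm s u t : separation (col_perm s u) (col_perm s t) = separation u t.
Proof.
have le s' u' t' : separation u' t' <= separation (col_perm s' u') (col_perm s' t').
  apply: separation_ge => [|a b ab]; first exact: separation_le1.
  rewrite /gap !mxE; apply: separation_le; rewrite (inj_eq (@perm_inj _ s')).
  exact: ab.
apply/eqP; rewrite eq_le le andbT.
by have := le s^-1%g (col_perm s u) (col_perm s t); rewrite !col_permK.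
Qed.

Lemma continuous_separation (T : topologicalType) (f g : T -> V) : continuous f -> continuous g ->
  continuous (fun x => separation (f x) (g x)).
Proof.
have cn (h : T -> R) : continuous h -> continuous (fun x => `|h x|).
  by move=> hc x; apply: cvg_norm; exact: hc.
move=> fc gc; apply: continuous_big => [a b|[a b]] /=; first exact: continuous_min.
have c1 := cn _ (continuous_subr (continuous_coord (j := a) fc) (continuous_coord (j := b) fc)).
have c2 := cn _ (continuous_subr (continuous_coord (j := a) gc) (continuous_coord (j := b) gc)).
exact: (continuous_max c1 c2).
Qed.

Lemma exists_sort t : exists s : 'S_n, forall a b : 'I_n, (a <= b)%N -> t 0 (s a) <= t 0 (s b).
Proof.
pose T := [tuple t 0 i | i < n].
have /tuple_permP[s hs] : perm_eq (sort_tuple <=%R T) T by rewrite /= perm_sort.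
exists s => a b ab.
have e (i : 'I_n) : t 0 (s i) = nth 0 (sort <=%R T) i.
  by rewrite -[sort _ _]/(tval (sort_tuple <=%R T)) hs -tnth_nth !tnth_mktuple.
rewrite !e; apply: (sorted_leq_nth le_trans le_refl) => //.
- exact: sort_le_sorted.
- by rewrite inE size_sort size_tuple.
- by rewrite inE size_sort size_tuple.
Qed.
End Separation.

Section Center.
Variables (R : realType) (n : nat).
Notation V := 'rV[R]_n.
Hypothesis n0 : (0 < n)%N.

Definition center (u : V) : V := u - (dot u (ones R n) / n%:R) *: ones R n.

Lemma in_W_center u : in_W (center u).
Proof.
have o : dot (ones R n) (ones R n) = n%:R.
  rewrite /dot (eq_bigr (fun=> 1)) => [|j _]; last by rewrite !mxE mulr1.
  by rewrite sumr_const card_ord.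
by rewrite /in_W dotBl dotZl o divfK ?subrr // pnatr_eq0 -lt0n.
Qed.

Lemma center_col_perm s u : center (col_perm s u) = col_perm s (center u).
Proof.
rewrite /center col_perm_sub col_permZ ones_col_perm; congr (_ - (_ / _) *: _).
by rewrite -{1}(ones_col_perm _ s) dot_col_perm.
Qed.

Lemma center_diff u a b : center u 0 a - center u 0 b = u 0 a - u 0 b.
Proof. by rewrite !mxE; ring. Qed.

Lemma continuous_center (T : topologicalType) (f : T -> V) : continuous f -> continuous (fun x =>
  center (f x)).
Proof.
move=> fc; have oc : continuous (fun _ : T => ones R n) by exact: continuous_cst.
have nc : continuous (fun _ : T => (n%:R : R)^-1) by exact: continuous_cst.
exact: (continuous_sub fc (continuous_scale (continuous_mulr (continuous_dot fc oc) nc) oc)).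
Qed.
End Center.

Section PlaneField.
Variables (R : realType) (n : nat) (O : finType) (side : O -> nat).
Notation V := 'rV[R]_n.
Hypothesis n0 : (0 < n)%N.
Variables (B : O -> V -> V) (c : R).
Hypotheses (c0 : 0 < c) (Bc : forall o, continuous (B o)).
Hypothesis BW : forall o u, in_W u -> in_W (B o u).
Hypothesis B_tight : forall o u a b, in_W u -> B o u != 0 -> same_side (side o) a b ->
  `|u 0 a - u 0 b| < c.
Hypothesis B_neq0 : forall u, in_W u ->
  u + \sum_o \sum_(s | shuffle (side o) s) col_perm s^-1%g (B o (col_perm s u)) != 0.
Implicit Types (u t v : V) (s : 'S_n).

(** A continuous substitute for the indicator that [t] increases along [s] inside each cluster. *)
Definition order_weight o s (a : R) t : R :=
  \prod_(d : 'I_n * 'I_n | (d.1 < d.2)%N && same_side (side o) d.1 d.2)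
    clamp01 (a * (t 0 (s d.2) - t 0 (s d.1))).

(* For [a] the inverse of the separation, close points of one cluster are told apart by [t], and
   on configurations sorted by [t] the weights single out the shuffles. *)
Definition raw_field (a : R) u t : V :=
  (c * a) *: center u + \sum_o \sum_s
    order_weight o s a t *: col_perm s^-1%g (B o (col_perm s ((c * a) *: center u))).

Lemma order_weight_col_perm o s s' a t : order_weight o s a (col_perm s' t) = order_weight o (s *
  s') a t.
Proof. by apply: eq_bigr => d _; rewrite !mxE !permM. Qed.

Lemma raw_field_col_perm s a u t : raw_field a (col_perm s u) (col_perm s t) = col_perm s
  (raw_field a u t).
Proof.
rewrite /raw_field col_permD col_permZ center_col_perm; congr (_ + _).
rewrite col_perm_sum; apply: eq_bigr => o _; rewrite col_perm_sum.
rewrite (reindex_inj (mulIg s^-1%g)) /=; apply: eq_bigr => s' _.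
rewrite order_weight_col_perm mulgKV [RHS]col_permZ; congr (_ *: _).
by rewrite -[X in B o (col_perm _ X)]col_permZ [RHS]col_permA invMg invgK (col_permA s) mulgVK.
Qed.

Lemma raw_field_W a u t : in_W (raw_field a u t).
Proof.
have cW : in_W ((c * a) *: center u) by apply: in_W_scale; exact: in_W_center.
apply: in_W_add => //; apply: in_W_sum => o _; apply: in_W_sum => s _; apply: in_W_scale.
by apply: in_W_col_perm; apply: BW; exact: in_W_col_perm.
Qed.

(** By equivariance [t] may be taken nondecreasing. Where a term of [B] is nonzero, points of one
    cluster are closer in [u] than the separation, so at least that far apart in [t]. Each weight
    then is 1 for a shuffle and 0 for any other permutation, which is the situation of [B_neq0]. *)
Lemma raw_field_neq0 u t : planar_conf u t -> raw_field (separation u t)^-1 u t != 0.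
Proof.
move=> ut; have [s hs] := exists_sort t.
have -> : u = col_perm s^-1%g (col_perm s u) by rewrite col_permK.
have -> : t = col_perm s^-1%g (col_perm s t) by rewrite col_permK.
rewrite separation_col_perm raw_field_col_perm.
suff h : raw_field (separation (col_perm s u) (col_perm s t))^-1 (col_perm s u) (col_perm s t) != 0.
  by apply: contra h => /eqP/(congr1 (col_perm s)); rewrite col_permKV col_perm0 => ->.
have {}ut : planar_conf (col_perm s u) (col_perm s t).
  by move=> a b ab; rewrite !mxE; apply: ut; rewrite (inj_eq (@perm_inj _ s)).
have {hs} : forall a b : 'I_n, (a <= b)%N -> col_perm s t 0 a <= col_perm s t 0 b.
  by move=> a b ab; rewrite !mxE; exact: hs.
move: (col_perm s u) (col_perm s t) ut => {s} {}u {}t ut sorted_t.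
have r0 := separation_gt0 ut; set r := separation u t in r0 *.
pose v := (c * r^-1) *: center u.
have vW : in_W v by apply: in_W_scale; exact: in_W_center.
suff -> : raw_field r^-1 u t = v + \sum_o \sum_(s | shuffle (side o) s) col_perm s^-1%g (B o
  (col_perm s v)).
  exact: B_neq0.
congr (_ + _); apply: eq_bigr => o _; rewrite [RHS]big_mkcond /=; apply: eq_bigr => s _.
rewrite -/v; have [->|Bv] := eqVneq (B o (col_perm s v)) 0.
  by rewrite col_perm0 scaler0 if_same.
have far (a b : 'I_n) : (a < b)%N -> same_side (side o) a b -> r <= `|t 0 (s a) - t 0 (s b)|.
  have vE j : col_perm s v 0 j = c / r * center u 0 (s j) by rewrite mxE /v mxE.
  move=> ab ss; have := B_tight (in_W_col_perm s vW) Bv ss; rewrite !vE -mulrBr center_diff => h.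
  have sab : s a != s b by rewrite (inj_eq (@perm_inj _ s)); apply: contraTneq ab => ->; rewrite ltnn.
  have : r <= gap u t (s a) (s b) by exact: separation_le.
  rewrite le_max leNgt => /orP[|//]; suff -> : `|u 0 (s a) - u 0 (s b)| < r by [].
  move: h; rewrite normrM (ger0_norm (_ : 0 <= c / r)); last by rewrite divr_ge0 // ltW.
  by rewrite -mulrA gtr_pMr // mulrC ltr_pdivrMr // mul1r.
case: ifPn => [/shuffleP sh|nsh].
  rewrite /order_weight big1 ?scale1r // => -[a b] /= /andP[ab ss].
  have := far a b ab ss; have := sorted_t _ _ (ltnW (sh a b ab ss)).
  rewrite distrC => h; rewrite ger0_norm ?subr_ge0 // => h2.
  by rewrite clamp01_ge1 // mulrC ler_pdivlMr // mul1r.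
suff -> : order_weight o s r^-1 t = 0 by rewrite scale0r.
have [a [b [ab ss sab]]] : exists a b : 'I_n, [/\ (a < b)%N, same_side (side o) a b & (s b <= s a)%N].
  move: nsh; rewrite negb_forall => /existsP[a]; rewrite negb_forall => /existsP[b].
  by rewrite negb_imply -leqNgt => /andP[/andP[ab ss] sab]; exists a, b.
rewrite /order_weight (bigD1 (a, b)) /=; last by rewrite ab.
rewrite clamp01_le0 ?mul0r // mulr_ge0_le0 ?invr_ge0 ?(ltW r0) // subr_le0.
exact: sorted_t.
Qed.

Lemma continuous_raw_field : continuous (fun x : R * (V * V) => raw_field x.1 x.2.1 x.2.2).
Proof.
have ac : continuous (fun x : R * (V * V) => c * x.1).
  by apply: continuous_mulr; [exact: continuous_cst | move=> x; exact: cvg_fst].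
have sc : continuous (fun x : R * (V * V) => x.2) by move=> x; exact: cvg_snd.
have uc : continuous (fun x : R * (V * V) => x.2.1).
  by apply: (continuous_comp_fun (g := fst)) sc => x; exact: cvg_fst.
have tc : continuous (fun x : R * (V * V) => x.2.2).
  by apply: (continuous_comp_fun (g := snd)) sc => x; exact: cvg_snd.
have vc := continuous_scale ac (continuous_center uc).
apply: (continuous_add vc); apply: continuous_sum => o; apply: continuous_sum => s.
have h1 := continuous_col_perm (s := s^-1%g) (continuous_comp_fun (@Bc o) (continuous_col_perm (s
  := s) vc)).
apply: continuous_scale h1; apply: continuous_big => [f g fc gc|d]; first exact: continuous_mulr.
apply: continuous_clamp01; apply: continuous_mulr; first by move=> x; exact: cvg_fst.
exact: (continuous_subr (continuous_coord (j := s d.2) tc) (continuous_coord (j := s d.1) tc)).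
Qed.

(** Rescaled to have the separation as its length, so that it extends continuously by 0 over
    collisions. *)
Definition plane_field (x : V * V) : V :=
  let r := separation x.1 x.2 in
  (r / nrm (raw_field r^-1 x.1 x.2)) *: raw_field r^-1 x.1 x.2.

Lemma plane_field_neq0 u t : planar_conf u t -> plane_field (u, t) != 0.
Proof.
move=> ut; rewrite scaler_eq0 mulf_eq0 invr_eq0 nrm_eq0 (negPf (raw_field_neq0 ut)) !orbF.
by rewrite gt_eqF // separation_gt0.
Qed.

Lemma plane_field_W x : in_W (plane_field x).
Proof. by apply: in_W_scale; exact: raw_field_W. Qed.

Lemma plane_field_col_perm s u t : plane_field (col_perm s u,
  col_perm s t) = col_perm s (plane_field (u, t)).
Proof. by rewrite /plane_field /= separation_col_perm raw_field_col_perm nrm_col_perm col_permZ. Qed.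

Lemma plane_field_le x j : `|plane_field x 0 j| <= separation x.1 x.2.
Proof.
apply: le_trans (coord_nrm _ j) _; rewrite nrmZ; set w := raw_field _ _ _.
have r0 := separation_ge0 x.1 x.2; have [->|w0] := eqVneq w 0; first by rewrite nrm0 mulr0.
by rewrite normrM (ger0_norm r0) ger0_norm ?invr_ge0 ?nrm_ge0 // divfK // nrm_eq0.
Qed.

Lemma continuous_plane_field : continuous plane_field.
Proof.
have uc : continuous (fun x : V * V => x.1) by move=> x; exact: cvg_fst.
have tc : continuous (fun x : V * V => x.2) by move=> x; exact: cvg_snd.
have rc : continuous (fun x : V * V => separation x.1 x.2) by exact: continuous_separation.
move=> x; have [r0|r0] := eqVneq (separation x.1 x.2) 0.
  apply: cvg_rV => j; have -> : plane_field x 0 j = 0.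
    by apply/eqP; rewrite -normr_le0 -r0 plane_field_le.
  apply/cvgr0Pnorm_lt => e e0.
  have /cvgr_lt /(_ e) := rc x; rewrite r0 => /(_ e0); apply: filterS => z; apply: le_lt_trans.
  exact: plane_field_le.
have ut : planar_conf x.1 x.2.
  move=> a b ab; have [e1|] := eqVneq (x.1 0 a) (x.1 0 b); last by left.
  right; apply: contra r0 => /eqP e2; rewrite -normr_le0 ger0_norm ?separation_ge0 //.
  by apply: (le_trans (separation_le _ _ ab)); rewrite /gap e1 e2 !subrr normr0 maxxx.
have ic : (separation z.1 z.2)^-1 @[z --> x] --> (separation x.1 x.2)^-1.
  by apply: cvgV => //; exact: rc.
have pc : ((separation z.1 z.2)^-1, z) @[z --> x] --> ((separation x.1 x.2)^-1, x).
  exact: (cvg_pair ic cvg_id).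
have wc : raw_field (separation z.1 z.2)^-1 z.1 z.2 @[z --> x] -->
  raw_field (separation x.1 x.2)^-1 x.1 x.2.
  exact: (cvg_comp _ _ pc (@continuous_raw_field _)).
have nc : nrm (raw_field (separation z.1 z.2)^-1 z.1 z.2) @[z --> x] -->
    nrm (raw_field (separation x.1 x.2)^-1 x.1 x.2).
  apply: (cvg_comp _ _ wc); have h : continuous (fun v : V => nrm v); last exact: h.
  by apply: continuous_nrm => v; exact: cvg_id.
rewrite /plane_field; apply: cvgZ wc; apply: cvgM; first exact: rc.
by apply: cvgV nc; rewrite nrm_eq0 raw_field_neq0.
Qed.
End PlaneField.

(** * Centres of the inserted spheres *)

Section Centers.
Variables (R : realType) (n : nat).
Notation V := 'rV[R]_n.
Notation ones := (@ones R n).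
Hypothesis n6 : (6 <= n)%N.

Let j0 : 'I_n := Ordinal (leq_trans (isT : 0 < 6) n6)%N.
Let j1 : 'I_n := Ordinal (leq_trans (isT : 1 < 6) n6)%N.
Let j2 : 'I_n := Ordinal (leq_trans (isT : 2 < 6) n6)%N.
Fact last_lt : (n.-1 < n)%N. Proof. by move: n6; lia. Qed.
Let jl : 'I_n := Ordinal last_lt.

Lemma dot_delta (u : V) j : dot u (delta_mx 0 j) = u 0 j.
Proof.
rewrite /dot (bigD1 j) //= big1 ?addr0 => [|k kj]; first by rewrite mxE !eqxx mulr1.
by rewrite mxE (negPf kj) andbF mulr0.
Qed.

Lemma in_W_deltaB i j : in_W (delta_mx 0 i - delta_mx 0 j : V).
Proof. by rewrite /in_W dotC dotBr !dot_delta !mxE subrr. Qed.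

Definition tail (i : nat) : V := \row_j if (j < i)%N then 0 else (n - i)%:R^-1.

Lemma tail_sum i : (0 < i < n)%N -> dot (tail i) ones = 1.
Proof.
move=> i_n; rewrite -[RHS](right_sum_spread R i_n) /right_sum [RHS]big_mkcond /=.
apply: eq_bigr => j _; rewrite !mxE mulr1.
by case: ltnP.
Qed.

(* The coordinates 0 and 1 distinguish different values of [e]; the last coordinate exceeds the
   absolute values of the negative ones, so that no two of these vectors are antipodal. *)
Definition two_clusters (i : nat) (e : R) : V :=
  i%:R *: spread R n i + (i%:R / 2) *: (delta_mx 0 jl - tail i) + e *: (delta_mx 0 j1 - delta_mx 0 j0).

(** An axis in W orthogonal to every centre, whose entries at 0, 1, 2 are -1 - e, -1 + e, -1.
    Reflecting in it as well changes the determinant without affecting the image of the centre; this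
    needs three points in the left cluster. *)
Definition twist : V := delta_mx 0 j0 + delta_mx 0 j1 - 2 *: delta_mx 0 j2.

Section Side.
Variables (i : nat) (e : R).
Hypotheses (i3 : (3 <= i)%N) (i_n : (i < n)%N).

Let i_n' : (0 < i < n)%N. Proof. by move: i3 i_n; lia. Qed.
Let i_gt : (3 : R) <= i%:R. Proof. by rewrite ler_nat. Qed.
Let ni_gt : (0 : R) < (n - i)%:R. Proof. by rewrite ltr0n subn_gt0. Qed.

Lemma two_clusters_W : in_W (two_clusters i e).
Proof.
apply: in_W_add; last by apply: in_W_scale; exact: in_W_deltaB.
apply: in_W_add; apply: in_W_scale; first exact: spread_W.
by rewrite /in_W dotBl tail_sum // dotC dot_delta mxE subrr.
Qed.

Lemma two_clusters_left (j : 'I_n) : (j < i)%N ->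
  two_clusters i e 0 j = -1 + e * ((j == j1)%:R - (j == j0)%:R).
Proof.
move=> ji; have jl' : (j == jl) = false.
  by apply/negbTE; apply: contraTneq ji => -> /=; move: i_n; lia.
have i0 : (i%:R : R) != 0 by rewrite gt_eqF //; have := i_gt; lra.
by rewrite !mxE ji jl' !eqxx /= subrr mulr0 addr0 mulrN divff.
Qed.

Lemma two_clusters_right (j : 'I_n) : (i <= j)%N ->
  two_clusters i e 0 j = i%:R / (2 * (n - i)%:R) + i%:R / 2 * (j == jl)%:R.
Proof.
move=> ij; have e1' : (j == j1) = false.
  by apply/negbTE; apply: contraTneq ij => -> /=; move: i3; lia.
have e0' : (j == j0) = false.
  by apply/negbTE; apply: contraTneq ij => -> /=; move: i3; lia.
rewrite !mxE ltnNge ij e1' e0' !eqxx /= subrr mulr0 addr0; field.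
by rewrite gt_eqF.
Qed.

Hypotheses (e0 : 0 < e) (e2 : e <= 1/2).

Lemma two_clusters_neg (j : 'I_n) : (j < i)%N -> two_clusters i e 0 j < 0.
Proof.
move=> ji; rewrite two_clusters_left //; have := e0; have := e2.
by case: (j == j1); case: (j == j0); rewrite /= ?subrr ?subr0 ?sub0r; lra.
Qed.

Lemma two_clusters_pos (j : 'I_n) : (i <= j)%N -> 0 < two_clusters i e 0 j.
Proof.
move=> ij; rewrite two_clusters_right //; apply: ltr_pwDl.
  by rewrite divr_gt0 ?mulr_gt0 //; have := i_gt; lra.
by rewrite mulr_ge0 // divr_ge0.
Qed.

(** The last entry exceeds 3/2 because i >= 3, and no entry is below -3/2 because e <= 1/2. *)
Lemma two_clusters_skew l : - two_clusters i e 0 l < two_clusters i e 0 jl.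
Proof.
have h : 3 / 2 < two_clusters i e 0 jl.
  rewrite two_clusters_right /=; last by move: i_n; lia.
  rewrite eqxx mulr1; have : 0 < i%:R / (2 * (n - i)%:R) :> R.
    by rewrite divr_gt0 ?mulr_gt0 //; have := i_gt; lra.
  by have := i_gt; lra.
have [li|li] := ltnP l i; last by have := two_clusters_pos li; lra.
move: h; rewrite (two_clusters_left li); have := e0; have := e2.
by case: (l == j1); case: (l == j0); rewrite /= ?subrr ?subr0 ?sub0r; lra.
Qed.

Lemma dot_twist : dot (two_clusters i e) twist = 0.
Proof.
rewrite /twist dotBr dotDr dotZr !dot_delta !two_clusters_left /=; try by move: i3; lia.
by ring.
Qed.

Lemma two_clusters_neq0 : two_clusters i e != 0.
Proof.
have := @two_clusters_neg j0 (leq_trans (isT : 0 < 3)%N i3).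
by apply: contraTneq => ->; rewrite mxE ltxx.
Qed.
End Side.

Lemma twist_W : in_W twist.
Proof. by rewrite /in_W dotC /twist !dotE !dot_delta !mxE; ring. Qed.

Lemma twist_neq0 : twist != 0.
Proof. by apply/eqP => /rowP/(_ j0)/eqP; rewrite !mxE -!val_eqE /= addr0 mulr0 subr0 oner_eq0. Qed.

Lemma two_clusters_inj i e e' (c c' : R) : (3 <= i < n)%N -> c != 0 ->
  c *: two_clusters i e = c' *: two_clusters i e' -> e = e'.
Proof.
move=> /andP[i3 i_n] c0 E.
have i0 : (j0 < i)%N by exact: leq_trans i3.
have i2 : (j2 < i)%N by exact: leq_trans i3.
have := congr1 (fun v : V => v 0 j2) E; have := congr1 (fun v : V => v 0 j0) E.
rewrite [LHS]mxE [RHS]mxE !(two_clusters_left _ i3 i_n) //.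
move=> E0; rewrite [LHS]mxE [RHS]mxE !(two_clusters_left _ i3 i_n) //.
move: E0; rewrite /= !subrr !mulr0 !addr0 !mulrN1 => E0 /oppr_inj E2.
rewrite -E2 in E0; have := mulfI c0 E0.
by rewrite sub0r !mulrN1 => /addrI/oppr_inj.
Qed.
End Centers.

Theorem exists_plane_field (R : realType) (n : nat) (a : nat -> int) : (6 <= n)%N ->
  1 + \sum_(i < n | (3 <= i)%N) a i * ('C(n, i))%:Z = 0 ->
  exists g : 'rV[R]_n * 'rV[R]_n -> 'rV[R]_n, [/\ continuous g, forall x, in_W (g x),
    forall s u t, g (col_perm s u, col_perm s t) = col_perm s (g (u, t)) &
    forall u t, planar_conf u t -> g (u, t) != 0].
Proof.
move=> n6 a_sum.
pose cnt (i : 'I_n) : nat := if (3 <= i)%N then `|a i|%N else 0%N.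
pose Q := {i : 'I_n & 'I_(cnt i)}.
(* Distinct values in (0,1/2] for the [|a i|] copies with the same i. *)
pose eps (q : Q) : R := ((tagged q : nat).+2%:R)^-1.
pose base (q : Q) : 'rV[R]_n := two_clusters n6 (tag q) (eps q).
have eps0 q : 0 < eps q by rewrite invr_gt0 ltr0n.
have eps2 q : eps q <= 1 / 2 by rewrite div1r lef_pV2 ?posrE ?ltr0n // ler_nat.
have q3 (q : Q) : (3 <= tag q)%N.
  by case: q => i [k hk] /=; move: hk; rewrite /cnt; case: ifP.
have qn (q : Q) : (tag q < n)%N by exact: ltn_ord.
have qr (q : Q) : (3 <= tag q < n)%N by rewrite q3 qn.
have base0 q : base q != 0 by exact: two_clusters_neq0.
pose p q := (nrm (base q))^-1 *: base q.
have inv0 q : 0 < (nrm (base q))^-1 by rewrite invr_gt0 nrm_gt0.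
have pE q j : p q 0 j = (nrm (base q))^-1 * base q 0 j by rewrite mxE.
have p1 q : nrm (p q) = 1 by exact: nrm_normalize.
have pW q : in_W (p q) by apply: in_W_scale; apply: two_clusters_W.
have p_neg (q : Q) (j : 'I_n) : (j < tag q)%N -> p q 0 j < 0.
  by move=> jq; rewrite pE pmulr_rlt0 //; exact: two_clusters_neg.
have p_pos (q : Q) (j : 'I_n) : (tag q <= j)%N -> 0 < p q 0 j.
  by move=> jq; rewrite pE pmulr_rgt0 //; exact: two_clusters_pos.
have p_skew q : exists j, forall l, - p q 0 l < p q 0 j.
  exists (Ordinal (last_lt n6)) => l; rewrite !pE -mulrN ltr_pM2l //.
  exact: two_clusters_skew.
have p_inj : injective p.
  move=> q q' E; have lt_tag (x x' : Q) : p x = p x' -> ~ (tag x < tag x')%N.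
    by move=> e h; have := p_pos x (tag x) (leqnn _); rewrite e ltNge (ltW (p_neg _ _ h)).
  have tE : tag q = tag q'.
    by apply: val_inj; case: (ltngtP (tag q) (tag q')) => // /lt_tag[].
  case: q q' E tE => i k [i' k'] E /= tE; rewrite -tE in k' E *.
  have := @two_clusters_inj R n n6 i (eps (existT _ i k)) (eps (existT _ i k')) _ _ (qr (existT _ i
    k)) _ E.
  rewrite gt_eqF // => /(_ isT)/invr_inj/eqP; rewrite eqr_nat => /eqP[kE].
  by congr existT; apply: val_inj.
pose tw := twist R n6.
(* The reflection along the centre has determinant -1, as wanted for negative [a i]; otherwise a
   second reflection, fixing the centre, makes it 1. *)
pose M (q : Q) : 'M[R]_n := if a (tag q) < 0 then refl_mx (p q) else refl_mx (p q) *m refl_mx tw.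
have p0 q : p q != 0 by rewrite -nrm_gt0 p1.
have p_tw q : dot (p q) tw = 0 by rewrite dotZl dot_twist // mulr0.
have fix1 v : in_W v -> ones R n *m refl_mx v = ones R n.
  by move=> vW; rewrite mul_refl_mx refl_fix // dotC.
have M_ok q : [/\ isometry (M q), ones R n *m M q = ones R n & p q *m M q = - p q].
  rewrite /M; case: ifP => _; split.
  - exact: isometry_refl.
  - exact: fix1.
  - by rewrite mul_refl_mx refl_self.
  - by apply: isometryM; exact: isometry_refl.
  - by rewrite mulmxA !fix1 //; exact: twist_W.
  by rewrite mulmxA !mul_refl_mx refl_self refl_opp refl_fix.
have M_det q : \det (M q) = if a (tag q) < 0 then -1 else 1.
  rewrite /M; case: ifP => _; first exact: det_refl_mx.
  by rewrite det_mulmx !det_refl_mx ?mulrNN ?mulr1 //; exact: twist_neq0.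
have det_sum : 1 + \sum_(q : Q) ('C(n, tag q))%:R * \det (M q) = 0 :> R.
  have := congr1 (fun z : int => z%:~R : R) a_sum;
    rewrite rmorph0 rmorphD rmorph1 rmorph_sum /= => E; rewrite -[RHS]E.
  congr (_ + _); transitivity (\sum_(i < n) \sum_(k < cnt i) ('C(n,
    i))%:R * (if a i < 0 then -1 else 1) : R).
    by rewrite sig_big_dep /=; apply: eq_bigr => q _; rewrite M_det.
  rewrite [RHS]big_mkcond /=; apply: eq_bigr => i _.
  rewrite sumr_const card_ord /cnt; case: (3 <= i)%N; last by rewrite mulr0n.
  rewrite intrM [RHS]mulrC -mulrnAr; congr (_ * _).
  case: (ltP (a i) 0) => h.
    by rewrite -mulr_natr mulN1r pmulrn abszE ltr0_norm // mulrNz opprK.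
  by rewrite pmulrn abszE ger0_norm.
have side_n (q : Q) : (0 < tag q < n)%N by rewrite qn (leq_trans _ (q3 q)).
have n3 : (2 < n)%N by exact: (leq_trans _ n6).
have n0 : (0 < n)%N by exact: (leq_trans _ n6).
have [B [c [c0 Bc BW Bt B0]]] :=
  @local_fields R n Q (fun q : Q => tag q : nat) p M n3 side_n p1 pW p_inj p_neg p_pos p_skew M_ok
    det_sum.
exists (plane_field (side_of (fun q : Q => tag q : nat)) B c); split.
- exact: (continuous_plane_field n0 c0 Bc Bt B0).
- by move=> x; exact: plane_field_W.
- by move=> s u t; exact: plane_field_col_perm.
by move=> u t ut; exact: (plane_field_neq0 n0 c0 Bt B0).
Qed.

(** * Higher dimensions *)

Section Suspension.
Variables (R : realType) (k n : nat).
Notation V := 'rV[R]_n.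
Notation conf := ('I_k.+2 -> 'I_n -> R).
Hypothesis n0 : (0 < n)%N.
Variable g : V * V -> V.
Hypotheses (gc : continuous g) (gW : forall x, in_W (g x)).
Hypothesis g_perm : forall s u t, g (col_perm s u, col_perm s t) = col_perm s (g (u, t)).
Hypothesis g_neq0 : forall u t, planar_conf u t -> g (u, t) != 0.

Definition suspension_row (X : 'M[R]_(k.+2, n)) (l : 'I_k.+1) : V :=
  if l == ord0 then g (row ord0 X, row (lift ord0 ord0) X) else center (row (lift ord0 l) X).

Definition suspension_nrm (X : 'M[R]_(k.+2, n)) : R :=
  Num.sqrt (\sum_l dot (suspension_row X l) (suspension_row X l)).

Definition suspension (x : conf) (l : 'I_k.+1) (j : 'I_n) : R :=
  let X := \matrix_(i, j) x i j in suspension_row X l 0 j / suspension_nrm X.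

Lemma suspension_row_perm s X l : suspension_row (col_perm s X) l = col_perm s (suspension_row X l).
Proof.
have rp i : row i (col_perm s X) = col_perm s (row i X) by apply/rowP => j; rewrite !mxE.
by rewrite /suspension_row !rp g_perm center_col_perm; case: ifP.
Qed.

Lemma suspension_row_W X l : in_W (suspension_row X l).
Proof. by rewrite /suspension_row; case: ifP => _; [exact: gW | exact: in_W_center]. Qed.

(** If the first two rows do not separate all columns, two columns agreeing there differ in some
    later row, which is then not constant and stays nonzero after centring. *)
Lemma suspension_nrm_gt0 (x : conf) : is_conf x -> 0 < suspension_nrm (\matrix_(i, j) x i j).
Proof.
move=> xc; set X := \matrix_(i, j) _.
suff [l hl] : exists l, suspension_row X l != 0.
  rewrite sqrtr_gt0 (bigD1 l) //=; apply: ltr_pwDl; first by rewrite dot_gt0.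
  by apply: sumr_ge0 => i _; exact: dot_ge0.
have [h|h] := pselect (planar_conf (row ord0 X) (row (lift ord0 ord0) X)).
  by exists ord0; rewrite /suspension_row eqxx g_neq0.
have [a [b [ab e0 e1]]] : exists a b : 'I_n, [/\ a != b,
  x ord0 a = x ord0 b & x (lift ord0 ord0) a = x (lift ord0 ord0) b].
  apply: contrapT => hn; apply: h => a b ab; rewrite !mxE.
  have [e0|] := eqVneq (x ord0 a) (x ord0 b); last by left.
  have [e1|] := eqVneq (x (lift ord0 ord0) a) (x (lift ord0 ord0) b); last by right.
  by case: hn; exists a, b.
have [i xi] := xc a b (elimN eqP ab).
have [l iE|iE] := unliftP (ord0 : 'I_k.+2) i; rewrite iE in xi; last by case: xi.
have [lE|l0] := eqVneq l ord0; first by case: xi; rewrite lE.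
exists l; rewrite /suspension_row (negPf l0); apply/eqP => /rowP c0.
apply: xi; apply/eqP; rewrite -subr_eq0; have := center_diff (row (lift ord0 l) X) a b.
by rewrite !c0 !mxE subrr => <-.
Qed.

Lemma continuous_suspension_row l : continuous (fun X => suspension_row X l).
Proof.
have rc (i : 'I_k.+2) : continuous (fun X : 'M[R]_(k.+2, n) => row i X).
  apply: continuous_rV => j; have -> : (fun X : 'M[R]_(k.+2, n) => row i X 0 j) = (fun X => X i j).
    by apply/funext => X; rewrite mxE.
  exact: coord_continuous.
rewrite /suspension_row; case: (l == ord0); last exact: (continuous_center (rc _)).
exact: (continuous_comp_fun gc (continuous_pair (rc _) (rc _))).
Qed.

Lemma continuous_suspension_nrm : continuous suspension_nrm.
Proof.
apply: (continuous_comp_fun (@sqrt_continuous R)); apply: continuous_sumr => l.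
by apply: continuous_dot; exact: continuous_suspension_row.
Qed.

Lemma suspension_cvg (x : conf) (eps : R) : is_conf x -> 0 < eps -> exists delta : R, 0 < delta /\
  forall y, (forall i j, `|y i j - x i j| < delta) ->
    forall l j, `|suspension y l j - suspension x l j| < eps.
Proof.
move=> xc e0; set X : 'M[R]_(k.+2, n) := \matrix_(i, j) x i j.
have : \forall Y \near X, forall (l : 'I_k.+1) (j : 'I_n),
   `|suspension_row X l 0 j / suspension_nrm X - suspension_row Y l 0 j / suspension_nrm Y| < eps.
  apply: (@filter_forall _ _ _ _ (nbhs_filter X)) => l;
    apply: (@filter_forall _ _ _ _ (nbhs_filter X)) => j.
  have h1 := continuous_coord (j := j) (@continuous_suspension_row l) (x := X).
  have h2 : (suspension_nrm Y)^-1 @[Y --> X] --> (suspension_nrm X)^-1.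
    by apply: (cvgV _ (@continuous_suspension_nrm X)); rewrite gt_eqF // suspension_nrm_gt0.
  have h3 := cvgM (FF := nbhs_filter X) h1 h2.
  by move/cvgrPdist_lt: h3 => /(_ eps e0).
move=> /nbhs_ballP[delta /= d0 hd]; exists delta; split=> // y hy l j.
rewrite distrC; apply: (hd (\matrix_(i, j) y i j) _ l j).
by split=> // i j'; rewrite !mxE /ball /= distrC; exact: hy.
Qed.

End Suspension.

Theorem exists_equivariant_map (R : realType) (k n : nat) (a : nat -> int) : (6 <= n)%N ->
  1 + \sum_(i < n | (3 <= i)%N) a i * ('C(n, i))%:Z = 0 ->
  exists f : ('I_k.+2 -> 'I_n -> R) -> 'I_k.+1 -> 'I_n -> R,
  [/\ forall x, is_conf x -> forall l, \sum_j f x l j = 0,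
      forall x, is_conf x -> \sum_l \sum_j f x l j * f x l j = 1,
      forall (s : 'S_n) x, is_conf x -> forall l j, f (fun i b => x i (s b)) l j = f x l (s j) &
      forall x, is_conf x -> forall eps : R, 0 < eps -> exists delta : R, 0 < delta /\
        forall y, is_conf y -> (forall i j, `|y i j - x i j| < delta) ->
        forall l j, `|f y l j - f x l j| < eps].
Proof.
move=> n6 a_sum; have [g [gc gW gp g0]] := exists_plane_field R n6 a_sum.
have n0 : (0 < n)%N by exact: (leq_trans _ n6).
exists (suspension g); split.
- move=> x _ l; rewrite /suspension -mulr_suml; set w := suspension_row _ _ _.
  have := suspension_row_W n0 gW (\matrix_(i, j) x i j) l; rewrite -/w /in_W /dot.
  rewrite (eq_bigr (fun j => w 0 j)) => [->|j _]; first by rewrite mul0r.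
  by rewrite !mxE mulr1.
- move=> x xc; rewrite /suspension /=; set N := suspension_nrm _ _.
  have N0 : 0 < N by exact: suspension_nrm_gt0.
  transitivity (N ^- 2 * \sum_l dot (suspension_row g (\matrix_(i,
    j) x i j) l) (suspension_row g (\matrix_(i, j) x i j) l)).
    rewrite mulr_sumr; apply: eq_bigr => l _; rewrite /dot mulr_sumr; apply: eq_bigr => j _.
    by rewrite mulrACA -invfM -expr2 mulrC.
  rewrite -[X in _ * X]sqr_sqrtr; last by apply: sumr_ge0 => l _; exact: dot_ge0.
  by rewrite mulVf // expf_neq0 // gt_eqF.
- move=> s x _ l j; rewrite /suspension /=.
  have -> : \matrix_(i, j) x i (s j) = col_perm s (\matrix_(i, j) x i j).
    by apply/matrixP => i j'; rewrite !mxE.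
  rewrite /suspension_nrm suspension_row_perm // mxE; congr (_ / Num.sqrt _).
  by apply: eq_bigr => l' _; rewrite suspension_row_perm // dot_col_perm.
move=> x xc eps e0; have [delta [d0 hd]] := suspension_cvg gc g0 xc e0.
by exists delta; split=> // y _; exact: hd.
Qed.

Theorem theorem1p1 (d n : nat) (hd : (2 <= d)%N) (hn : (2 <= n)%N) :
  (exists f : mat d n -> mat (d - 1) n,
      (forall x : mat d n, in_conf x -> in_sphere_W (f x)) /\
      continuous_on_conf f /\
      equivariant_on_conf f)
  <-> ~ prime_power n.
Proof.
case: d hd => [|[|k]] // _; have -> : (k.+2 - 1 = k.+1)%N by [].
split=> [[f [fW [fc fe]]] [p [e [pr_p [_ nE]]]]|npp].
  apply: (@no_equivariant_map R k.+1 n f p e pr_p nE isT).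
  - by move=> x /fW[h _] l; exact: h.
  - by move=> x /fW[_ h]; exact: h.
  - by move=> s x xc l j; exact: fe.
  move=> x xc eps /RltP e0; have [delta [d0 hd]] := fc x xc eps e0.
  exists delta; split=> [|y yc hy l j]; first exact/RltP.
  rewrite -RabsE; apply/RltP; apply: hd => // i b.
  by rewrite RabsE; apply/RltP; exact: hy.
have [n6 [a a_sum]] := not_prime_power_comb hn npp.
have [f [f_sum f_norm f_perm f_cont]] := @exists_equivariant_map R k n a n6 a_sum.
exists f; split; [|split].
- by move=> x xc; split; [exact: f_sum | exact: f_norm].
- move=> x xc eps /RltP e0; have [delta [d0 hd]] := f_cont x xc eps e0.
  exists delta; split=> [|y yc hy l j]; first exact/RltP.
  rewrite RabsE; apply/RltP; apply: hd => // i b.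
  by rewrite -RabsE; apply/RltP; exact: hy.
by move=> s x xc l j; exact: f_perm.
Qed.
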